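(* Let $G$ be a $3$-connected cubic planar graph with a fixed plane embedding and a facial $2$-factor $\mathcal{Q}$ such that every face not in $\mathcal{Q}$ is a quadrilateral or a hexagon (faces in $\mathcal{Q}$ arbitrary). Let $H=G/\mathcal{Q}$ and assume the outer face of $H$ is a triangle $T$, and that $T$ and every triangle of $H$ contains an even number of vertices of $H$ in its interior. If no direct successor (of any triangle) in $H$ contains a separating digon inside it, then $H$ has a spanning tree of faces all of which are triangles, and consequently $G$ is hamiltonian.
   Context: A facial $2$-factor is a $2$-factor whose cycles are face boundaries; $H=G/\mathcal{Q}$ is obtained by contracting each $\mathcal{Q}$-face to a single vertex. Conventions: two edges with the same ends whose digon contains no vertex inside are treated as a single edge. For a cycle $C$, $int(C)$ is its bounded region; a cycle $C'$ is inside $C$ if $int(C')\subseteq int(C)$. A digon or triangle is separating if both its interior and exterior contain vertices. A direct successor of a triangle $T_1$ is a separating triangle $T_2\ne T_1$ with $int(T_2)\subset int(T_1)$ such that no separating triangle $T_3\notin\{T_1,T_2\}$ has $int(T_2)\subset int(T_3)\subset int(T_1)$. Spanning tree of faces: for a set $\mathcal{T}$ of bounded faces with pairwise edge-disjoint boundaries covering all vertices of $H$, the subgraph $H_{\mathcal{T}}$ formed by their edges is a spanning tree of faces if the bipartite graph on $V(H)\cup\mathcal{T}$ with $x\sim F$ iff $x$ lies on $F$ is a tree. *)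

(* Defs.v *)
(* Plane cubic graphs are encoded as combinatorial maps
   (rotation systems) on a finite type of darts. *)
From mathcomp Require Import all_boot.
Set Implicit Arguments. Unset Strict Implicit. Unset Printing Implicit Defensive.

Definition gconnected (T : finType) (V : pred T) (adj : rel T) :=
  forall a b, V a -> V b -> connect (fun u w => [&& V u, V w & adj u w]) a b.
Definition gacyclic (T : finType) (V : pred T) (adj : rel T) :=
  forall c : seq T, all V c -> uniq c -> 2 < size c -> ~~ cycle adj c.
Definition is_tree (T : finType) (V : pred T) (adj : rel T) :=
  gconnected V adj /\ gacyclic V adj.

(* ---------- the plane graph G as a combinatorial map ----------
   darts D, edge involution e, vertex rotation n; faces = orbits of
   gface = n o e (a dart d is the outgoing dart of its face corner). *)
Definition gface (D : finType) (e n : D -> D) (d : D) := n (e d).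
Definition gvert (D : finType) (n : D -> D) (x : D) : {set D} :=
  [set y | fconnect n x y].
Definition gfaceset (D : finType) (e n : D -> D) (x : D) : {set D} :=
  [set y | fconnect (gface e n) x y].

Definition is_map (D : finType) (e n : D -> D) :=
  [/\ injective n, involutive e & forall d, e d != d].
Definition map_connected (D : finType) (e n : D -> D) :=
  forall x y, connect (fun a b => (b == e a) || (b == n a)) x y.
(* Euler's formula V - E + F = 2 (genus 0), with 2E = #darts *)
Definition planar_map (D : finType) (e n : D -> D) :=
  2 * (#|[set gvert n x | x : D]| + #|[set gfaceset e n x | x : D]|)
  = #|D| + 4.
Definition cubic (D : finType) (n : D -> D) := forall d, order n d = 3.
Definition simple_map (D : finType) (e n : D -> D) :=
  (forall d, ~~ fconnect n d (e d)) /\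
  (forall d1 d2, fconnect n d1 d2 -> fconnect n (e d1) (e d2) -> d1 = d2).
Definition avoid_conn (D : finType) (e n : D -> D) (a b x y : D) :=
  connect (fun u w => [&& ~~ fconnect n a w, ~~ fconnect n b w &
                          (w == e u) || (w == n u)]) x y.
Definition three_connected (D : finType) (e n : D -> D) :=
  4 <= #|[set gvert n x | x : D]| /\
  forall a b x y, ~~ fconnect n a x -> ~~ fconnect n b x ->
    ~~ fconnect n a y -> ~~ fconnect n b y -> avoid_conn e n a b x y.
Definition hamiltonian (D : finType) (e n : D -> D) :=
  exists s : seq D, [/\ 3 <= size s, uniq (map (gvert n) s),
    forall x, gvert n x \in map (gvert n) s &
    cycle (fun u w => fconnect n (e u) w) s].

(* facial 2-factor: a union Q of face orbits such that every vertex has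
   exactly one dart in Q (every vertex lies on exactly one Q-face, and
   Q-face boundaries are vertex-disjoint cycles) *)
Definition facial_2factor (D : finType) (e n : D -> D) (Q : {set D}) :=
  (forall d, (gface e n d \in Q) = (d \in Q)) /\
  (forall d, #|[set x in gvert n d | x \in Q]| = 1).

(* ---------- H = G / Q ----------
   darts of H: darts of edges not on Q (the perfect matching);
   rotation of H around the contracted face: nH (valid for cubic G) ;
   faces of H: orbits of fH = nH o e. *)
Definition Hdart (D : finType) (e : D -> D) (Q : {set D}) (d : D) :=
  (d \notin Q) && (e d \notin Q).
Definition nH (D : finType) (e n : D -> D) (Q : {set D}) (d : D) :=
  if Hdart e Q d then n (e (n d)) else d.
Definition fH (D : finType) (e n : D -> D) (Q : {set D}) (d : D) :=
  if Hdart e Q d then nH e n Q (e d) else d.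
Definition hvert (D : finType) (e n : D -> D) (Q : {set D}) (x : D) : {set D} :=
  [set y | fconnect (nH e n Q) x y].
Definition hface (D : finType) (e n : D -> D) (Q : {set D}) (x : D) : {set D} :=
  [set y | fconnect (fH e n Q) x y].

Definition hcycle (D : finType) (e n : D -> D) (Q : {set D}) (s : seq D) :=
  [&& all (Hdart e Q) s, uniq (map (hvert e n Q) s) &
      cycle (fun u w => fconnect (nH e n Q) (e u) w) s].
Definition htriangle (D : finType) (e n : D -> D) (Q : {set D}) (s : seq D) :=
  hcycle e n Q s && (size s == 3).
Definition hdigon (D : finType) (e n : D -> D) (Q : {set D}) (s : seq D) :=
  [&& hcycle e n Q s, size s == 2 &
      (if s is [:: a; b] then b != e a else false)].
Definition on_cycle_edge (D : finType) (e : D -> D) (s : seq D) (x : D) :=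
  (x \in s) || (e x \in s).
Definition on_cycle_vertex (D : finType) (e n : D -> D) (Q : {set D})
  (s : seq D) (x : D) := has (fun d => fconnect (nH e n Q) d x) s.

(* sides of a cycle: faces of H reachable from the outer face (face of the
   dart o) without crossing an edge of the cycle are exterior. *)
Definition dual_step (D : finType) (e n : D -> D) (Q : {set D}) (s : seq D)
  (u w : D) :=
  [&& Hdart e Q u, Hdart e Q w &
      (w == fH e n Q u) || ((w == e u) && ~~ on_cycle_edge e s u)].
Definition exterior (D : finType) (e n : D -> D) (Q : {set D}) (o : D)
  (s : seq D) (x : D) := connect (dual_step e n Q s) o x.
Definition interior_vertex (D : finType) (e n : D -> D) (Q : {set D}) (o : D)
  (s : seq D) (x : D) :=
  [&& Hdart e Q x, ~~ on_cycle_vertex e n Q s x & ~~ exterior e n Q o s x].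
Definition exterior_vertex (D : finType) (e n : D -> D) (Q : {set D}) (o : D)
  (s : seq D) (x : D) :=
  [&& Hdart e Q x, ~~ on_cycle_vertex e n Q s x & exterior e n Q o s x].
Definition n_inside (D : finType) (e n : D -> D) (Q : {set D}) (o : D)
  (s : seq D) := #|[set hvert e n Q x | x : D & interior_vertex e n Q o s x]|.
(* bounded region of the cycle, as its set of faces; empty digon faces
   (faces of length 2) are discarded (parallel-edge convention) *)
Definition region (D : finType) (e n : D -> D) (Q : {set D}) (o : D)
  (s : seq D) : {set D} :=
  [set x | [&& Hdart e Q x, ~~ exterior e n Q o s x &
               order (fH e n Q) x != 2]].
Definition separating (D : finType) (e n : D -> D) (Q : {set D}) (o : D)
  (s : seq D) :=
  [exists x, interior_vertex e n Q o s x] &&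
  [exists x, exterior_vertex e n Q o s x].
Definition direct_successor (D : finType) (e n : D -> D) (Q : {set D})
  (o : D) (t1 t2 : seq D) :=
  [/\ htriangle e n Q t1, htriangle e n Q t2, separating e n Q o t2,
      region e n Q o t2 \proper region e n Q o t1 &
      forall t3, htriangle e n Q t3 -> separating e n Q o t3 ->
        ~ (region e n Q o t2 \proper region e n Q o t3 /\
           region e n Q o t3 \proper region e n Q o t1)].

(* edges of H up to the convention: parallel edges bounding a digon with
   no vertex inside are the same edge *)
Definition same_edge (D : finType) (e n : D -> D) (Q : {set D}) (o : D)
  (x y : D) :=
  (y = x \/ y = e x) \/
  exists a b, [/\ hdigon e n Q [:: a; b], a = x \/ a = e x, b = y \/ b = e y &
                  n_inside e n Q o [:: a; b] = 0].

Definition tri_face (D : finType) (e n : D -> D) (Q : {set D}) (x : D) :=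
  (order (fH e n Q) x == 3) &&
  uniq [:: hvert e n Q x; hvert e n Q (fH e n Q x);
           hvert e n Q (fH e n Q (fH e n Q x))].

Definition inc_node (D : finType) (e n : D -> D) (Q : {set D}) (S : {set D})
  (p : {set D} * bool) :=
  if p.2 then [exists x, (x \in S) && (p.1 == hface e n Q x)]
  else [exists x, Hdart e Q x && (p.1 == hvert e n Q x)].
Definition inc_adj (D : finType) (p q : {set D} * bool) :=
  (p.2 != q.2) && (p.1 :&: q.1 != set0).

Definition spanning_tree_of_triangles (D : finType) (e n : D -> D)
  (Q : {set D}) (o : D) (S : {set D}) :=
  [/\ forall x, x \in S -> Hdart e Q x,
      forall x, x \in S -> hface e n Q x \subset S,
      forall x, x \in S -> ~~ fconnect (fH e n Q) o x,
      forall x, x \in S -> tri_face e n Q x &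
   [/\
      forall x y, x \in S -> y \in S -> ~~ fconnect (fH e n Q) x y ->
        ~ same_edge e n Q o x y,
      forall x, Hdart e Q x ->
        exists2 y, y \in S & hvert e n Q y = hvert e n Q x
    & is_tree (inc_node e n Q S) (@inc_adj D)]].

(* Main.v *)
(** Since [G] is 3-connected and cubic, the plane map [H] is loopless and its
    faces are triangles and digons.  By parity, for adjacent [u] and [v] only one
    triangle lies to the left of an edge from [u] to [v]: two such edges would
    form a 2-cycle with an odd number of vertices on either side, but the number
    of vertices of [H] is odd.  Merging parallel edges therefore turns the
    triangular faces into a triangulated sphere in which every 3-cycle has evenly
    many vertices inside.

    In such a sphere some set [T] of faces connects all [n] vertices and has
    [2 * #|T| + 1 = n].  Induction cuts the sphere along separating 3-cycles and
    glues the two trees; one of them contains the cutting triangle, the other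
    avoids it because it contains an adjacent face.  If there is no separating
    3-cycle, this is a case of linear matroid parity: attach to the face [uvw]
    the skew form [(x_v - x_u) /\ (x_w - x_u)] and take a generic linear
    combination of these forms.  Either its radical on the functions constant on
    one face is trivial, and [T] is extracted from the form, or a maximal edge
    set on which the radical stays large contradicts Euler's formula.

    The faces of [T] can be added one at a time so that each one meets the
    previous ones in one vertex.  Hence the incidence graph is a tree, and
    the boundary of the union of the faces of [T] is a single closed walk; it
    passes every edge end of [H], that is every vertex of [G], exactly once and
    so yields a Hamiltonian cycle. *)

(* The induction prescribes one face of [T]. Two faces of such a tree share at most one vertex,
   because [n = 2 * #|T| + 1] leaves no slack in counting vertices, so prescribing a face next to a
   triangle keeps that triangle out of [T]. The outer face is kept out of the final tree in the same
   way.

   Skew forms fit the problem because each face put into [T] lowers the dimension of the functions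
   constant on the chosen faces by two, and a skew form has even rank. As [n] is odd, a radical
   larger than the constants exceeds them by at least two; this slack of two is what the Euler count
   refutes. Generic coefficients are coefficients that maximise a sum of ranks.

   Plane topology enters through ranks. The sides of a loop or of a 2-cycle are level sets of a
   potential, whose existence is a dimension count based on Euler's formula. A sphere is a set of
   vertex triples with conditions on mod-2 boundaries, vertex links and the number of faces; Euler's
   inequality for the two pieces of a cut sphere shows that both are spheres again. *)
Require Import Defs.
From mathcomp Require Import all_boot.
From mathcomp Require Import all_order all_algebra zify ring lra.
From Stdlib Require Import Classical.
Set Implicit Arguments. Unset Strict Implicit. Unset Printing Implicit Defensive.
Import GRing.Theory Num.Theory Order.TTheory.

(* [lia] is very slow on cardinals and ranks unless they are first abstracted. *)
Ltac lia_card :=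
  repeat match goal with
  | |- context [card ?A] => let c := fresh in set c := card A; clearbody c
  | |- context [mxrank ?A] => let c := fresh in set c := mxrank A; clearbody c
  end; clear; lia.

(** * Skew forms and generic combinations *)

Section LinearAlgebra.
Variable F : realFieldType.
Local Open Scope ring_scope.

Lemma skew_unit_even r (B : 'M[F]_r) : B^T = - B -> B \in unitmx -> ~~ odd r.
Proof.
move=> skB uB; apply/negP => odd_r.
have := det_tr B; rewrite skB -scaleN1r detZ -signr_odd odd_r expr1 mulN1r => dB.
have /eqP : \det B = 0 by lra.
by move: uB; rewrite unitmxE unitfE => /negbTE ->.
Qed.

(** In the rank factorisation [A = C R], skewness turns [R] into [- B C^T] with [B = L *m R^T]
    square of size [\rank A]. This [B] is again skew, and it is invertible because [R] has full row
    rank. *)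
Lemma skew_rank_even n (A : 'M[F]_n) : A^T = - A -> ~~ odd (\rank A).
Proof.
move=> skA.
have /row_fullP [L LC] : row_full (col_base A) by exact: col_base_full.
have LA : L *m A = row_base A.
  transitivity (L *m (col_base A *m row_base A)); first by rewrite mulmx_base.
  by rewrite mulmxA LC mul1mx.
pose B := L *m (row_base A)^T.
have LB : (row_base A) = - (B *m (col_base A)^T).
  transitivity (- (L *m A^T)); first by rewrite skA mulmxN opprK LA.
  congr (- _); transitivity (L *m (col_base A *m row_base A)^T); first by rewrite mulmx_base.
  by rewrite trmx_mul mulmxA.
have skB : B^T = - B.
  rewrite /B trmx_mul trmxK {1}LB mulNmx -mulmxA -trmx_mul LC trmx1 mulmx1.
  by [].
apply: (@skew_unit_even _ B) => //.
rewrite -row_full_unit -col_leq_rank.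
have := mxrankM_maxl B (col_base A)^T.
rewrite -mxrank_opp -LB.
by have /eqP -> := row_base_free A.
Qed.

Lemma rank_cap_kermx n (U : 'M[F]_n) (c : 'cV[F]_n) :
  (\rank U <= (\rank (U :&: kermx c)).+1)%N.
Proof.
move: (mxrank_mul_ker U c) (rank_leq_col (U *m c)).
by move: (\rank (U *m c)) (\rank _) (\rank U) => a b k; lia.
Qed.

Lemma rank_cap_kermx_lt n (U : 'M[F]_n) (c : 'cV[F]_n) (x : 'rV_n) :
  (x <= U)%MS -> x *m c != 0 -> \rank U = (\rank (U :&: kermx c)).+1.
Proof.
move=> xU xc; have Uc : (0 < \rank (U *m c))%N.
  rewrite lt0n mxrank_eq0; apply: contraNneq xc => Uc.
  by case/submxP: xU => X ->; rewrite -mulmxA Uc mulmx0.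
move: (mxrank_mul_ker U c) (rank_leq_col (U *m c)) Uc.
by move: (\rank (U *m c)) (\rank _) (\rank U) => a b k; lia.
Qed.

(** Dimensions are bounded from above by listing functionals whose common kernel in [U] lies in [J];
    each costs at most one dimension. *)
Lemma rank_le_constraints n (s : seq 'cV[F]_n) (U J : 'M[F]_n) :
  (forall x : 'rV_n, (x <= U)%MS -> (forall c, c \in s -> x *m c = 0) -> (x <= J)%MS) ->
  (\rank U <= size s + \rank J)%N.
Proof.
elim: s U => [|c s IH] U UJ.
  by rewrite add0n; apply/mxrankS/rV_subP => x xU; apply: UJ.
apply: leq_trans (rank_cap_kermx U c) _; rewrite addSn ltnS; apply: IH => x.
rewrite sub_capmx => /andP [xU /sub_kermxP xc] xs.
by apply: UJ => // d; rewrite inE => /orP [/eqP -> //|]; apply: xs.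
Qed.

(** [L] and [K] single out a nonsingular part of [B] of size [\rank B]. For [B + t *: C] its
    determinant is a polynomial in [t] with value 1 at 0, and the rank cannot drop away from the
    roots. *)
Lemma rank_perturb_roots m (B C : 'M[F]_m) :
  exists2 p : {poly F}, p != 0 &
    forall t, ~~ root p t -> (\rank B <= \rank (B + t *: C)%R)%N.
Proof.
have /row_fullP [L LC] : row_full (col_base B) by exact: col_base_full.
have /row_freeP [K RK] : row_free (row_base B) by exact: row_base_free.
have LBK : L *m B *m K = 1%:M.
  transitivity (L *m (col_base B *m row_base B) *m K); first by rewrite mulmx_base.
  by rewrite -mulmxA -[X in L *m X]mulmxA RK mulmx1.
pose N := map_mx polyC (L *m B *m K) + 'X *: map_mx polyC (L *m C *m K).
have evN t : map_mx (horner_eval t) N = L *m (B + t *: C) *m K.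
  rewrite mulmxDr mulmxDl -scalemxAr -scalemxAl.
  by apply/matrixP => i j; rewrite !mxE /horner_eval !hornerE.
have detN t : (\det N).[t] = \det (L *m (B + t *: C) *m K).
  by rewrite -evN det_map_mx.
exists (\det N).
  apply/eqP => N0; have := detN 0; rewrite N0 horner0 scale0r addr0.
  by rewrite LBK det1 => /eqP; rewrite eq_sym oner_eq0.
move=> t; rewrite rootE detN => nz.
have : L *m (B + t *: C) *m K \in unitmx by rewrite unitmxE unitfE.
rewrite -row_full_unit -col_leq_rank => /leq_trans; apply.
exact: leq_trans (mxrankM_maxl _ _) (mxrankM_maxr _ _).
Qed.

Lemma rank_perturb (I : finType) m (B C : I -> 'M[F]_m) :
  exists2 t : F, t != 0 & forall i, (\rank (B i) <= \rank (B i + t *: C i)%R)%N.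
Proof.
have [p p0 Hp] : exists2 p : {poly F}, p != 0 &
    forall t, ~~ root p t -> forall i, i \in enum I -> (\rank (B i) <= \rank (B i + t *: C i)%R)%N.
  elim: (enum I) => [|i s [p p0 IH]]; first by exists 1; rewrite ?oner_eq0.
  have [q q0 Hq] := rank_perturb_roots (B i) (C i).
  exists (p * q); first by rewrite mulf_neq0.
  move=> t; rewrite rootM negb_or => /andP [pt qt] j.
  by rewrite inE => /orP [/eqP ->|]; [apply: Hq | apply: IH].
(* These are [size p] distinct values, more than [p] can have roots; starting at 1 keeps [t]
   nonzero. *)
pose s := [seq (k.+1)%:R : F | k <- iota 0 (size p)].
have us : uniq s.
  rewrite map_inj_uniq ?iota_uniq // => a b /eqP.
  by rewrite eqr_nat => /eqP [].
have [ps|] := boolP (all (root p) s).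
  have := max_poly_roots p0 ps us.
  by rewrite size_map size_iota ltnn.
case/allPn => t /mapP [k _ ->] nr; exists (k.+1)%:R; first by rewrite pnatr_eq0.
by move=> i; apply: (Hp _ nr); rewrite mem_enum.
Qed.

End LinearAlgebra.

(** * Functions constant on the members of a family of sets *)

Section Constant.
Variable F : realFieldType.
Local Open Scope ring_scope.
Variable T : finType.
Local Notation vec := 'rV[F]_#|T|.

Definition val_at (x : vec) (v : T) := x 0 (enum_rank v).
Definition of_fun (g : T -> F) : vec := \row_i g (enum_val i).
Definition diff (u v : T) : 'cV[F]_#|T| :=
  delta_mx (enum_rank u) 0 - delta_mx (enum_rank v) 0.

Lemma val_of_fun g v : val_at (of_fun g) v = g v.
Proof. by rewrite /val_at mxE enum_rankK. Qed.

Lemma mul_delta (x : vec) v : x *m delta_mx (enum_rank v) (0 : 'I_1) = (val_at x v)%:M.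
Proof.
apply/matrixP => i j; rewrite !ord1 !mxE eqxx mulr1n (bigD1 (enum_rank v)) //=.
rewrite mxE !eqxx mulr1 big1 ?addr0 // => k kv; rewrite mxE (negbTE kv) mulr0 //.
Qed.

Lemma mul_diff (x : vec) u v : x *m diff u v = (val_at x u - val_at x v)%:M.
Proof. by rewrite mulmxBr !mul_delta -raddfB. Qed.

Lemma mul_diff_eq0 (x : vec) u v : (x *m diff u v == 0) = (val_at x u == val_at x v).
Proof.
rewrite mul_diff -[RHS]subr_eq0; apply/eqP/eqP => [|-> //]; last by rewrite raddf0.
by move/matrixP/(_ 0 0); rewrite !mxE eqxx mulr1n.
Qed.

Lemma val_atZ c (x : vec) v : val_at (c *: x) v = c * val_at x v.
Proof. by rewrite /val_at !mxE. Qed.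

Lemma val_at_inj (x y : vec) : (forall v, val_at x v = val_at y v) -> x = y.
Proof. by move=> h; apply/rowP => i; rewrite -[i]enum_valK; apply: h. Qed.

(* The functions constant on every member of [M], as a row space. *)
Definition cst (M : {set {set T}}) : 'M[F]_#|T| :=
  (\bigcap_(p : T * T | [exists e in M, (p.1 \in e) && (p.2 \in e)])
     kermx (diff p.1 p.2))%MS.

Lemma cstP (x : vec) (M : {set {set T}}) :
  reflect (forall e u v, e \in M -> u \in e -> v \in e -> val_at x u = val_at x v)
          (x <= cst M)%MS.
Proof.
apply: (iffP sub_bigcapmxP) => [h e u v eM ue ve|h [u v] /= /exists_inP [e eM /andP [ue ve]]].
  apply/eqP; rewrite -mul_diff_eq0; apply/eqP/sub_kermxP/(h (u, v)).
  by apply/exists_inP; exists e; rewrite //= ue ve.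
by apply/sub_kermxP/eqP; rewrite mul_diff_eq0; apply/eqP/(h e).
Qed.

Lemma cst_setU1_pair (M : {set {set T}}) u v :
  (cst ([set u; v] |: M) :=: cst M :&: kermx (diff u v))%MS.
Proof.
apply/eqmxP/andP; split; apply/rV_subP => x.
  move/cstP => h; rewrite sub_capmx; apply/andP; split.
    by apply/cstP => e a b eM; apply: h; rewrite inE eM orbT.
  apply/sub_kermxP/eqP; rewrite mul_diff_eq0; apply/eqP/(h [set u; v]).
  - by rewrite !inE eqxx.
  - by rewrite !inE eqxx.
  - by rewrite !inE eqxx orbT.
rewrite sub_capmx => /andP [/cstP h /sub_kermxP /eqP].
rewrite mul_diff_eq0 => /eqP xuv; apply/cstP => e a b.
rewrite in_setU1 => /orP [/eqP ->|]; last exact: h.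
by rewrite !inE => /orP [] /eqP -> /orP [] /eqP ->.
Qed.

Lemma rank_cst1 (B : {set T}) : B != set0 ->
  (\rank (cst [set B]) + #|B| = #|T| + 1)%N.
Proof.
elim: {B}_.+1 {-2}B (ltnSn #|B|) => // n IH B; rewrite ltnS => leB /set0Pn [r rB].
have [Br|[v]] := set_0Vmem (B :\ r).
  have -> : B = [set r] by rewrite -(setD1K rB) Br setU0.
  suff -> : \rank (cst [set [set r]]) = #|T| by rewrite cards1.
  apply/eqP; rewrite -/(row_full _) -sub1mx; apply/rV_subP => x _.
  by apply/cstP => e a b; rewrite inE => /eqP ->; rewrite !inE => /eqP -> /eqP ->.
rewrite !inE => /andP [vr vB]; pose B' := B :\ v.
have rB' : r \in B' by rewrite !inE eq_sym vr.
have cB : #|B| = #|B'|.+1 by rewrite (cardsD1 v B) vB.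
have <- : \rank (cst [set B'] :&: kermx (diff v r))%MS = \rank (cst [set B]).
  apply/eqmx_rank/andP; split; apply/rV_subP => x.
    rewrite sub_capmx => /andP [/cstP h /sub_kermxP /eqP].
    rewrite mul_diff_eq0 => /eqP xvr; apply/cstP => e a b; rewrite inE => /eqP -> aB bB.
    suff {a b aB bB} hr a : a \in B -> val_at x a = val_at x r by rewrite !hr.
    have [-> //|av aB] := eqVneq a v; apply: (h B'); rewrite ?set11 //.
    by rewrite !inE av.
  move/cstP => h; rewrite sub_capmx; apply/andP; split.
    apply/cstP => e a b; rewrite inE => /eqP ->; rewrite !inE => /andP [_ aB] /andP [_ bB].
    by apply: (h B); rewrite ?set11.
  apply/sub_kermxP/eqP; rewrite mul_diff_eq0; apply/eqP/(h B) => //.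
  by rewrite set11.
have E : \rank (cst [set B']) = (\rank (cst [set B'] :&: kermx (diff v r))%MS).+1.
  apply: (@rank_cap_kermx_lt _ _ _ _ (of_fun (fun w => (w == v)%:R))).
    apply/cstP => e a b; rewrite inE => /eqP ->; rewrite !inE => /andP [av _] /andP [bv _].
    by rewrite !val_of_fun (negbTE av) (negbTE bv).
  by rewrite mul_diff_eq0 !val_of_fun eqxx [r == v]eq_sym (negbTE vr) oner_eq0.
have B'0 : B' != set0 by apply/set0Pn; exists r.
have := IH B'; rewrite -cB leB E cB => /(_ isT B'0); lia.
Qed.

Lemma cst_sub (M N : {set {set T}}) :
  (forall e u v, e \in M -> u \in e -> v \in e -> u != v ->
     exists2 g, g \in N & (u \in g) && (v \in g)) -> (cst N <= cst M)%MS.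
Proof.
move=> h; apply/rV_subP => x /cstP xN; apply/cstP => e u v eM ue ve.
have [-> //|uv] := eqVneq u v.
by have [g gN /andP [ug vg]] := h _ _ _ eM ue ve uv; apply: (xN g).
Qed.

End Constant.

Lemma nat_attains_max (X : Type) (phi : X -> nat) B (x0 : X) :
  (forall x, phi x <= B) -> exists x, forall y, phi y <= phi x.
Proof.
move=> phiB; elim: {x0}_.+1 {-2}x0 (ltnSn (B - phi x0)) => // n IH x0 lt.
have [h|h] := classic (exists y, phi x0 < phi y); last first.
  by exists x0 => y; rewrite leqNgt; apply/negP => xy; apply: h; exists y.
case: h => y xy; apply: (IH y); have := phiB y; lia.
Qed.

(** * Radicals of skew forms restricted to subspaces *)

Section Radical.
Variables (F : realFieldType) (n : nat).
Local Open Scope ring_scope.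
Implicit Types (U A : 'M[F]_n).

(* The radical of the restriction of the form [A] to [U]. *)
Definition rad U A : 'M[F]_n := (U :&: kermx (A *m U^T))%MS.

Lemma rank_rad U A : (\rank (U *m A *m U^T) + \rank (rad U A) = \rank U)%N.
Proof. by rewrite -mulmxA mxrank_mul_ker. Qed.

Lemma skew_self (A : 'M[F]_n) (x : 'rV[F]_n) : A^T = - A -> x *m A *m x^T = 0.
Proof.
move=> skA; have : (x *m A *m x^T)^T = - (x *m A *m x^T).
  by rewrite !trmx_mul trmxK skA mulNmx mulmxN mulmxA.
move/matrixP/(_ 0 0); rewrite !mxE => h; apply/matrixP => i j; rewrite !ord1 mxE [RHS]mxE.
by move: h; set s := \sum_(_ < _) _; lra.
Qed.

Lemma skew_swap (A : 'M[F]_n) (x a : 'rV[F]_n) : A^T = - A ->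
  x *m A *m a^T = - (a *m A *m x^T).
Proof.
move=> skA; have : (a *m A *m x^T)^T = - (x *m A *m a^T).
  by rewrite !trmx_mul trmxK skA mulNmx mulmxN mulmxA.
move=> h; rewrite [X in - X]mx11_scalar -tr_scalar_mx -mx11_scalar h opprK //.
Qed.

Lemma radP U A (x : 'rV_n) :
  reflect ((x <= U)%MS /\ forall a : 'rV_n, (a <= U)%MS -> x *m A *m a^T = 0)
          (x <= rad U A)%MS.
Proof.
rewrite sub_capmx; apply: (iffP andP) => [[xU /sub_kermxP xA]|[xU xA]]; split=> //.
  by move=> a /submxP [D ->]; rewrite trmx_mul mulmxA -(mulmxA x) xA mul0mx.
apply/sub_kermxP/rowP => j; have /matrixP/(_ 0 0) := xA (row j U) (row_sub _ _).
move=> h; rewrite mulmxA [RHS]mxE -[RHS](etrans h (mxE _ _ _ _)) !mxE.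
by apply: eq_bigr => i _; rewrite !mxE.
Qed.

(* A functional vanishing on the radical cuts [U] down but enlarges the radical. *)
Lemma rad_rank_capmx U A (c : 'cV_n) (x0 : 'rV_n) :
  A^T = - A -> (forall k : 'rV_n, (k <= rad U A)%MS -> k *m c = 0) ->
  (x0 <= U)%MS -> x0 *m c != 0 ->
  (\rank (rad U A) < \rank (rad (U :&: kermx c)%MS A))%N.
Proof.
move=> skA kc x0U x0c; pose G := U *m A *m U^T.
have trG : G^T = - G by rewrite !trmx_mul trmxK skA mulNmx mulmxN mulmxA.
(* On [U] the functional [c] kills the radical, so the form represents it by a vector [x]. The form
   is alternating, hence [c] vanishes at [x]; so [x] lies in the new radical, but not in the old one
   because [c] is nonzero at [x0]. *)
have /submxP [w wG] : (c^T *m U^T <= G)%MS.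
  rewrite submxE; apply/eqP; have := mulmx_coker G; move: (cokermx G) => Z GZ.
  apply: trmx_inj; rewrite trmx0 !trmx_mul !trmxK mulmxA.
  have ZG : Z^T *m G = 0 by rewrite -[G]opprK -trG mulmxN -trmx_mul GZ trmx0 oppr0.
  apply/row_matrixP => i; rewrite row0 row_mul; apply: kc.
  rewrite row_mul; apply/radP; split; first exact: submxMl.
  move=> a /submxP [D ->]; rewrite trmx_mul mulmxA -(mulmxA _ U) -(mulmxA _ (U *m A)) -/G.
  by rewrite -row_mul ZG row0 mul0mx.
pose x := w *m U.
have xA a : (a <= U)%MS -> x *m A *m a^T = (a *m c)^T.
  case/submxP => D ->.
  have -> : x *m A *m (D *m U)^T = (w *m G) *m D^T by rewrite trmx_mul /x /G !mulmxA.
  by rewrite -wG !trmx_mul !mulmxA.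
have xU : (x <= U)%MS by exact: submxMl.
have xc : x *m c = 0.
  apply: trmx_inj; rewrite -xA // trmx0.
  exact: skew_self.
have sub : (rad U A <= rad (U :&: kermx c)%MS A)%MS.
  apply/rV_subP => k kR; have kc0 := kc _ kR; case/radP: kR => kU kA; apply/radP; split.
    by rewrite sub_capmx kU; apply/sub_kermxP.
  by move=> a; rewrite sub_capmx => /andP [aU _]; apply: kA.
have xR : (x <= rad (U :&: kermx c)%MS A)%MS.
  apply/radP; split; first by rewrite sub_capmx xU; apply/sub_kermxP.
  by move=> a; rewrite sub_capmx => /andP [aU /sub_kermxP ac]; rewrite xA // ac trmx0.
rewrite ltn_neqAle (mxrankS sub) andbT; apply: contra x0c => /eqP eqr.
have := mxrank_leqif_sup sub; rewrite eqr => -[_]; rewrite eqxx => /esym le.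
have /radP [_ xA0] := submx_trans xR le.
by rewrite -trmx_eq0 -xA // xA0.
Qed.

End Radical.

(** * Forms attached to faces and generic coefficients *)

Section FaceForms.
Variables (F : realFieldType) (V : finType).
Local Open Scope ring_scope.
Local Notation vec := 'rV[F]_#|V|.

(* [wedge f] is, up to sign, [(x_v - x_u) /\ (x_w - x_u)] for [f = {u, v, w}];
   it vanishes on the functions constant on [f]. *)
Definition face1 (f : {set V}) : 'cV[F]_#|V| :=
  if enum f is [:: u, v & _] then diff F v u else 0.
Definition face2 (f : {set V}) : 'cV[F]_#|V| :=
  if enum f is [:: u, _, w & _] then diff F w u else 0.
Definition wedge (f : {set V}) : 'M[F]_#|V| :=
  face1 f *m (face2 f)^T - face2 f *m (face1 f)^T.
Definition l1 f (x : vec) := (x *m face1 f) 0 0.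
Definition l2 f (x : vec) := (x *m face2 f) 0 0.

Lemma face_enum (f : {set V}) : #|f| = 3 ->
  exists u v w, [/\ uniq [:: u; v; w], f = [set u; v; w],
    forall x, l1 f x = val_at x v - val_at x u & forall x, l2 f x = val_at x w - val_at x u].
Proof.
rewrite cardE /l1 /l2 /face1 /face2; have := enum_uniq f; have := mem_enum f.
case: (enum f) => [|u [|v [|w [|]]]] // mem_f uq _; exists u, v, w; split=> //.
- by apply/setP => x; rewrite -mem_f !inE -orbA.
- by move=> x; rewrite mul_diff mxE.
- by move=> x; rewrite mul_diff mxE.
Qed.

Lemma l1B f x y : l1 f (x - y) = l1 f x - l1 f y.
Proof. by rewrite /l1 mulmxBl !mxE. Qed.
Lemma l2B f x y : l2 f (x - y) = l2 f x - l2 f y.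
Proof. by rewrite /l2 mulmxBl !mxE. Qed.
Lemma l1Z f c x : l1 f (c *: x) = c * l1 f x.
Proof. by rewrite /l1 -scalemxAl mxE. Qed.
Lemma l2Z f c x : l2 f (c *: x) = c * l2 f x.
Proof. by rewrite /l2 -scalemxAl mxE. Qed.

Lemma wedgeE f (x a : vec) :
  x *m wedge f *m a^T = (l1 f x * l2 f a - l2 f x * l1 f a)%:M.
Proof.
rewrite mulmxBr mulmxBl !mulmxA.
have E (c d : 'cV[F]_#|V|) : x *m c *m d^T *m a^T = ((x *m c) 0 0 * (a *m d) 0 0)%:M.
  rewrite -mulmxA -trmx_mul [x *m c]mx11_scalar [a *m d]mx11_scalar tr_scalar_mx.
  by rewrite !mxE -scalar_mxM !mulr1n.
by rewrite !E -raddfB.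
Qed.

Lemma wedge_skew f : (wedge f)^T = - wedge f.
Proof. by rewrite linearB /= !trmx_mul !trmxK opprB. Qed.

Definition form (Y : {set {set V}}) (y : {set V} -> F) : 'M[F]_#|V| :=
  \sum_(f in Y) y f *: wedge f.

Lemma form_skew (Y : {set {set V}}) y : (form Y y)^T = - form Y y.
Proof.
rewrite linear_sum -sumrN; apply: eq_bigr => f _.
by rewrite linearZ /= wedge_skew scalerN.
Qed.

Lemma formD1 (Y : {set {set V}}) y f : f \in Y -> form Y y = form (Y :\ f) y + y f *: wedge f.
Proof. by move=> fY; rewrite /form (big_setD1 f) //= addrC. Qed.

Lemma form_add (Y : {set {set V}}) y f t : f \in Y ->
  form Y (fun g => y g + t * (g == f)%:R) = form Y y + t *: wedge f.
Proof.
move=> fY; rewrite /form (eq_bigr (fun g => y g *: wedge g + (t * (g == f)%:R) *: wedge g)).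
  rewrite big_split /=; congr (_ + _).
  rewrite (big_setD1 f) //= eqxx mulr1 big1 ?addr0 //.
  by move=> g; rewrite !inE => /andP [/negbTE -> _]; rewrite mulr0 scale0r.
by move=> g _; rewrite scalerDl.
Qed.

Lemma wedge_const f (x : vec) : l1 f x = 0 -> l2 f x = 0 -> x *m wedge f = 0.
Proof.
rewrite /l1 /l2 => x1 x2; rewrite mulmxBr !mulmxA [x *m face1 f]mx11_scalar.
by rewrite [x *m face2 f]mx11_scalar x1 x2 raddf0 !mul0mx subr0.
Qed.

(** The old form kills [k1] and [k2], so an element of the new radical pairs to zero with both under
    [wedge f]. The nonzero determinant makes it constant on [f], which puts it into the old radical;
    [k1] itself is lost. *)
Lemma rad_perturb (U A : 'M[F]_#|V|) f (k1 k2 : vec) t :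
  A^T = - A -> (k1 <= rad U A)%MS -> (k2 <= rad U A)%MS ->
  l1 f k1 * l2 f k2 - l2 f k1 * l1 f k2 != 0 -> t != 0 ->
  (\rank (rad U (A + t *: wedge f)%R) < \rank (rad U A))%N.
Proof.
move=> skA k1R k2R det0 t0.
have kR k (x : vec) : (k <= rad U A)%MS -> (x <= rad U (A + t *: wedge f)%R)%MS ->
    l1 f x * l2 f k - l2 f x * l1 f k = 0.
  move=> kR /radP [xU xA]; case/radP: kR => kU kA.
  have := xA k kU; rewrite mulmxDr mulmxDl (skew_swap _ _ skA) kA // oppr0 add0r.
  rewrite -scalemxAr -scalemxAl wedgeE => /matrixP/(_ 0 0); rewrite !mxE eqxx mulr1n.
  by move/eqP; rewrite mulf_eq0 (negbTE t0) => /eqP.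
have sub : (rad U (A + t *: wedge f)%R <= rad U A)%MS.
  apply/rV_subP => x xR; have h1 := kR _ _ k1R xR; have h2 := kR _ _ k2R xR.
  have x1 : l1 f x = 0.
    apply/(mulIf det0); rewrite mul0r.
    transitivity (l1 f k1 * (l1 f x * l2 f k2 - l2 f x * l1 f k2)
                  - l1 f k2 * (l1 f x * l2 f k1 - l2 f x * l1 f k1)); first by ring.
    by rewrite h1 h2 !mulr0 subr0.
  have x2 : l2 f x = 0.
    apply/(mulIf det0); rewrite mul0r.
    transitivity (l2 f k1 * (l1 f x * l2 f k2 - l2 f x * l1 f k2)
                  - l2 f k2 * (l1 f x * l2 f k1 - l2 f x * l1 f k1)); first by ring.
    by rewrite h1 h2 !mulr0 subr0.
  case/radP: xR => xU xA; apply/radP; split=> // a aU.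
  by rewrite -[RHS](xA a aU) mulmxDr -scalemxAr wedge_const // scaler0 addr0.
rewrite ltn_neqAle (mxrankS sub) andbT; apply: contra det0 => /eqP eqr.
have [_] := mxrank_leqif_sup sub; rewrite eqr eqxx => /esym le.
by apply/eqP/kR => //; apply: submx_trans k1R le.
Qed.

(* A [y] maximising the total rank over all [M] is generic enough. *)
Lemma generic_form (Y : {set {set V}}) : exists y : {set V} -> F,
  forall (M : {set {set V}}) f (k1 k2 : vec), f \in Y ->
    (k1 <= rad (cst F M) (form Y y))%MS -> (k2 <= rad (cst F M) (form Y y))%MS ->
    l1 f k1 * l2 f k2 - l2 f k1 * l1 f k2 = 0.
Proof.
pose phi y := (\sum_(M : {set {set V}})
  \rank (cst F M *m form Y y *m (cst F M)^T))%N.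
have [y ymax] : exists y, forall z, (phi z <= phi y)%N.
  apply: (@nat_attains_max _ phi (\sum_(M : {set {set V}}) #|V|)%N (fun _ => 0)) => y.
  by apply: leq_sum => M _; apply: rank_leq_col.
exists y => M f k1 k2 fY k1R k2R; apply/eqP; apply/negPn/negP => det0.
(* This [t] lets no term of the sum drop, while the term of [M] rises by [rad_perturb]. Summing over
   all [M] makes one [y] serve every restriction. *)
have [t t0 tP] := rank_perturb (fun N : {set {set V}} => cst F N *m form Y y *m (cst F N)^T)
  (fun N : {set {set V}} => cst F N *m wedge f *m (cst F N)^T).
have := ymax (fun g => y g + t * (g == f)%:R); rewrite leqNgt => /negP; apply.
have E N : cst F N *m form Y (fun g => y g + t * (g == f)%:R) *m (cst F N)^T =
    cst F N *m form Y y *m (cst F N)^T + t *: (cst F N *m wedge f *m (cst F N)^T).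
  by rewrite form_add // mulmxDr mulmxDl -scalemxAr -scalemxAl.
rewrite /phi (bigD1 M) //= [X in (_ < X)%N](bigD1 M) //= -addSn.
apply: leq_add; last by apply: leq_sum => N _; rewrite E; apply: tP.
have := rad_perturb (form_skew Y y) k1R k2R det0 t0.
have := rank_rad (cst F M) (form Y y).
have := rank_rad (cst F M) (form Y y + t *: wedge f); rewrite -(form_add _ _ fY).
set a := \rank _; set b := \rank _; set c := \rank _; set d := \rank _; set e := \rank _.
by move=> h1 h2 h3; lia.
Qed.

End FaceForms.

(** * Extracting faces from a form with trivial radical *)

Section TreeOfForm.
Variables (F : realFieldType) (V : finType).
Local Open Scope ring_scope.
Local Notation vec := 'rV[F]_#|V|.
Implicit Types (M Y T : {set {set V}}) (f : {set V}).

Lemma mul_face1_eq0 f (x : vec) : (x *m face1 F f == 0) = (l1 f x == 0).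
Proof.
rewrite /l1; apply/eqP/eqP => [->|h]; first by rewrite mxE.
by rewrite [LHS]mx11_scalar h raddf0.
Qed.
Lemma mul_face2_eq0 f (x : vec) : (x *m face2 F f == 0) = (l2 f x == 0).
Proof.
rewrite /l2; apply/eqP/eqP => [->|h]; first by rewrite mxE.
by rewrite [LHS]mx11_scalar h raddf0.
Qed.

Lemma face_constP f (x : vec) : #|f| = 3 ->
  reflect (forall u v, u \in f -> v \in f -> val_at x u = val_at x v)
          ((l1 f x == 0) && (l2 f x == 0)).
Proof.
move=> f3; apply: (iffP andP); have [u [v [w [_ -> -> ->]]]] := face_enum F f3; rewrite !subr_eq0.
  case=> /eqP vu /eqP wu.
  have hu z : z \in [set u; v; w] -> val_at x z = val_at x u.
    by rewrite !inE => /orP [/orP [] /eqP ->|/eqP ->].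
  by move=> a b /hu -> /hu ->.
by move=> h; split; apply/eqP/h; rewrite !inE eqxx ?orbT.
Qed.

Lemma cst_setU1_face f M : #|f| = 3 ->
  (cst F (f |: M) :=: (cst F M :&: kermx (face1 F f)) :&: kermx (face2 F f))%MS.
Proof.
move=> f3; apply/eqmxP/andP; split; apply/rV_subP => x.
  move/cstP => h; have xf : forall u v, u \in f -> v \in f -> val_at x u = val_at x v.
    by move=> u v; apply: h; rewrite setU11.
  have /andP [x1 x2] := introT (face_constP x f3) xf.
  rewrite !sub_capmx -andbA; apply/and3P; split.
  - by apply/cstP => e u v eM; apply: h; rewrite setU1r.
  - by apply/sub_kermxP/eqP; rewrite mul_face1_eq0.
  - by apply/sub_kermxP/eqP; rewrite mul_face2_eq0.
rewrite !sub_capmx -andbA => /and3P [/cstP h /sub_kermxP /eqP x1 /sub_kermxP /eqP x2].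
rewrite mul_face1_eq0 in x1; rewrite mul_face2_eq0 in x2.
apply/cstP => e u v; rewrite in_setU1 => /orP [/eqP ->|]; last exact: h.
by apply/(face_constP x f3); rewrite x1 x2.
Qed.

(** The nonzero determinant makes [l1 f] and [l2 f] independent on [cst F M], so constancy on [f]
    costs exactly two dimensions. The vector [z] in the proof is the combination of [k] and [a]
    killed by [l1 f]; its value under [l2 f] is the determinant up to sign. *)
Lemma rank_cst_setU1_face f M (k a : vec) : #|f| = 3 ->
  (k <= cst F M)%MS -> (a <= cst F M)%MS -> l1 f k * l2 f a - l2 f k * l1 f a != 0 ->
  (\rank (cst F M) = (\rank (cst F (f |: M))).+2)%N.
Proof.
move=> f3 kU aU det0; rewrite (cst_setU1_face M f3).
set U := cst F M in kU aU *.
have [x xU x1] : exists2 x : vec, (x <= U)%MS & x *m face1 F f != 0.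
  have [k1|k1] := eqVneq (l1 f k) 0; last by exists k; rewrite // mul_face1_eq0.
  exists a => //; rewrite mul_face1_eq0; apply: contra det0 => /eqP ->.
  by rewrite k1 mul0r mulr0 subrr.
rewrite (rank_cap_kermx_lt xU x1); congr _.+1.
pose z := l1 f a *: k - l1 f k *: a.
apply: (@rank_cap_kermx_lt _ _ _ _ z).
  rewrite sub_capmx; apply/andP; split; first by rewrite addmx_sub ?eqmx_opp ?scalemx_sub.
  by apply/sub_kermxP/eqP; rewrite mul_face1_eq0 l1B !l1Z mulrC subrr.
rewrite mul_face2_eq0 l2B !l2Z; apply: contra det0 => /eqP h.
by rewrite -oppr_eq0 -h; apply/eqP; ring.
Qed.

Lemma cstS M Y : M \subset Y -> (cst F Y <= cst F M)%MS.
Proof.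
by move=> /subsetP MY; apply/rV_subP => x /cstP h; apply/cstP => e u v /MY; apply: h.
Qed.

(* Removing a face [f] from the form either keeps the radical trivial, or
   makes it trivial again once functions are required to be constant on [f],
   and then [f] goes into [T]. *)
Lemma tree_of_form (FF : {set {set V}}) (y : {set V} -> F) Y M :
  (forall f, f \in FF -> #|f| = 3) -> Y \subset FF -> M \subset FF ->
  (rad (cst F M) (form Y y) <= cst F FF)%MS ->
  exists T, [/\ T \subset Y, (cst F (M :|: T) <= cst F FF)%MS &
                (\rank (cst F M) = \rank (cst F FF) + 2 * #|T|)%N].
Proof.
move=> tri; elim: {Y}_.+1 {-2}Y (ltnSn #|Y|) M => // n IH Y; rewrite ltnS => leY M YF MF radJ.
have [Y0|[f fY]] := set_0Vmem Y.
  have UJ : (cst F M <= cst F FF)%MS.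
    apply/rV_subP => x xU; apply: submx_trans radJ; apply/radP; split=> // a _.
    by rewrite /form Y0 big_set0 mulmx0 mul0mx.
  exists set0; rewrite setU0 sub0set cards0 muln0 addn0; split=> //.
  by apply/eqP; rewrite eqn_leq (mxrankS UJ) (mxrankS (cstS MF)).
have fF := subsetP YF f fY; have f3 := tri f fF; pose Y' := Y :\ f.
have ltY' : (#|Y'| < n)%N by move: leY; rewrite (cardsD1 f) fY.
have Y'F : Y' \subset FF by apply: subset_trans YF; apply: subsetDl.
set L := form Y y in radJ; pose L' := form Y' y.
have EL : L = L' + y f *: wedge F f by rewrite /L (formD1 y fY).
have skL : L^T = - L := form_skew Y y.
have skL' : L'^T = - L' := form_skew Y' y.
have [radJ'|] := boolP (rad (cst F M) L' <= cst F FF)%MS.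
  have [T [TY cT rT]] := IH _ ltY' M Y'F MF radJ'.
  by exists T; split=> //; apply: subset_trans TY _; apply: subsetDl.
case/row_subPn => i; set k := row i _ => kJ.
have /radP [kU kL'] : (k <= rad (cst F M) L')%MS by exact: row_sub.
have kL a : (a <= cst F M)%MS ->
    k *m L *m a^T = (y f * (l1 f k * l2 f a - l2 f k * l1 f a))%:M.
  move=> aU; rewrite EL mulmxDr mulmxDl kL' // add0r -scalemxAr -scalemxAl wedgeE.
  by rewrite scale_scalar_mx.
(* If [k] paired to zero with every row, it would lie in the radical of the form that still contains
   [f], hence in [cst F FF]. *)
have [j] : exists j, (l1 f k * l2 f (row j (cst F M)) - l2 f k * l1 f (row j (cst F M)) != 0)
                   && (y f != 0).
  apply/existsP; apply: contraR kJ => /existsPn h; apply: submx_trans radJ.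
  apply/radP; split=> // a /submxP [D ->].
  have -> : k *m L *m (D *m cst F M)^T = (k *m L *m (cst F M)^T) *m D^T.
    by rewrite trmx_mul !mulmxA.
  suff -> : k *m L *m (cst F M)^T = 0 by rewrite mul0mx.
  apply/rowP => j; have /matrixP/(_ 0 0) := kL (row j (cst F M)) (row_sub _ _).
  move=> e; transitivity ((k *m L *m (row j (cst F M))^T) 0 0).
    by rewrite !mxE; apply: eq_bigr => l _; rewrite !mxE.
  rewrite e [LHS]mxE [RHS]mxE eqxx mulr1n; apply/eqP; rewrite mulf_eq0.
  by have := h j; rewrite negb_and !negbK orbC.
set a := row j _ => /andP [det0 yf0]; have aU : (a <= cst F M)%MS by exact: row_sub.
have rk2 := rank_cst_setU1_face f3 kU aU det0.
have radJ' : (rad (cst F (f |: M)) L' <= cst F FF)%MS.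
  apply/rV_subP => x /radP [xU' xL'].
  have xU : (x <= cst F M)%MS by apply: submx_trans xU' _; apply/cstS/subsetUr.
  have xfc (z : vec) : (z <= cst F (f |: M))%MS -> l1 f z = 0 /\ l2 f z = 0.
    move/cstP => h.
    have /andP [/eqP ? /eqP ?] //: (l1 f z == 0) && (l2 f z == 0).
    by apply/(face_constP z f3) => u v; apply: h; rewrite setU11.
  have [x1 x2] := xfc x xU'.
  pose mu := (x *m L' *m a^T) 0 0.
  (* With this factor [x'] pairs to zero with [a] under [L]. Once [x'] is shown to lie in the
     radical, it is constant on [f]; so is [x], while [k] is not, and therefore [lam = 0]. *)
  pose lam := mu / (y f * (l1 f k * l2 f a - l2 f k * l1 f a)).
  have d0 : y f * (l1 f k * l2 f a - l2 f k * l1 f a) != 0 by rewrite mulf_neq0.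
  pose x' := x - lam *: k.
  have x'U : (x' <= cst F M)%MS by rewrite addmx_sub ?eqmx_opp ?scalemx_sub.
  have xLE b : x *m L *m b^T = x *m L' *m b^T.
    by rewrite EL mulmxDr -scalemxAr wedge_const // scaler0 addr0.
  have x'L b : x' *m L *m b^T = x *m L' *m b^T - lam *: (k *m L *m b^T).
    by rewrite /x' mulmxBl mulmxBl xLE -!scalemxAl.
  have x'R : (x' <= cst F FF)%MS.
    apply: submx_trans radJ; apply/radP; split=> // b bU.
    (* [b] is a combination of [k], [a] and a function constant on [f]. *)
    pose d := l1 f k * l2 f a - l2 f k * l1 f a.
    pose p := (l1 f b * l2 f a - l2 f b * l1 f a) / d.
    pose q := (l1 f k * l2 f b - l2 f k * l1 f b) / d.
    pose b' := b - p *: k - q *: a.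
    have b'U' : (b' <= cst F (f |: M))%MS.
      rewrite (cst_setU1_face M f3) !sub_capmx -andbA; apply/and3P; split.
      - by rewrite !addmx_sub ?eqmx_opp ?scalemx_sub.
      - apply/sub_kermxP/eqP; rewrite mul_face1_eq0 !l1B !l1Z /p /q; apply/eqP.
        by rewrite /d; field.
      - apply/sub_kermxP/eqP; rewrite mul_face2_eq0 !l2B !l2Z /p /q; apply/eqP.
        by rewrite /d; field.
    have x'b' : x' *m L *m b'^T = 0.
      rewrite x'L xL' // kL; last by rewrite (submx_trans b'U') // cstS // subsetUr.
      have [-> ->] := xfc b' b'U'.
      by rewrite !mulr0 subrr mulr0 raddf0 scaler0 subrr.
    have x'k : x' *m L *m k^T = 0.
      rewrite x'L (skew_swap _ _ skL') kL' // skew_self // oppr0 scaler0 subrr //.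
    have x'a : x' *m L *m a^T = 0.
      rewrite x'L kL // [x *m L' *m a^T]mx11_scalar -/mu.
      by rewrite scale_scalar_mx /lam divfK // subrr.
    have -> : b = b' + q *: a + p *: k by rewrite /b' addrNK addrNK.
    clearbody b'.
    have trD (u v : vec) : (u + v)^T = u^T + v^T by exact: linearD.
    have trZ c (u : vec) : (c *: u)^T = c *: u^T by exact: linearZ.
    rewrite !trD !trZ !mulmxDr -!scalemxAr x'b' x'k x'a.
    by rewrite !scaler0 !addr0.
  have /andP [/eqP x'1 /eqP x'2] : (l1 f x' == 0) && (l2 f x' == 0).
    by apply/(face_constP x' f3) => u v; move/cstP: x'R; apply.
  have lam0 : lam = 0.
    apply/(mulIf det0); rewrite mul0r.
    move: x'1 x'2; rewrite l1B l2B l1Z l2Z x1 x2 => e1 e2.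
    transitivity ((0 - lam * l2 f k) * l1 f a - (0 - lam * l1 f k) * l2 f a); first by ring.
    by rewrite e1 e2; ring.
  by move: x'R; rewrite /x' lam0 scale0r subr0.
have fMF : f |: M \subset FF by rewrite subUset sub1set fF.
have [T [TY cT rT]] := IH _ ltY' (f |: M) Y'F fMF radJ'.
exists (f |: T); split.
- by rewrite subUset sub1set fY; apply: subset_trans TY _; apply: subsetDl.
- by rewrite setUCA setUA.
- have fT : f \notin T by apply/negP => /(subsetP TY); rewrite !inE eqxx.
  by rewrite rk2 rT cardsU1 fT mulnDr muln1 addnCA.
Qed.

End TreeOfForm.

(** * Mod-2 boundaries of sets of triples *)

Section Boundary.
Variable V : finType.
Implicit Types (A B FF : {set {set V}}) (e f t C : {set V}).

Definition pairs f : {set {set V}} := [set e : {set V} | (e \subset f) && (#|e| == 2)].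
Definition star A e : {set {set V}} := [set f in A | e \subset f].
Definition bd A : {set {set V}} := [set e : {set V} | (#|e| == 2) && odd #|star A e|].
Definition edges A : {set {set V}} := [set e : {set V} | (#|e| == 2) && (star A e != set0)].
Definition symd A B := (A :\: B) :|: (B :\: A).

Lemma in_symd A B f : (f \in symd A B) = (f \in A) (+) (f \in B).
Proof. by rewrite !inE; case: (f \in A); case: (f \in B). Qed.

Lemma odd_symd (X Y : {set {set V}}) : odd #|symd X Y| = odd #|X| (+) odd #|Y|.
Proof.
have -> : #|symd X Y| = #|X :\: Y| + #|Y :\: X|.
  rewrite /symd cardsU (_ : _ :&: _ = set0) ?cards0 ?subn0 //.
  by apply/setP => x; rewrite !inE; case: (x \in X); case: (x \in Y).
rewrite -(cardsID Y X) -(cardsID X Y) (setIC Y X) !oddD.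
by case: (odd _); case: (odd _); case: (odd _).
Qed.

Lemma bd_symd A B : bd (symd A B) = symd (bd A) (bd B).
Proof.
apply/setP => e; rewrite in_symd !inE.
have -> : star (symd A B) e = symd (star A e) (star B e).
  by apply/setP => f; rewrite in_symd !inE; case: (f \in A); case: (f \in B); case: (e \subset f).
by rewrite odd_symd; case: (_ == _).
Qed.

Lemma bd0 : bd set0 = set0.
Proof. by apply/setP => e; rewrite !inE (_ : star _ _ = set0) ?cards0 ?andbF //; apply/setP => f; rewrite !inE. Qed.

Lemma bd1 t : bd [set t] = pairs t.
Proof.
apply/setP => e; rewrite !inE andbC; congr (_ && _).
rewrite (_ : star _ _ = if e \subset t then [set t] else set0).
  by case: ifP; rewrite ?cards1 ?cards0.
apply/setP => f; rewrite !inE; have [->|ft] := eqVneq f t; case: ifP; rewrite !inE ?eqxx //.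
by rewrite (negbTE ft).
Qed.

Lemma bd_sub_edges A B : A \subset B -> bd A \subset edges B.
Proof.
move=> AB; apply/subsetP => e; rewrite !inE => /andP [-> o] /=.
have [f] : exists f, f \in star A e by apply/set0Pn; apply: contraL o => /eqP ->; rewrite cards0.
by rewrite inE => /andP [fA ef]; apply/set0Pn; exists f; rewrite inE (subsetP AB).
Qed.

Lemma pair_edge e : #|e| = 2 -> exists u v, u != v /\ e = [set u; v].
Proof. by move/eqP/cards2P. Qed.

Lemma triple f : #|f| = 3 -> exists u v w, uniq [:: u; v; w] /\ f = [set u; v; w].
Proof.
rewrite cardE; have := enum_uniq f; have := mem_enum f.
case: (enum f) => [|u [|v [|w [|]]]] // mem_f uq _; exists u, v, w; split=> //.
by apply/setP => x; rewrite -mem_f !inE -orbA.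
Qed.

Lemma in_pairs2 f u v : u != v -> ([set u; v] \in pairs f) = (u \in f) && (v \in f).
Proof. by move=> uv; rewrite inE cards2 uv andbT subUset !sub1set. Qed.

Lemma pairs3 (u v w : V) : uniq [:: u; v; w] ->
  pairs [set u; v; w] = [set [set u; v]; [set v; w]; [set u; w]].
Proof.
rewrite /= !inE !andbT => /andP [] /norP [uv uw] vw.
apply/setP => e; rewrite !inE; apply/andP/idP; last first.
  by case/orP => [/orP [] |] /eqP ->; rewrite cards2 ?uv ?uw ?vw subUset !sub1set !inE !eqxx ?orbT.
case=> es /eqP /pair_edge [a [b [ab eab]]]; move: es; rewrite eab subUset !sub1set !inE.
case/andP => /orP [/orP [] |] /eqP aa /orP [/orP [] |] /eqP bb; move: ab;
  rewrite aa bb ?eqxx //= => _; by rewrite ?eqxx ?orbT // setUC ?eqxx ?orbT.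
Qed.

Lemma uniq_pairs3 (u v w : V) : uniq [:: u; v; w] ->
  uniq [:: [set u; v]; [set v; w]; [set u; w]].
Proof.
rewrite /= !inE !andbT => /andP [] /norP [uv uw] vw.
rewrite negb_or -andbA; apply/and3P; split; apply/eqP => /setP.
- by move/(_ u); rewrite !inE eqxx (negbTE uv) (negbTE uw).
- by move/(_ v); rewrite !inE eqxx orbT (negbTE vw) eq_sym (negbTE uv).
- by move/(_ v); rewrite !inE eqxx (negbTE vw) eq_sym (negbTE uv).
Qed.

Lemma card_pairs3 t : #|t| = 3 -> #|pairs t| = 3.
Proof.
case/triple => u [v [w [uq ->]]]; rewrite pairs3 //; have := uniq_pairs3 uq.
by rewrite /= !inE -setUA => /andP [h1 /andP [h2 _]]; rewrite cardsU1 !inE h1 cards2 h2.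
Qed.

Definition cross C e := #|e :&: C| == 1.

Lemma cross2 C u v : u != v -> cross C [set u; v] = (u \in C) (+) (v \in C).
Proof.
move=> uv; rewrite /cross setIUl cardsU (_ : _ :&: _ :&: _ = set0) ?cards0 ?subn0; last first.
  by apply/setP => x; rewrite !inE; apply/andP => -[/andP [/eqP -> _] /andP [/eqP h _]]; rewrite h eqxx in uv.
have c1 x : #|[set x] :&: C| = (x \in C).
  case: (boolP (x \in C)) => xC; first by rewrite (setIidPl _) ?cards1 ?sub1set.
  by apply/eqP; rewrite cards_eq0 setI_eq0 disjoints1.
by rewrite !c1; case: (u \in C); case: (v \in C).
Qed.

Lemma odd_sum_odd (I : finType) (P : pred I) (G : I -> nat) :
  odd (\sum_(i | P i) odd (G i)) = odd (\sum_(i | P i) G i).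
Proof.
by elim/big_rec2: _ => // i a b _ IH; rewrite !oddD oddb IH.
Qed.

Lemma card_cross_pairs_even C f : #|f| = 3 -> ~~ odd #|[set e in pairs f | cross C e]|.
Proof.
case/triple => u [v [w [uq ->]]]; rewrite pairs3 //; have := uniq_pairs3 uq.
move: uq; rewrite /= !inE !andbT => /andP [] /norP [uv uw] vw.
move=> /andP [] /norP [n1 n2] n3.
have -> : #|[set e in [set [set u; v]; [set v; w]; [set u; w]] | cross C e]| =
  cross C [set u; v] + cross C [set v; w] + cross C [set u; w].
  rewrite -sum1dep_card -setUA big_mkcondr /= big_setU1 /= ?inE ?negb_or ?n1 //.
  rewrite big_setU1 /= ?inE // big_set1 addnA.
  by case: (cross _ _); case: (cross _ _); case: (cross _ _).
by rewrite !cross2 //; case: (u \in C); case: (v \in C); case: (w \in C).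
Qed.

Lemma card_star A e : #|star A e| = \sum_(f in A) (e \subset f).
Proof.
by rewrite /star -sum1dep_card big_mkcondr; apply: eq_bigr => f _; case: (e \subset f).
Qed.

(** A triangle crosses any vertex cut an even number of times. Summing over [A] counts an edge
    [#|star A e|] times, which is odd exactly on the boundary. *)
Lemma bd_cut_even A C : (forall f, f \in A -> #|f| = 3) ->
  ~~ odd #|[set e in bd A | cross C e]|.
Proof.
move=> A3; pose P e := (#|e| == 2) && cross C e.
have -> : #|[set e in bd A | cross C e]| = \sum_(e : {set V} | P e) odd #|star A e|.
  rewrite -sum1dep_card [RHS]big_mkcond [LHS]big_mkcond; apply: eq_bigr => e _.
  by rewrite /P inE -andbA andbC -andbA; case: (#|e| == 2); case: (odd _); case: (cross C e).
rewrite odd_sum_odd.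
have -> : \sum_(e : {set V} | P e) #|star A e| =
    \sum_(f in A) #|[set e in pairs f | cross C e]|.
  rewrite (eq_bigr (fun e => \sum_(f in A) (e \subset f))); last by move=> e _; apply: card_star.
  rewrite exchange_big; apply: eq_bigr => f _ /=.
  rewrite -sum1dep_card [LHS]big_mkcond [RHS]big_mkcond; apply: eq_bigr => e _.
  by rewrite /P !inE; case: (e \subset f); case: (#|e| == 2); case: (cross C e).
elim/big_ind: _ => // [a b|f fA]; first by rewrite oddD => /negbTE -> /negbTE ->.
exact/card_cross_pairs_even/A3.
Qed.

Lemma bd_degree A e v : (forall f, f \in A -> #|f| = 3) -> e \in bd A -> v \in e ->
  exists2 e', e' \in bd A & (e' != e) && (v \in e').
Proof.
move=> A3 eA ve; have := bd_cut_even [set v] A3.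
have crossv e' : cross [set v] e' = (v \in e').
  rewrite /cross; case: (boolP (v \in e')) => h; first by rewrite (setIidPr _) ?cards1 ?sub1set.
  by apply/negbTE; rewrite setIC (_ : _ :&: _ = set0) ?cards0 //; apply/eqP; rewrite setI_eq0 disjoints1.
set S := [set _ in _ | _] => oS.
have eS : e \in S by rewrite !inE crossv ve andbT in eA *; rewrite eA.
have [e'] : exists e', e' \in S :\ e.
  by apply/set0Pn; apply: contra oS => /eqP h; rewrite (cardsD1 e) eS h cards0.
by rewrite !inE crossv => /and3P [ne bde' ve']; exists e'; rewrite ?ne // inE.
Qed.

(** Every end of a boundary edge lies on a second boundary edge, by [bd_degree]. Following an edge
    at both ends gives three edges, and if there are no others they must close up to a triangle. *)
Lemma bd_small A : (forall f, f \in A -> #|f| = 3) -> bd A != set0 ->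
  3 <= #|bd A| /\ (#|bd A| = 3 -> exists2 t : {set V}, #|t| = 3 & bd A = pairs t).
Proof.
move=> A3 /set0Pn [e eA]; have := eA; rewrite inE => /andP [/eqP /pair_edge [u [v [uv ee]]] _].
have ue : u \in e by rewrite ee !inE eqxx.
have ve : v \in e by rewrite ee !inE eqxx orbT.
have [e2 e2A /andP [ne2 ue2]] := bd_degree A3 eA ue.
have [e3 e3A /andP [ne3 ve3]] := bd_degree A3 eA ve.
rewrite ee in eA ne2 ne3.
have other x e' : e' \in bd A -> x \in e' -> exists2 y, y != x & e' = [set x; y].
  rewrite inE => /andP [/eqP /pair_edge [a [b [ab ->]]] _]; rewrite !inE => /orP [] /eqP ->.
    by exists b; rewrite // eq_sym.
  by exists a; rewrite // setUC.
have [w wu e2E] := other u e2 e2A ue2; have [x xv e3E] := other v e3 e3A ve3.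
have wv : w != v by apply: contra ne2 => /eqP h; rewrite e2E h.
have xu : x != u by apply: contra ne3 => /eqP h; rewrite e3E h setUC.
have ne23 : e2 != e3.
  apply/eqP => h; have : u \in e3 by rewrite -h e2E !inE eqxx.
  by rewrite e3E !inE (negbTE uv) eq_sym (negbTE xu).
have sub : [set [set u; v]; e2; e3] \subset bd A by rewrite !subUset !sub1set eA e2A e3A.
have c3 : #|[set [set u; v]; e2; e3]| = 3.
  by rewrite -setUA cardsU1 cards2 ne23 !inE ![[set u; v] == _]eq_sym (negbTE ne2) (negbTE ne3).
split; first by rewrite -c3 subset_leq_card.
move=> cA; have bdE : bd A = [set [set u; v]; e2; e3].
  by apply/esym/eqP; rewrite eqEcard sub cA c3.
have we2 : w \in e2 by rewrite e2E !inE eqxx orbT.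
have [e4 e4A /andP [ne4 we4]] := bd_degree A3 e2A we2.
have : w \in e3.
  move: e4A we4 ne4; rewrite bdE !inE => /orP [/orP [] /eqP -> |/eqP -> //].
    by rewrite !inE (negbTE wv) (negbTE wu).
  by rewrite eqxx.
rewrite e3E !inE (negbTE wv) /= => /eqP wx; exists [set u; v; w].
  by rewrite -setUA cardsU1 cards2 !inE (negbTE uv) eq_sym (negbTE wu) eq_sym wv.
rewrite bdE pairs3; last by rewrite /= !inE (negbTE uv) eq_sym (negbTE wu) eq_sym wv.
by rewrite e2E e3E wx setUAC.
Qed.

End Boundary.

(** * Triangulated surfaces *)

Section Surface.
Variables (V : finType).
Implicit Types (A B FF M : {set {set V}}) (e f t C : {set V}).

(** [surface_conn] is connectedness across edges: the only mod-2 cycles are the empty set and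
    everything. Pinched vertices are still allowed here. *)
Record surface FF : Prop := Surface {
  surface_tri : forall f, f \in FF -> #|f| = 3;
  surface_two : forall e, e \in edges FF -> #|star FF e| = 2;
  surface_conn : forall A, A \subset FF -> bd A = set0 -> A = set0 \/ A = FF;
  surface_ne : FF != set0 }.

Variable FF : {set {set V}}.
Hypothesis surf : surface FF.
Let tri := surface_tri surf.

Lemma edges_card e : e \in edges FF -> #|e| = 2.
Proof. by rewrite inE => /andP [/eqP]. Qed.

Lemma pairs_edges f : f \in FF -> pairs f \subset edges FF.
Proof.
move=> fF; apply/subsetP => e; rewrite !inE => /andP [ef ->] /=.
by apply/set0Pn; exists f; rewrite inE fF.
Qed.

Lemma edge_faces e : e \in edges FF ->
  exists f g, [/\ f != g, star FF e = [set f; g], f \in FF, g \in FF & (e \subset f) && (e \subset g)].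
Proof.
move=> eE; have /eqP/cards2P [f [g [fg st]]] := surface_two surf eE.
have fs : f \in star FF e by rewrite st !inE eqxx.
have gs : g \in star FF e by rewrite st !inE eqxx orbT.
move: fs gs; rewrite !inE => /andP [fF ef] /andP [gF eg].
by exists f, g; split=> //; rewrite ef.
Qed.

Lemma in_bd A e f g : A \subset FF -> star FF e = [set f; g] -> f != g -> #|e| = 2 ->
  (e \in bd A) = (f \in A) (+) (g \in A).
Proof.
move=> AF st fg e2; rewrite inE e2 eqxx /=.
have -> : star A e = [set h in [set f; g] | h \in A].
  apply/setP => h; rewrite -st !inE; case hA: (h \in A); rewrite ?andbF //= andbT.
  by rewrite (subsetP AF).
rewrite -sum1dep_card big_mkcondr big_setU1 ?inE //= big_set1.
by case: (f \in A); case: (g \in A).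
Qed.

Lemma bd_surface : bd FF = set0.
Proof.
apply/setP => e; rewrite in_set0; apply/negbTE/negP => h.
have eE := subsetP (bd_sub_edges (subxx FF)) e h.
by move: h; rewrite inE (surface_two surf eE) andbF.
Qed.

Lemma bd_inj A B : A \subset FF -> B \subset FF -> bd A = bd B -> B = A \/ B = FF :\: A.
Proof.
move=> AF BF eqbd; have sF : symd A B \subset FF.
  by rewrite subUset !(subset_trans (subsetDl _ _)).
have : bd (symd A B) = set0 by rewrite bd_symd eqbd; apply/setP => x; rewrite in_symd in_set0 addbb.
case/(surface_conn surf sF) => /setP h; [left|right]; apply/setP => x; have := h x; rewrite in_symd.
  by rewrite in_set0; case: (x \in A); case: (x \in B).
rewrite inE; case xB: (x \in B); rewrite ?(subsetP BF _ xB) ?andbT; first by case: (x \in A).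
by case xA: (x \in A); rewrite ?(subsetP AF _ xA) //= => <-.
Qed.

(** The two faces at an edge share a vertex and so fall on the same side of [B]; hence the faces
    inside [B] form a set without boundary. *)
Lemma cover_conn (B : {set V}) : B \subset cover FF ->
  (forall f, f \in FF -> f \subset B \/ [disjoint f & B]) -> B = set0 \/ B = cover FF.
Proof.
move=> Bc dich; pose A := [set f in FF | f \subset B].
have AF : A \subset FF by apply/subsetP => f; rewrite inE => /andP [].
have bd0 : bd A = set0.
  apply/setP => e; rewrite in_set0; apply/negbTE/negP => eA.
  have eE := subsetP (bd_sub_edges AF) e eA.
  have [f [g [fg st fF gF /andP [ef eg]]]] := edge_faces eE.
  move: eA; rewrite (in_bd AF st fg (edges_card eE)) !inE fF gF /=.
  have [u ue] : exists u, u \in e.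
    by apply/set0Pn; rewrite -card_gt0 (edges_card eE).
  have dich' h : h \in FF -> e \subset h -> (h \subset B) = (u \in B).
    move=> hF eh; case: (dich h hF) => [hB|/disjoint_setI0 hB].
      by rewrite hB (subsetP hB) // (subsetP eh).
    case uB: (u \in B).
      by have := in_set0 u; rewrite -hB inE uB (subsetP eh).
    by apply/negbTE/negP => /subsetP/(_ u (subsetP eh _ ue)); rewrite uB.
  by rewrite !dich' // addbb.
case: (surface_conn surf AF bd0) => hA; [left|right].
  apply/setP => u; rewrite in_set0; apply/negbTE/negP => uB.
  have /bigcupP [f fF uf] := subsetP Bc u uB.
  case: (dich f fF) => [fB|/disjoint_setI0 fB].
    by have := in_set0 f; rewrite -hA inE fF fB.
  by have := in_set0 u; rewrite -fB inE uf uB.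
apply/eqP; rewrite eqEsubset Bc; apply/bigcupsP => f fF.
by move: fF; rewrite -{1}hA inE => /andP [].
Qed.

Variable K : realFieldType.
Local Open Scope ring_scope.
Notation cst := (cst K).

Lemma cst_cover (x : 'rV[K]_#|V|) : (x <= cst FF)%MS ->
  forall u v, u \in cover FF -> v \in cover FF -> val_at x u = val_at x v.
Proof.
move/cstP => h u v uc vc; pose B := [set w in cover FF | val_at x w == val_at x u].
have Bc : B \subset cover FF by apply/subsetP => w; rewrite inE => /andP [].
case: (@cover_conn B Bc).
- move=> f fF; have [|/subsetPn [w wf]] := boolP (f \subset B); first by left.
  have wc : w \in cover FF by apply/bigcupP; exists f.
  rewrite inE wc /= => xw; right; rewrite -setI_eq0; apply/eqP/setP => z; rewrite !inE.
  apply/negbTE/negP => /and3P [zf _ xz]; move: xw.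
  by rewrite (h f w z fF wf zf) xz.
- by move/setP/(_ u); rewrite !inE uc eqxx.
- by move/setP/(_ v); rewrite vc inE vc /= => /eqP.
Qed.

Lemma cst_cover_eq : (cst FF :=: cst [set cover FF])%MS.
Proof.
apply/eqmxP/andP; split; apply/rV_subP => x.
  by move=> h; apply/cstP => e u v; rewrite inE => /eqP ->; apply: cst_cover.
move/cstP => h; apply/cstP => f u v fF uf vf.
by apply: (h (cover FF)); rewrite ?set11 //; apply/bigcupP; exists f.
Qed.

Lemma rank_cst_surface : (\rank (cst FF) + #|cover FF| = #|V| + 1)%N.
Proof.
rewrite cst_cover_eq; apply: rank_cst1.
have /set0Pn [f fF] := surface_ne surf.
have /set0Pn [u uf] : f != set0 by rewrite -card_gt0 tri.
by apply/set0Pn; exists u; apply/bigcupP; exists f.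
Qed.

Lemma cst_edges : (cst (edges FF) :=: cst FF)%MS.
Proof.
apply/eqmxP/andP; split; apply: cst_sub => e u v eE ue ve uv.
  exists [set u; v]; last by rewrite !inE !eqxx orbT.
  by apply: (subsetP (pairs_edges eE)); rewrite in_pairs2 // ue.
have [f [g [_ _ fF _ /andP [/subsetP ef _]]]] := edge_faces eE.
by exists f; rewrite // !ef.
Qed.

(** Functions on faces that do not change across the edges outside [M], the planar dual of [cst M].
    They are defined on all of [{set V}], so every set outside [FF] adds a free dimension; this
    surplus cancels when [rank_steps] meets [rank_dual_le]. *)
Definition dual_cst M := cst [set star FF e | e in edges FF :\: M].

(** Adding [g] to [M] lowers the first rank or raises the second by at most one, and not both.
    Otherwise some [x] constant on [M] separates the ends of [g] and some dual function [a]
    separates its two faces; the boundary of a level set of [a] then crosses a level set of [x] in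
    [g] alone, against [bd_cut_even]. *)
Lemma rank_step M g : M \subset edges FF -> g \in edges FF :\: M ->
  (\rank (cst M) + \rank (dual_cst (g |: M)) <=
   (\rank (cst (g |: M)) + \rank (dual_cst M)).+1)%N.
Proof.
move=> ME; rewrite inE => /andP [gM gE].
have [u [v [uv gE2]]] := pair_edge (edges_card gE).
have [f [h [fh st fF hF _]]] := edge_faces gE.
have E1 : (cst (g |: M) :=: cst M :&: kermx (diff K u v))%MS by rewrite gE2; apply: cst_setU1_pair.
have E2 : (dual_cst M :=: dual_cst (g |: M) :&: kermx (diff K f h))%MS.
  suff E : edges FF :\: M = g |: (edges FF :\: (g |: M)).
    by rewrite /dual_cst E imsetU1 st; apply: cst_setU1_pair.
  apply/setP => x; rewrite !inE; have [->|xg] := eqVneq x g; first by rewrite gM; move: gE; rewrite inE.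
  by [].
rewrite E1 E2.
have [xs|] := boolP (cst M <= kermx (diff K u v))%MS.
  have <- : \rank (cst M) = \rank (cst M :&: kermx (diff K u v))%MS.
    apply/eqP; rewrite eqn_leq (mxrankS (capmxSl _ _)) andbT.
    by apply: mxrankS; rewrite sub_capmx submx_refl.
  by rewrite -addnS leq_add2l; apply: rank_cap_kermx.
case/row_subPn => i; set x := row i _ => xk.
have xM : (x <= cst M)%MS by exact: row_sub.
have xuv : val_at x u != val_at x v.
  by apply: contra xk => xx; apply/sub_kermxP/eqP; rewrite mul_diff_eq0.
have [as_|] := boolP (dual_cst (g |: M) <= kermx (diff K f h))%MS.
  have <- : \rank (dual_cst (g |: M)) = \rank (dual_cst (g |: M) :&: kermx (diff K f h))%MS.
    apply/eqP; rewrite eqn_leq (mxrankS (capmxSl _ _)) andbT.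
    by apply: mxrankS; rewrite sub_capmx submx_refl.
  by rewrite -addSn leq_add2r; apply: rank_cap_kermx.
case/row_subPn => j; set a := row j _ => ak.
have aM : (a <= dual_cst (g |: M))%MS by exact: row_sub.
have afh : val_at a f != val_at a h.
  by apply: contra ak => hh; apply/sub_kermxP/eqP; rewrite mul_diff_eq0.
pose A := [set k in FF | val_at a k == val_at a f].
pose C := [set w | val_at x w == val_at x u].
have AF : A \subset FF by apply/subsetP => k; rewrite inE => /andP [].
have := @bd_cut_even _ A C (fun k kA => tri (subsetP AF k kA)).
suff -> : [set e in bd A | cross C e] = [set g] by rewrite cards1.
apply/setP => e; rewrite in_set1 in_set; apply/andP/eqP => [[eA eC]|->]; last first.
  rewrite (in_bd AF st fh (edges_card gE)) !inE fF hF eqxx /= eq_sym (negbTE afh).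
  by rewrite gE2 cross2 // !inE eqxx /= eq_sym (negbTE xuv).
apply/eqP; apply: contraLR eC => eg.
have eE := subsetP (bd_sub_edges AF) e eA.
have [f' [h' [fh' st' fF' hF' _]]] := edge_faces eE.
have [u' [v' [uv' eE']]] := pair_edge (edges_card eE).
have eM : e \in M.
  apply: contraLR eA => eM; rewrite (in_bd AF st' fh' (edges_card eE)) !inE fF' hF' /=.
  move/cstP: aM => /(_ (star FF e) f' h') ->.
  - by rewrite addbb.
  - by apply: imset_f; rewrite !inE negb_or eg eM; move: eE; rewrite inE.
  - by rewrite st' !inE eqxx.
  - by rewrite st' !inE eqxx orbT.
rewrite eE' cross2 // !inE; move/cstP: xM => /(_ e u' v' eM) ->; rewrite ?addbb //.
- by rewrite eE' !inE eqxx.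
- by rewrite eE' !inE eqxx orbT.
Qed.

(** The steps are summed down from [M = edges FF], where the dual functions are unconstrained.
    Together with [rank_dual_le] this is Euler's inequality for the surface cut along [M]. *)
Lemma rank_steps M : M \subset edges FF ->
  (\rank (cst M) + #|{set V}| <= \rank (cst FF) + \rank (dual_cst M) + #|edges FF :\: M|)%N.
Proof.
elim: {M}_.+1 {-2}M (ltnSn #|edges FF :\: M|) => // n IH M; rewrite ltnS => leM ME.
have [M0|[g gM]] := set_0Vmem (edges FF :\: M).
  have MeqE : M = edges FF by apply/eqP; rewrite eqEsubset ME -setD_eq0 M0 eqxx.
  rewrite M0 cards0 addn0 {1}MeqE cst_edges leq_add2l /dual_cst M0 imset0.
  rewrite -[X in (X <= _)%N](mxrank1 K #|{set V}|); apply/mxrankS/rV_subP => x _.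
  by apply/cstP => e u v; rewrite inE.
have /andP [gnM gE] : (g \notin M) && (g \in edges FF) by move: gM; rewrite inE.
have cE : #|edges FF :\: M| = #|edges FF :\: (g |: M)|.+1.
  by rewrite (cardsD1 g) gM setDDl setUC.
have := rank_step ME gM; have := IH (g |: M).
rewrite -cE leM subUset sub1set gE ME => /(_ isT isT).
rewrite cE; lia_card.
Qed.

(** [adj], [class] and [classes] describe the regions into which the edges of [M] cut the
    surface. *)
Definition adj M : rel {set V} := fun f g =>
  [&& f \in FF, g \in FF & [exists e in edges FF :\: M, (e \subset f) && (e \subset g)]].
Definition class M f := [set g in FF | connect (adj M) f g].
Definition classes M := [set class M f | f in FF].

Lemma adj_sym M : connect_sym (adj M).
Proof.
apply: sym_connect_sym => f g; rewrite /adj andbCA; congr [&& _, _ & _].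
by apply: eq_existsb => e; congr (_ && _); rewrite andbC.
Qed.

Lemma class_eq M f g : f \in FF -> g \in class M f -> class M g = class M f.
Proof.
move=> fF; rewrite inE => /andP [gF fg]; apply/setP => h; rewrite !inE.
by rewrite (same_connect (adj_sym M) fg).
Qed.

Lemma class_refl M f : f \in FF -> f \in class M f.
Proof. by move=> fF; rewrite inE fF connect0. Qed.

Lemma rank_dual_le M :
  (\rank (dual_cst M) + #|FF| <= #|{set V}| + #|classes M|)%N.
Proof.
pose pt f : 'cV[K]_#|{set V}| := delta_mx (enum_rank f) 0.
pose rep (R : {set {set V}}) := odflt set0 [pick f in R].
(* The functionals are the values at all sets outside [FF] and at one representative of each
   region. *)
have := @rank_le_constraints K #|{set V}|
  ([seq pt f | f <- enum (~: FF)] ++ [seq pt (rep R) | R <- enum (classes M)]) (dual_cst M) 0.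
rewrite mxrank0 addn0 size_cat !size_map -!cardE => H.
have : (#|FF| + #|~: FF| = #|{set V}|)%N by rewrite cardsC.
suff : (\rank (dual_cst M) <= #|~: FF| + #|classes M|)%N.
  lia_card.
apply: H => x /cstP xW xs; suff -> : x = 0 by exact: sub0mx.
apply: val_at_inj => f; rewrite [RHS]mxE.
have val0 g : x *m pt g = 0 -> val_at x g = 0.
  by rewrite mul_delta => /matrixP/(_ 0 0); rewrite !mxE eqxx mulr1n.
have [fF|fF] := boolP (f \in FF); last first.
  apply: val0; apply: xs; rewrite mem_cat; apply/orP; left; apply/mapP.
  by exists f => //; rewrite mem_enum inE.
have -> : val_at x f = val_at x (rep (class M f)).
  have : rep (class M f) \in class M f.
    rewrite /rep; case: pickP => [//|/(_ f)]; by rewrite class_refl.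
  move: (rep _) => r; rewrite inE => /andP [_ /connectP [p]].
  elim: p f fF => [|g p IH] f fF /=; first by move=> _ ->.
  move=> /andP [/and3P [_ gF /exists_inP [e eE /andP [ef eg]]] pp] rE.
  rewrite -(IH g gF pp rE); apply: (xW (star FF e)); first by apply: imset_f.
    by rewrite inE fF.
  by rewrite inE gF.
apply: val0; apply: xs; rewrite mem_cat; apply/orP; right; apply/mapP.
by exists (class M f) => //; rewrite mem_enum imset_f.
Qed.

Lemma card_edges : (2 * #|edges FF| = 3 * #|FF|)%N.
Proof.
transitivity (\sum_(e in edges FF) #|star FF e|)%N.
  transitivity (\sum_(e in edges FF) 2)%N; first by rewrite sum_nat_const mulnC.
  by apply: eq_bigr => e eE; rewrite (surface_two surf eE).
rewrite (eq_bigr (fun e => \sum_(f in FF) (e \subset f)))%N; last by move=> e _; apply: card_star.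
transitivity (\sum_(f in FF) 3)%N; last by rewrite sum_nat_const mulnC.
rewrite exchange_big; apply: eq_bigr => f fF /=.
rewrite -(card_pairs3 (tri fF)) -sum1dep_card [LHS]big_mkcond [RHS]big_mkcond.
apply: eq_bigr => e _; case ef: (e \subset f); last by rewrite andFb; case: ifP.
have [e2|e2] := boolP (#|e| == 2); last by rewrite inE (negbTE e2).
by rewrite (subsetP (pairs_edges fF)) // inE ef e2.
Qed.

Lemma bd_class M f : f \in FF -> bd (class M f) \subset M.
Proof.
move=> fF; have cF : class M f \subset FF by apply/subsetP => h; rewrite inE => /andP [].
apply/subsetP => e eA; have eE := subsetP (bd_sub_edges cF) e eA.
apply: contraLR eA => eM.
have [h [k [hk st hF kF /andP [eh ek]]]] := edge_faces eE.
have ahk : connect (adj M) h k.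
  apply: connect1; rewrite /adj hF kF; apply/exists_inP; exists e; last by rewrite eh.
  by rewrite inE eM.
rewrite (in_bd cF st hk (edges_card eE)) !inE hF kF /=.
by rewrite (same_connect_r (adj_sym _) ahk) addbb.
Qed.

(** For [M = set0] there is one region, and the rank inequalities become [V - E + F <= 2], with
    [2E = 3F]. *)
Lemma surface_genus : (2 * #|cover FF| <= #|FF| + 4)%N.
Proof.
have rV : \rank (cst (set0 : {set {set V}})) = #|V|.
  apply/eqP; rewrite -/(row_full _) -sub1mx; apply/rV_subP => x _.
  by apply/cstP => e u v; rewrite inE.
have := rank_steps (sub0set _); have := rank_dual_le set0; rewrite setD0 rV.
have c1 : (#|classes set0| <= 1)%N.
  have /set0Pn [f fF] := surface_ne surf.
  suff : classes set0 \subset [set FF] by move/subset_leq_card; rewrite cards1.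
  apply/subsetP => R /imsetP [g gF ->]; rewrite in_set1; apply/eqP.
  have cF : class set0 g \subset FF by apply/subsetP => h; rewrite inE => /andP [].
  have b0 : bd (class set0 g) = set0 by apply/eqP; rewrite -subset0 bd_class.
  case: (surface_conn surf cF b0) => // /setP/(_ g).
  by rewrite class_refl // in_set0.
have := rank_cst_surface; have := card_edges; move: c1.
lia_card.
Qed.

End Surface.

(** * Regions cut out by a set of edges *)

Section Base.
Variables (V : finType) (K : realFieldType).
Implicit Types (A B M T : {set {set V}}) (e f t C : {set V}).
Local Open Scope ring_scope.
Local Notation cst := (cst K).
Local Notation vec := 'rV[K]_#|V|.

Variable FF : {set {set V}}.
Hypothesis surf : surface FF.
Let tri := surface_tri surf.

Lemma bd_regions M : M \subset edges FF ->
  (\sum_(R in classes FF M) #|bd R| <= 2 * #|M|)%N.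
Proof.
move=> ME; rewrite (eq_bigr (fun R => \sum_(e in M) (e \in bd R)))%N; last first.
  move=> R /imsetP [f fF ->]; rewrite -sum1_card [LHS]big_mkcond [RHS]big_mkcond.
  apply: eq_bigr => e _; case eb: (e \in bd _); last by case: ifP.
  by rewrite (subsetP (bd_class surf M fF) e eb).
rewrite exchange_big /= mulnC -sum_nat_const; apply: leq_sum => e eM.
have eE := subsetP ME e eM.
rewrite -(surface_two surf eE) -big_mkcondr sum1dep_card.
apply: leq_trans (leq_imset_card (class FF M) (star FF e)).
apply/subset_leq_card/subsetP => R; rewrite inE => /andP [/imsetP [f fF ->]] eb.
have [g] : exists g, g \in star (class FF M f) e.
  by apply/set0Pn; apply: contraL eb => /eqP h; rewrite inE h cards0 andbF.
rewrite inE => /andP [gf eg].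
have gF : g \in FF by move: gf; rewrite inE => /andP [].
by apply/imsetP; exists g; rewrite ?inE ?gF // (class_eq fF gf).
Qed.

(** A vanishing determinant means that [x] and [k] are proportional on [f] modulo constants; as [k]
    separates [u] from [v] and [x] does not, [x] is a zero multiple of [k] there. *)
Lemma wedge_corner f (x k : vec) u v : #|f| = 3 ->
  l1 f x * l2 f k - l2 f x * l1 f k = 0 -> u \in f -> v \in f ->
  val_at x u = val_at x v -> val_at k u != val_at k v ->
  forall a b, a \in f -> b \in f -> val_at x a = val_at x b.
Proof.
move=> f3 det uf vf xuv kuv.
suff : (l1 f x == 0) && (l2 f x == 0) by move/(face_constP x f3).
have [a [b [c [_ fE L1 L2]]]] := face_enum K f3.
move: det uf vf; rewrite !L1 !L2 fE !inE.
move=> det.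
have key (p q : K) : p * q = 0 -> q != 0 -> p == 0.
  by move=> /eqP; rewrite mulf_eq0 => /orP [//|/eqP ->]; rewrite eqxx.
have sub (p q : K) : p != q -> p - q != 0 by rewrite subr_eq0.
case/orP => [/orP [] |] /eqP uu /orP [/orP [] |] /eqP vv; move: xuv kuv; rewrite uu vv ?eqxx //.
- move=> h1 h2; rewrite -h1 subrr eqxx /=.
  apply: (key _ _ _ (sub _ _ h2)); move: det; rewrite -h1 => det.
  by rewrite -[RHS]det; ring.
- move=> h1 h2; rewrite -h1 subrr eqxx andbT.
  apply: (key _ _ _ (sub _ _ h2)); move: det; rewrite -h1 => det.
  by rewrite -[RHS]oppr0 -[in RHS]det; ring.
- move=> h1 h2; rewrite h1 subrr eqxx /=.
  apply: (key _ _ _ (sub _ _ h2)); move: det; rewrite h1 => det.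
  by rewrite -[RHS]oppr0 -[in RHS]det; ring.
- move=> h1 h2; rewrite -h1 andbb.
  apply: (key _ _ _ (sub _ _ h2)); move: det; rewrite -h1 => det.
  by rewrite -[RHS]oppr0 -[in RHS]det; ring.
- move=> h1 h2; rewrite h1 subrr eqxx andbT.
  apply: (key _ _ _ (sub _ _ h2)); move: det; rewrite h1 => det.
  by rewrite -[RHS]det; ring.
- move=> h1 h2; rewrite h1 andbb.
  apply: (key _ _ _ (sub _ _ h2)); move: det; rewrite h1 => det.
  by rewrite -[RHS]det; ring.
Qed.

Definition nontrivial M (R : {set {set V}}) := [exists f in R, ~~ (pairs f \subset M)].

(* On the triangles of a region, an element of [U] is determined up to a
   constant by its difference along one edge outside [M]. *)
Lemma collinear_rank M (U : 'M[K]_#|V|) : M \subset edges FF ->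
  (U <= cst M)%MS ->
  (forall u v, [set u; v] \in edges FF :\: M ->
     exists2 k : vec, (k <= U)%MS & val_at k u != val_at k v) ->
  (forall f (x k : vec), f \in FF -> ~~ (pairs f \subset M) -> (x <= U)%MS -> (k <= U)%MS ->
     l1 f x * l2 f k - l2 f x * l1 f k = 0) ->
  (\rank U <= #|[set R in classes FF M | nontrivial M R]| + \rank (cst FF))%N.
Proof.
move=> ME UM sep col.
pose cC (R : {set {set V}}) : 'cV[K]_#|V| :=
  if [pick p : V * V | (p.1 != p.2) && [exists f in R, [set p.1; p.2] \in pairs f :\: M]] is Some p
  then diff K p.1 p.2 else 0.
have := @rank_le_constraints K _ [seq cC R | R <- enum [set R in classes FF M | nontrivial M R]]
  U (cst FF).
rewrite size_map -cardE; apply=> x xU xc.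
have spread f u v : f \in FF -> [set u; v] \in pairs f :\: M -> u != v ->
    val_at x u = val_at x v -> forall a b, a \in f -> b \in f -> val_at x a = val_at x b.
  move=> fF; rewrite inE => /andP [uvM uvf] uv xuv.
  have uvE := subsetP (pairs_edges fF) _ uvf.
  have [k kU kuv] : exists2 k : vec, (k <= U)%MS & val_at k u != val_at k v.
    by apply: sep; rewrite inE uvM.
  move: (uvf); rewrite in_pairs2 // => /andP [uf vf].
  apply: (@wedge_corner f x k u v) => //; first exact: tri.
  by apply: col => //; apply/subsetPn; exists [set u; v].
have step f g : adj FF M f g ->
    (forall a b, a \in f -> b \in f -> val_at x a = val_at x b) ->
    (forall a b, a \in g -> b \in g -> val_at x a = val_at x b).
  case/and3P => fF gF /exists_inP [e]; rewrite inE => /andP [eM eE] /andP [ef eg] xf.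
  have [u [v [uv ee]]] := pair_edge (edges_card eE).
  apply: (@spread g u v) => //; first by rewrite -ee !inE eM eg (edges_card eE).
  by move: ef; rewrite ee subUset !sub1set => /andP [uf vf]; apply: xf.
apply/cstP => f u v fF uf vf.
have [triv|nt] := boolP (pairs f \subset M).
  have [-> //|uv] := eqVneq u v.
  have xM := submx_trans xU UM; move/cstP: xM => /(_ [set u; v]); apply.
  - by apply: (subsetP triv); rewrite in_pairs2 // uf.
  - by rewrite !inE eqxx.
  - by rewrite !inE eqxx orbT.
have ntR : nontrivial M (class FF M f).
  by apply/exists_inP; exists f => //; apply: class_refl.
have := xc (cC (class FF M f)).
rewrite map_f; last by rewrite mem_enum inE ntR imset_f.
move=> /(_ isT); rewrite /cC; case: pickP => [[p q] /= /andP [pq /exists_inP [g gR gp]]|]; last first.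
  have /subsetPn [e ef eM] := nt.
  have [p [q [pq ee]]] := pair_edge (edges_card (subsetP (pairs_edges fF) e ef)).
  move/(_ (p, q)); rewrite /= pq /= => /negbT/exists_inPn/(_ f (class_refl _ fF)).
  by rewrite inE -ee eM ef.
move/eqP; rewrite mul_diff_eq0 => /eqP xpq.
have gF : g \in FF by move: gR; rewrite inE => /andP [].
have xg := spread g p q gF gp pq xpq.
move: gR; rewrite inE (adj_sym) => /andP [_ /connectP [s]].
elim: s g gF xg {gp} => [|h s IH] g gF xg /=; first by move=> _ fg; move: uf vf; rewrite fg; apply: xg.
case/andP => gh ps fE; apply: (IH h) => //; last exact: step gh xg.
by case/and3P: gh.
Qed.

(** Write P and N for the numbers of all regions and of nontrivial ones. If N is at least two, a
    region has at least three boundary edges and a nontrivial one at least four, so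
    [3P + N <= 2 * #|M|]. The Euler inequality bounds the rank by [#|V| - 1 + P - #|M|], and
    [N <= P] finishes the count. *)
Lemma region_count M f0 : M \subset edges FF -> f0 \in FF -> pairs f0 \subset M ->
  (#|FF| + 4 = 2 * #|cover FF|)%N ->
  (forall A t, A \subset FF -> #|t| = 3 -> bd A = pairs t -> t \in FF) ->
  (#|[set R in classes FF M | nontrivial M R]| + \rank (cst M) < #|V|)%N.
Proof.
move=> ME f0F f0M euler nosep; set P := classes FF M; set N := [set R in P | _].
(* With at most one nontrivial region the three edges of [f0] suffice: they bring the rank down to
   at most [#|V| - 2]. *)
have [N1|N2] := leqP #|N| 1.
  have le : (\rank (cst M) <= \rank (cst [set f0]))%N.
    apply/mxrankS/cst_sub => e u v; rewrite inE => /eqP -> uf vf uv.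
    by exists [set u; v]; rewrite ?inE ?eqxx ?orbT // (subsetP f0M) // in_pairs2 // uf.
  have f00 : f0 != set0 by rewrite -card_gt0 tri.
  have := rank_cst1 K f00; rewrite tri //; move: le N1.
  lia_card.
have sumbd := bd_regions ME.
have sub R : R \in P -> R \subset FF.
  by case/imsetP => f fF ->; apply/subsetP => h; rewrite inE => /andP [].
have R3 R : R \in P -> forall f, f \in R -> #|f| = 3%N by move=> RP f fR; apply/tri/(subsetP (sub R RP)).
have RneR R : R \in P -> R != set0.
  by case/imsetP => f fF ->; apply/set0Pn; exists f; apply: class_refl.
have disj R S f : R \in P -> S \in P -> f \in R -> f \in S -> R = S.
  case/imsetP => g gF -> /imsetP [h hF ->] fg fh.
  by rewrite -(class_eq gF fg) -(class_eq hF fh).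
have bdM R : R \in P -> bd R \subset M by case/imsetP => f fF ->; apply: bd_class.
have other R : exists2 S, S \in N & S != R.
  have [S SN] : exists S, S \in N :\ R.
    apply/set0Pn; rewrite -card_gt0; have := cardsD1 R N; move: N2.
    by set a := #|_|; set b := #|_|; case: (R \in N); clearbody a b; clear -a b; lia.
  by move: SN; rewrite in_setD1 => /andP [SR SN]; exists S.
have bdne R : R \in P -> bd R != set0.
  move=> RP; apply/eqP => bd0.
  case: (surface_conn surf (sub R RP) bd0) => RE; first by have := RneR R RP; rewrite RE eqxx.
  have [S SN SR] := other R; have SP : S \in P by move: SN; rewrite inE => /andP [].
  have /set0Pn [f fS] := RneR S SP.
  by move: SR; rewrite (disj R S f) ?eqxx // RE (subsetP (sub S SP)).
have ge3 R : R \in P -> (3 <= #|bd R|)%N.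
  by move=> RP; have [] := bd_small (R3 R RP) (bdne R RP).
(* Three boundary edges would surround a face [t]. The region is then [t] alone, which is trivial,
   or all the other faces, which leaves no second nontrivial region. *)
have ge4 R : R \in N -> (4 <= #|bd R|)%N.
  rewrite inE => /andP [RP ntR]; rewrite ltn_neqAle ge3 // andbT; apply/eqP => c3.
  have [_ /(_ (esym c3)) [t t3 bt]] := bd_small (R3 R RP) (bdne R RP).
  have tF := nosep R t (sub R RP) t3 bt.
  have tM : pairs t \subset M by rewrite -bt bdM.
  have t1 : [set t] \subset FF by rewrite sub1set.
  have contra S : S \in P -> S = [set t] -> nontrivial M S = false.
    move=> _ ->; apply/negbTE/exists_inPn => f; rewrite inE => /eqP ->.
    by rewrite negbK.
  case: (bd_inj surf t1 (sub R RP) _) => [|RE|RE]; first by rewrite bd1 bt.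
    by rewrite (contra R) in ntR.
  have [S SN SR] := other R; have [SP ntS] : S \in P /\ nontrivial M S.
    by move: SN; rewrite inE => /andP.
  have SE : S = [set t].
    apply/eqP; rewrite eqEsubset sub1set; have /set0Pn [f fS] := RneR S SP.
    have St : S \subset [set t].
      apply/subsetP => g gS; rewrite inE; apply: contraR SR => gt.
      by apply/eqP/esym/(disj R S g) => //; rewrite RE !inE gt (subsetP (sub S SP)).
    by rewrite St /=; have := subsetP St f fS; rewrite inE => /eqP <-.
  by rewrite (contra S) in ntS.
have : (\sum_(R in P) (3 + (R \in N)) <= 2 * #|M|)%N.
  apply: leq_trans sumbd; apply: leq_sum => R RP; case RN: (R \in N); first exact: ge4.
  by rewrite addn0 ge3.
rewrite big_split /= sum_nat_const.
have -> : (\sum_(R in P) (R \in N) = #|N|)%N.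
  rewrite -sum1_card [LHS]big_mkcond [RHS]big_mkcond; apply: eq_bigr => R _.
  by rewrite inE; case: (R \in P); case: (nontrivial M R).
have : (#|N| <= #|P|)%N by apply/subset_leq_card/subsetP => R; rewrite inE => /andP [].
have := rank_steps surf K ME; have := rank_dual_le FF K M.
have := rank_cst_surface surf K; have := card_edges surf.
have : (#|edges FF :\: M| + #|M| = #|edges FF|)%N.
  by rewrite -(cardsID M (edges FF)) (setIidPr ME) addnC.
move: euler N2; rewrite -/P.
lia_card.
Qed.

End Base.

(** * Hypertrees in even spheres *)

Section Tree.
Variables (V : finType).
Implicit Types (A B M T FF : {set {set V}}) (e f t : {set V}).

Definition connects T (X : {set V}) := forall B : {set V},
  B \subset X -> B != set0 -> B != X ->
  exists2 f, f \in T & ~~ (f \subset B) && ~~ [disjoint f & B].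

(** A connected nonempty family of [#|T|] triples covers at most [2 * #|T| + 1] vertices, so the
    last field excludes cycles of the hypergraph. *)
Record hypertree FF T : Prop := Hypertree {
  hypertree_sub : T \subset FF;
  hypertree_conn : connects T (cover FF);
  hypertree_card : (#|T|.*2).+1 = #|cover FF| }.

Local Notation K := rat.

Lemma connects_of_cst FF T : surface FF -> (cst K T <= cst K FF)%MS -> connects T (cover FF).
Proof.
move=> surf TF B BX /set0Pn [u uB] BnX.
have [v vX vB] : exists2 v, v \in cover FF & v \notin B.
  by apply/subsetPn; apply: contra BnX => XB; rewrite eqEsubset BX.
apply/exists_inP; apply: contraT => /exists_inPn h.
pose g (w : V) : K := (w \in B)%:R%R.
have hc : (of_fun g <= cst K FF)%MS.
  apply: submx_trans TF; apply/cstP => f a b fT af bf; rewrite !val_of_fun /g.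
  have := h f fT; rewrite negb_and !negbK => /orP [/subsetP fB|fB]; first by rewrite !fB.
  by rewrite !(disjointFr fB).
have := cst_cover surf hc (subsetP BX u uB) vX.
by rewrite !val_of_fun /g uB (negbTE vB) => /eqP; rewrite oner_eq0.
Qed.

Lemma rad_eqS (U U' A : 'M[K]_#|V|) : (U <= U')%MS -> (U' <= U)%MS -> (rad U A <= rad U' A)%MS.
Proof.
move=> UU' U'U; apply/rV_subP => x /radP [xU xA]; apply/radP; split; first exact: submx_trans xU UU'.
by move=> a aU'; apply: xA; apply: submx_trans aU' U'U.
Qed.

(** The face [f0] is left out of the form and imposed as a constraint from the start, so that it
    belongs to the result. *)
Lemma base_tree FF f0 : surface FF -> #|FF| + 4 = 2 * #|cover FF| ->
  (forall A t, A \subset FF -> #|t| = 3 -> bd A = pairs t -> t \in FF) ->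
  odd #|cover FF| -> f0 \in FF -> exists2 T, hypertree FF T & f0 \in T.
Proof.
move=> surf euler nosep oddX f0F; have tri := surface_tri surf.
pose Y := FF :\ f0; have YF : Y \subset FF by exact: subsetDl.
have [y ycol] := generic_form K Y; set A := form Y y in ycol.
have skA : (A^T = - A)%R := form_skew Y y.
have rJ := rank_cst_surface surf K.
have f00 : f0 != set0 by rewrite -card_gt0 tri.
have r0 := rank_cst1 K f00; rewrite tri // in r0.
have M1F : [set f0] \subset FF by rewrite sub1set.
have [radJ|radJ] := boolP (rad (cst K [set f0]) A <= cst K FF)%MS.
  have [T [TY cT rT]] := tree_of_form tri YF M1F radJ.
  exists (f0 |: T); last exact: setU11; split.
  - by rewrite subUset M1F (subset_trans TY).
  - exact: connects_of_cst.
  - have f0T : f0 \notin T by apply/negP => /(subsetP TY); rewrite !inE eqxx.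
    move: rJ r0; rewrite rT cardsU1 f0T.
    lia_card.
pose M0 := pairs f0; have M0E : M0 \subset edges FF by exact: pairs_edges.
have le01 : (cst K [set f0] <= cst K M0)%MS.
  apply: cst_sub => e u v; rewrite inE => /andP [/subsetP ef _] ue ve _.
  by exists f0; rewrite ?set11 // !ef.
have le10 : (cst K M0 <= cst K [set f0])%MS.
  apply: cst_sub => e u v; rewrite inE => /eqP -> uf vf uv.
  by exists [set u; v]; rewrite ?in_pairs2 ?uf // !inE !eqxx orbT.
have rM0 : \rank (cst K M0) = \rank (cst K [set f0]).
  by apply/eqP; rewrite eqn_leq (mxrankS le01) (mxrankS le10).
have Jrad M : M \subset edges FF -> (cst K FF <= rad (cst K M) A)%MS.
  move=> ME; apply/rV_subP => x xJ; apply/radP; split.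
    by apply: submx_trans xJ _; rewrite -(cst_edges surf K); apply: cstS.
  move=> a _; suff -> : (x *m A = 0)%R by rewrite mul0mx.
  rewrite /A /form mulmx_sumr big1 // => f; rewrite inE => /andP [_ fF].
  have /andP [/eqP x1 /eqP x2] : (l1 f x == 0%R) && (l2 f x == 0%R).
    by apply/(face_constP x (tri f fF)) => u v; move/cstP: xJ; apply.
  by rewrite -scalemxAr wedge_const // scaler0.
(* The radical is strictly larger than [cst K FF]. Both have even codimension in [cst K M0], the
   former since skew forms have even rank, the latter since [#|cover FF| - 3] is even. So the ranks
   differ by at least 2, which makes up for [\rank (cst K M0) = #|V| - 2]. *)
have inv0 : #|V| + \rank (cst K FF) <= \rank (rad (cst K M0) A) + \rank (cst K M0).
  have := rank_rad (cst K M0) A.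
  have /negP/negP : ~~ odd (\rank (cst K M0 *m A *m (cst K M0)^T)%R).
    by apply: skew_rank_even; rewrite !trmx_mul trmxK skA mulNmx mulmxN mulmxA.
  have : \rank (cst K FF) < \rank (rad (cst K M0) A).
    rewrite ltn_neqAle (mxrankS (Jrad _ M0E)) andbT; apply: contra radJ => /eqP eqr.
    have [_] := mxrank_leqif_sup (Jrad _ M0E); rewrite eqr eqxx => /esym.
    by apply: submx_trans; apply: rad_eqS.
  rewrite rM0; move: r0 rJ oddX.
  lia_card.
pose inv M := [&& M0 \subset M, M \subset edges FF &
  #|V| + \rank (cst K FF) <= \rank (rad (cst K M) A) + \rank (cst K M)].
have invM0 : inv M0 by rewrite /inv subxx M0E.
have [M /and3P [M0M ME invM] Mmax] := arg_maxnP (fun M => #|M|) invM0.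
(* If the radical did not separate [u] from [v], this edge could be added to [M]: either [cst] stays
   the same, or it loses one dimension while the radical gains at least one by [rad_rank_capmx]. *)
have sep u v : [set u; v] \in edges FF :\: M ->
    exists2 k : 'rV[K]_#|V|, (k <= rad (cst K M) A)%MS & val_at k u != val_at k v.
  rewrite inE => /andP [uvM uvE].
  have [vanish|] := boolP (rad (cst K M) A <= kermx (diff K u v))%MS; last first.
    case/row_subPn => i h; exists (row i (rad (cst K M) A)); first exact: row_sub.
    by apply: contra h => h; apply/sub_kermxP/eqP; rewrite mul_diff_eq0.
  have E1 := cst_setU1_pair K M u v.
  suff : inv ([set u; v] |: M) by move/Mmax; rewrite /= cardsU1 uvM add1n ltnn.
  rewrite /inv subUset ME sub1set uvE (subset_trans M0M (subsetUr _ _)) /=.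
  have rE : \rank (rad (cst K ([set u; v] |: M)) A) = \rank (rad (cst K M :&: kermx (diff K u v))%MS A).
    have h1 : (cst K ([set u; v] |: M) <= cst K M :&: kermx (diff K u v))%MS by rewrite E1.
    have h2 : (cst K M :&: kermx (diff K u v) <= cst K ([set u; v] |: M))%MS by rewrite E1.
    have h3 := mxrankS (rad_eqS A h1 h2); have h4 := mxrankS (rad_eqS A h2 h1).
    by apply/eqP; rewrite eqn_leq h3 h4.
  rewrite rE E1; have [allk|] := boolP (cst K M <= kermx (diff K u v))%MS.
    have h1 : (cst K M <= cst K M :&: kermx (diff K u v))%MS by rewrite sub_capmx submx_refl.
    have h2 := capmxSl (cst K M) (kermx (diff K u v)).
    have h3 := mxrankS (rad_eqS A h1 h2); have h4 := mxrankS h1.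
    exact: leq_trans invM (leq_add h3 h4).
  case/row_subPn => i; set x := row i _ => xk.
  have xM : (x <= cst K M)%MS by exact: row_sub.
  have xc : (x *m diff K u v != 0)%R by apply: contra xk => /eqP h; apply/sub_kermxP.
  have := rank_cap_kermx_lt xM xc.
  have kv (k : 'rV[K]_#|V|) : (k <= rad (cst K M) A)%MS -> (k *m diff K u v = 0)%R.
    by move=> kR; apply/sub_kermxP/(submx_trans kR).
  have := rad_rank_capmx skA kv xM xc; move: invM.
  lia_card.
have radM : (rad (cst K M) A <= cst K M)%MS by exact: capmxSl.
have := collinear_rank surf ME radM sep.
have colY f (x k : 'rV[K]_#|V|) : f \in FF -> ~~ (pairs f \subset M) ->
    (x <= rad (cst K M) A)%MS -> (k <= rad (cst K M) A)%MS ->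
    (l1 f x * l2 f k - l2 f x * l1 f k = 0)%R.
  move=> fF fM xR kR; apply: (ycol M) => //; rewrite !inE fF andbT.
  by apply: contra fM => /eqP ->.
move=> /(_ colY); have := region_count K surf ME f0F M0M euler nosep.
move: invM.
lia_card.
Qed.

End Tree.

(** * Even spheres and their pieces along separating 3-cycles *)

Section Sphere.
Variables (V : finType).
Implicit Types (A D M T FF : {set {set V}}) (e f g t B C X : {set V}).

(** [sphere_link] excludes pinched vertices: the faces at [v] are connected through edges at [v]. In
    [sphere_even], [A] is one side of the 3-cycle [t], which need not be a face. *)
Record even_sphere FF : Prop := EvenSphere {
  sphere_surface : surface FF;
  sphere_euler : #|FF| + 4 = 2 * #|cover FF|;
  sphere_link : forall v A, A \subset [set f in FF | v \in f] ->
    (forall e f g, v \in e -> #|e| = 2 -> f \in FF -> g \in FF -> e \subset f -> e \subset g ->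
       f \in A -> g \in A) ->
    A = set0 \/ A = [set f in FF | v \in f];
  sphere_even : forall A t, A \subset FF -> #|t| = 3 -> bd A = pairs t ->
    ~~ odd #|cover A :\: t| }.

(** A triple that meets the vertices reached so far adds at most two new ones. *)
Lemma grow_bound X C T : (forall f, f \in T -> #|f| = 3) -> C \subset X ->
  (forall f, f \in T -> f \subset X) ->
  (forall B, C \subset B -> B \subset X -> B != X ->
     exists2 f, f \in T & ~~ (f \subset B) && ~~ [disjoint f & B]) ->
  #|X| <= #|C| + 2 * #|T|.
Proof.
elim: {T}_.+1 {-2}T (ltnSn #|T|) C => // n IH T; rewrite ltnS => leT C T3 CX TX conn.
have [->|CnX] := eqVneq C X; first exact: leq_addr.
have [f fT /andP [fC fdC]] := conn C (subxx C) CX CnX.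
have cT : #|T| = #|T :\ f|.+1 by rewrite (cardsD1 f) fT.
have cC : #|C :|: f| <= #|C| + 2.
  have : 0 < #|f :&: C| by rewrite card_gt0 setI_eq0.
  by rewrite cardsU (T3 f fT) setIC; lia.
have T3' g : g \in T :\ f -> #|g| = 3 by rewrite inE => /andP [_]; apply: T3.
have TX' g : g \in T :\ f -> g \subset X by rewrite inE => /andP [_]; apply: TX.
have CX' : C :|: f \subset X by rewrite subUset CX TX.
have := IH (T :\ f) _ (C :|: f) T3' CX' TX'; rewrite -cT => /(_ leT) H.
suff : #|X| <= #|C :|: f| + 2 * #|T :\ f| by move: cC; rewrite cT; clear; lia.
apply: H => B CB BX BnX; have [CB' fB] : C \subset B /\ f \subset B.
  by move: CB; rewrite subUset => /andP.
have [g gT gB] := conn B CB' BX BnX; exists g => //; rewrite !inE gT andbT.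
by apply: contraTneq gB => ->; rewrite fB.
Qed.

(** If [f] and [g] shared two vertices, growth could start from the at most four vertices of
    [f :|: g], and the other [#|T| - 2] faces would reach at most [2 * #|T|] vertices, one too
    few. *)
Lemma hypertree_share FF T f g : surface FF -> hypertree FF T ->
  f \in T -> g \in T -> f != g -> #|f :&: g| <= 1.
Proof.
move=> surf [TF conn card] fT gT fg; rewrite leqNgt; apply/negP => fg2.
have T3 h : h \in T -> #|h| = 3 by move/(subsetP TF)/(surface_tri surf).
have TX h : h \in T -> h \subset cover FF.
  by move=> hT; apply: bigcup_max (subxx _); apply: (subsetP TF).
have : #|cover FF| <= #|f :|: g| + 2 * #|T :\ f :\ g|.
  apply: grow_bound.
  - by move=> h; rewrite !inE => /and3P [_ _]; apply: T3.
  - by rewrite subUset !TX.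
  - by move=> h; rewrite !inE => /and3P [_ _]; apply: TX.
  move=> B; rewrite subUset => /andP [fB gB] BX BnX.
  have B0 : B != set0.
    by apply: contraTneq fB => ->; rewrite subset0 -cards_eq0 T3.
  have [h hT hB] := conn B BX B0 BnX; exists h => //; rewrite !inE hT andbT.
  by apply/andP; split; apply: contraTneq hB => ->; rewrite ?fB ?gB.
have cT : #|T| = (#|T :\ f :\ g|).+2.
  by rewrite (cardsD1 f) fT (cardsD1 g (T :\ f)) !inE gT eq_sym fg.
by move: card; rewrite cardsU (T3 f fT) (T3 g gT) cT; move: fg2; clear; lia.
Qed.

Lemma pairs_inj f g : #|f| = 3 -> #|g| = 3 -> pairs f = pairs g -> f = g.
Proof.
move=> f3 g3 fg; apply/eqP; rewrite eqEcard f3 g3 leqnn andbT; apply/subsetP => x xf.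
have [y] : exists y, y \in f :\ x.
  by apply/set0Pn; rewrite -card_gt0; move: f3; rewrite (cardsD1 x) xf; case: #|_|.
rewrite !inE => /andP [yx yf]; have xy : x != y by rewrite eq_sym.
by have := in_pairs2 f xy; rewrite xf yf fg in_pairs2 // => /andP [].
Qed.

Section Split.
Variables (FF D : {set {set V}}) (t : {set V}).
Hypotheses (sph : even_sphere FF) (DF : D \subset FF) (t3 : #|t| = 3) (tF : t \notin FF).
Hypothesis bdD : bd D = pairs t.
Let surf := sphere_surface sph.
Let tri := surface_tri surf.
Local Notation FD := (t |: D).
Local Notation E := (FF :\: D).

Lemma bd_compl : bd E = pairs t.
Proof.
have -> : E = symd FF D.
  by apply/setP => f; rewrite in_symd !inE; case fD: (f \in D); rewrite ?(subsetP DF _ fD) // addbF.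
by rewrite bd_symd (bd_surface surf) bdD; apply/setP => e; rewrite in_symd in_set0.
Qed.

Lemma t_notin_D : t \notin D.
Proof. by apply: contra tF; apply: (subsetP DF). Qed.

Lemma bd_piece : bd FD = set0.
Proof.
have -> : FD = symd [set t] D.
  apply/setP => f; rewrite in_symd !inE; have [->|//] := eqVneq f t.
  by rewrite (negbTE t_notin_D).
by rewrite bd_symd bd1 bdD; apply/setP => e; rewrite in_symd in_set0 addbb.
Qed.

Lemma t_sub_cover A : bd A = pairs t -> t \subset cover A.
Proof.
move=> bA; apply/subsetP => x xt.
have [y] : exists y, y \in t :\ x.
  by apply/set0Pn; rewrite -card_gt0; move: t3; rewrite (cardsD1 x) xt; case: #|_|.
rewrite !inE => /andP [yx yt]; have xy : x != y by rewrite eq_sym.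
have : [set x; y] \in bd A by rewrite bA in_pairs2 // xt.
move/(subsetP (bd_sub_edges (subxx A))); rewrite inE => /andP [_ /set0Pn [f]].
by rewrite inE subUset !sub1set => /and3P [fA xf _]; apply/bigcupP; exists f.
Qed.

Lemma bd_face_in e : e \in pairs t -> exists2 f, f \in D & e \subset f.
Proof.
rewrite -bdD inE => /andP [_ o]; have [f] : exists f, f \in star D e.
  by apply/set0Pn; apply: contraL o => /eqP ->; rewrite cards0.
by rewrite inE => /andP [fD ef]; exists f.
Qed.

Lemma piece_surface : surface FD.
Proof.
have DneF : D != FF.
  apply/eqP => DE; have := bdD; rewrite DE (bd_surface surf) => /esym/(congr1 (fun A => #|A|)).
  by rewrite card_pairs3 // cards0.
split.
- by move=> f; rewrite !inE => /orP [/eqP -> //|/(subsetP DF)/tri].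
- move=> e eE; have e2 := edges_card eE.
  have sE : star FD e = (if e \subset t then [set t] else set0) :|: star D e.
    apply/setP => f; rewrite !inE; have [->|ft] := eqVneq f t.
      by rewrite (negbTE t_notin_D); case: ifP; rewrite !inE ?eqxx.
    by case: ifP; rewrite !inE ?(negbTE ft).
  have le2 : #|star D e| <= 2.
    have [->|/set0Pn [f]] := eqVneq (star D e) set0; first by rewrite cards0.
    rewrite inE => /andP [fD ef]; have fF := subsetP DF f fD.
    rewrite -(surface_two surf (e := e)).
      apply: subset_leq_card; apply/subsetP => g; rewrite !inE => /andP [gD ->].
      by rewrite (subsetP DF).
    by apply: (subsetP (pairs_edges fF)); rewrite inE ef e2.
  have ebd : (e \in bd D) = (e \subset t) by rewrite bdD inE e2 andbT.
  move: ebd; rewrite inE e2 eqxx /= => od; rewrite sE cardsU -od; case: ifP => o.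
    have -> : [set t] :&: star D e = set0.
      by apply/eqP; rewrite setI_eq0 disjoints1 inE (negbTE t_notin_D).
    by rewrite cards0 cards1 subn0; move: o le2; case: #|_| => [|[|[|]]].
  rewrite set0I !cards0 subn0 add0n.
  have : star D e != set0.
    by move: eE; rewrite inE sE -od o set0U e2 => /andP [].
  by rewrite -card_gt0; move: o le2; case: #|_| => [|[|[|]]].
- have key A : A \subset D -> bd A = set0 -> A = set0.
    move=> AD bA; case: (surface_conn surf (subset_trans AD DF) bA) => // AF.
    by move: DneF; rewrite eqEsubset DF -{1}AF AD.
  move=> A AF bA; have [tA|tA] := boolP (t \in A).
    right; have : FD :\: A = set0.
      apply: key.
        apply/subsetP => f; rewrite !inE => /andP [fA /orP [/eqP ft|//]].
        by rewrite ft tA in fA.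
      have -> : FD :\: A = symd FD A.
        apply/setP => f; rewrite in_symd in_setD; case fA: (f \in A); last by rewrite addbF.
        by rewrite (subsetP AF f fA).
      by rewrite bd_symd bd_piece bA; apply/setP => e; rewrite in_symd in_set0.
    by move/eqP; rewrite setD_eq0 => h; apply/eqP; rewrite eqEsubset AF.
  left; apply: key => //; apply/subsetP => f fA.
  by have := subsetP AF f fA; rewrite !inE => /orP [/eqP ft|//]; rewrite -ft fA in tA.
- by apply/set0Pn; exists t; rewrite setU11.
Qed.

Lemma cover_piece : cover FD = cover D.
Proof.
rewrite /cover bigcup_setU big_set1; apply/setUidPr; exact: t_sub_cover.
Qed.

Lemma cover_compl : cover D :|: cover E = cover FF.
Proof. by rewrite /cover -bigcup_setU setDE setUIr setUCr setIT (setUidPr DF). Qed.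

(** At a vertex off [t] no edge lies in the boundary of [D], so the faces of [D] there are closed
    under crossing edges. By [sphere_link] they are all the faces at that vertex or none. *)
Lemma cover_meet : cover D :&: cover E = t.
Proof.
have tD := t_sub_cover bdD; have tE := t_sub_cover bd_compl.
apply/eqP; rewrite eqEsubset [X in _ && X]subsetI tD tE !andbT.
apply/subsetP => v; rewrite inE => /andP [/bigcupP [f fD vf] /bigcupP [g gE vg]].
apply: contraT => vt; move: gE; rewrite inE => /andP [gD gF].
pose A := [set h in D | v \in h].
have AF : A \subset [set h in FF | v \in h].
  by apply/subsetP => h; rewrite !inE => /andP [/(subsetP DF) -> ->].
have closed e h k : v \in e -> #|e| = 2 -> h \in FF -> k \in FF -> e \subset h -> e \subset k ->
    h \in A -> k \in A.
  move=> ve e2 hF kF eh ek; rewrite !inE => /andP [hD _]; rewrite (subsetP ek) // andbT.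
  have [<- //|hk] := eqVneq h k; apply: contraT => kD.
  have eE : e \in edges FF by apply: (subsetP (pairs_edges hF)); rewrite inE eh e2.
  have st : star FF e = [set h; k].
    apply/esym/eqP; rewrite eqEcard (surface_two surf eE) cards2 hk leqnn andbT.
    by rewrite subUset !sub1set !inE hF kF eh ek.
  have : e \in bd D by rewrite (in_bd DF st hk e2) hD (negbTE kD).
  by rewrite bdD inE => /andP [/subsetP/(_ v ve)]; rewrite (negbTE vt).
case: (sphere_link sph AF closed) => /setP h; first by have := h f; rewrite !inE fD vf.
by have := h g; rewrite !inE gF vg (negbTE gD).
Qed.

Lemma card_cover_split : #|cover FF| + 3 = #|cover D| + #|cover E|.
Proof. by rewrite -cover_compl -t3 -cover_meet cardsUI. Qed.

Lemma card_piece_lt : #|FD| < #|FF|.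
Proof.
have E2 : 1 < #|E|.
  rewrite ltnNge; apply/negP => E1.
  have [E0|[g gE]] := set_0Vmem E.
    by have := bd_compl; rewrite E0 bd0 => /esym/eqP; rewrite -cards_eq0 card_pairs3.
  have Eg : E = [set g].
    by apply/esym/eqP; rewrite eqEcard sub1set gE cards1.
  have gF : g \in FF by move: gE; rewrite inE => /andP [].
  have := bd_compl; rewrite Eg bd1 => /(pairs_inj (tri gF) t3) gt.
  by move: tF; rewrite -gt gF.
rewrite cardsU1 t_notin_D -(cardsID D FF) (setIidPr DF).
by rewrite /= add1n -addn1 ltn_add2l.
Qed.

Lemma card_split : #|FD| + #|t |: E| = #|FF| + 2.
Proof.
have tE : t \notin E by rewrite inE negb_and tF orbT.
rewrite !cardsU1 t_notin_D tE -(cardsID D FF) (setIidPr DF) /=.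
lia_card.
Qed.

End Split.

Lemma piece_sphere FF D t : even_sphere FF -> D \subset FF -> #|t| = 3 -> t \notin FF ->
  bd D = pairs t -> even_sphere (t |: D).
Proof.
move=> sph DF t3 tF bdD; have surf := sphere_surface sph; have tri := surface_tri surf.
pose E := FF :\: D; have EF : E \subset FF by exact: subsetDl.
have bdE : bd E = pairs t by exact: (bd_compl sph DF bdD).
have DE : FF :\: E = D by rewrite setDDr setDv set0U; apply/setIidPr.
have tD : t \notin D by exact: (t_notin_D DF tF).
have tE : t \notin E by exact: (t_notin_D EF tF).
have tcD := t_sub_cover t3 bdD; have tcE := t_sub_cover t3 bdE.
have meet : cover D :&: cover E = t by exact: (cover_meet sph DF t3 bdD).
have cD : cover (t |: D) = cover D by exact: (cover_piece t3 bdD).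
have cE : cover (t |: E) = cover E by exact: (cover_piece t3 bdE).
split.
- exact: (piece_surface sph DF t3 tF bdD).
(* Both pieces satisfy [2V <= F + 4], and the two inequalities add up to Euler's equality for [FF],
   so each is an equality. *)
- have g1 := surface_genus (piece_surface sph DF t3 tF bdD) rat.
  have g2 := surface_genus (piece_surface sph EF t3 tF bdE) rat.
  have c1 := card_cover_split sph DF t3 bdD.
  have c2 := card_split DF tF.
  move: g1 g2 c1 c2 (sphere_euler sph); rewrite cD cE -/E.
  lia_card.
- move=> v.
  (* A family at [v] that misses the cap [t] can be tested inside [FF]. A family containing [t] is
     handled through its complement. *)
  have key A : A \subset [set f in t |: D | v \in f] -> t \notin A ->
    (forall e f g, v \in e -> #|e| = 2 -> f \in t |: D -> g \in t |: D -> e \subset f -> e \subset g ->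
       f \in A -> g \in A) -> A = set0 \/ A = [set f in t |: D | v \in f].
    move=> AS tA closed.
    have AD : A \subset D.
      apply/subsetP => f fA; have := subsetP AS f fA; rewrite !inE => /andP [/orP [/eqP ft|//] _].
      by rewrite -ft fA in tA.
    have AS' : A \subset [set f in FF | v \in f].
      apply/subsetP => f fA; rewrite inE (subsetP DF) ?(subsetP AD) //=.
      by have := subsetP AS f fA; rewrite inE => /andP [].
    have closed' e f g : v \in e -> #|e| = 2 -> f \in FF -> g \in FF -> e \subset f -> e \subset g ->
       f \in A -> g \in A.
      move=> ve e2 fF gF ef eg fA; have fD := subsetP AD f fA.
      have [gD|gD] := boolP (g \in D).
        by apply: (closed e f g) => //; rewrite !inE ?fD ?gD orbT.
      have fg : f != g by apply: contraNneq gD => <-.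
      have eE : e \in edges FF by apply: (subsetP (pairs_edges fF)); rewrite inE ef e2.
      have st : star FF e = [set f; g].
        apply/esym/eqP; rewrite eqEcard (surface_two surf eE) cards2 fg leqnn andbT.
        by rewrite subUset !sub1set !inE fF gF ef eg.
      have : e \in bd D by rewrite (in_bd DF st fg e2) fD (negbTE gD).
      rewrite bdD inE => /andP [et _]; move: tA.
      by rewrite (closed e f t ve e2 _ _ ef et fA) // !inE ?fD ?eqxx ?orbT.
    case: (sphere_link sph AS' closed') => [->|AE]; first by left.
    have [/bigcupP [g gE vg]|vE] := boolP (v \in cover E).
      have : g \in A by rewrite AE inE vg (subsetP EF).
      by move/(subsetP AD); move: gE; rewrite inE => /andP [/negbTE ->].
    right; apply/eqP; rewrite eqEsubset AS; apply/subsetP => f; rewrite !inE => /andP [/orP [/eqP ->|fD] vf].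
      by case/negP: vE; apply: (subsetP tcE).
    by rewrite AE inE (subsetP DF).
  move=> A AS closed; have [tA|tA] := boolP (t \in A); last exact: key.
  pose S := [set f in t |: D | v \in f].
  have : S :\: A = set0 \/ S :\: A = S.
    apply: key; first exact: subsetDl.
      by rewrite inE tA.
    move=> e f g ve e2 fF gF ef eg; rewrite !inE => /andP [fA _].
    move: (gF); rewrite !inE => ->; rewrite (subsetP eg) // !andbT.
    by apply: contra fA => gA; apply: (closed e g f).
  case=> SA; [right|left]; apply/eqP; last first.
    have : t \in S by apply: (subsetP AS).
    by rewrite -SA inE tA.
  by rewrite eqEsubset AS -setD_eq0 SA eqxx.
move=> A u AF u3 bA.
have [tA|tA] := boolP (t \in A); last first.
  apply: (sphere_even sph) => //; apply/subsetP => f fA.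
  have := subsetP AF f fA; rewrite !inE => /orP [/eqP ft|]; last exact: (subsetP DF).
  by rewrite -ft fA in tA.
(* Replacing the cap [t] by the far side [E] gives faces of [FF] with the same boundary, and adds
   the vertices of [cover E] off [t], an even number. *)
pose A2 := symd A (t |: E).
have A2E : A2 = (A :\ t) :|: E.
  apply/setP => f; rewrite in_symd !inE; have [->|ft] := eqVneq f t; first by rewrite tA (negbTE tF) andbF.
  case fA: (f \in A) => /=; last by [].
  have := subsetP AF f fA; rewrite !inE (negbTE ft) /= => ->.
  by [].
have bA2 : bd A2 = pairs u.
  by rewrite bd_symd (bd_piece EF tF bdE) bA; apply/setP => e; rewrite in_symd in_set0 addbF.
have A2F : A2 \subset FF.
  rewrite A2E subUset EF andbT; apply/subsetP => f; rewrite !inE => /andP [ft fA].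
  by have := subsetP AF f fA; rewrite !inE (negbTE ft) => /(subsetP DF).
have ev2 := sphere_even sph A2F u3 bA2.
have evE := sphere_even sph EF t3 bdE.
have ucA : u \subset cover A by exact: (t_sub_cover u3 bA).
have cA : cover A \subset cover D.
  by rewrite -cD; apply/bigcupsP => f fA; apply: bigcup_max (subxx _); apply: (subsetP AF).
have cAE : cover A = cover (A :\ t) :|: t.
  by rewrite -{1}(setD1K tA) /cover bigcup_setU big_set1 setUC.
have cA2 : cover A2 :\: u = (cover A :\: u) :|: (cover E :\: t).
  have -> : cover A2 = cover (A :\ t) :|: cover E by rewrite A2E /cover bigcup_setU.
  have xcA := subsetP cA; rewrite cAE in xcA *.
  apply/setP => x; have := congr1 (fun S : {set V} => x \in S) meet; rewrite /= inE => xm; rewrite !inE.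
  have xE : x \in t -> x \in cover E by apply: (subsetP tcE).
  have xu : x \in u -> x \in cover D by move/(subsetP ucA)/(subsetP cA).
  move: (xcA x); rewrite !inE; move: xm xE xu; case: (x \in cover E); case: (x \in t); case: (x \in u); case: (x \in cover D);
    case: (x \in cover (A :\ t)) => //= h1 h2 h3 h4;
    by [have := h2 isT | have := h3 isT | have := h4 isT].
have dis : (cover A :\: u) :&: (cover E :\: t) = set0.
  apply/setP => x; rewrite !inE; apply/negbTE/negP => /and3P [/andP [_ xA] xt xE].
  by move: xt; rewrite -meet inE xE (subsetP cA).
move: ev2; rewrite cA2 cardsU dis cards0 subn0 oddD (negbTE evE) addbF.
by [].
Qed.

End Sphere.

(** * Gluing hypertrees *)

Section TriTree.
Variables (V : finType).
Implicit Types (A D E M T FF : {set {set V}}) (e f g t B C X : {set V}).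

(** The faces of [Tb] take over the role of the removed [t]. If they do not cross [B], then [B]
    contains all of [cover E] or none of it, so [t] does not cross [B] either and the face found in
    [Ta] is another one. *)
Lemma glue_connects D E (Ta Tb : {set {set V}}) t : t \subset cover D -> t \subset cover E -> t != set0 ->
  Ta \subset t |: D -> Tb \subset t |: E -> t \in Ta -> t \notin Tb ->
  connects Ta (cover D) -> connects Tb (cover E) ->
  connects ((Ta :|: Tb) :\ t) (cover D :|: cover E).
Proof.
move=> tD tE t0 TaD TbE tTa tTb ca cb B BX B0 BnX.
have subE f : f \in Tb -> f \subset cover E.
  move/(subsetP TbE); rewrite !inE => /orP [/eqP -> //|fE].
  exact: bigcup_max (subxx _).
have subD f : f \in Ta -> f \subset cover D.
  move/(subsetP TaD); rewrite !inE => /orP [/eqP -> //|fE].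
  exact: bigcup_max (subxx _).
have lift X f : f \subset X -> ~~ (f \subset B :&: X) && ~~ [disjoint f & B :&: X] ->
    ~~ (f \subset B) && ~~ [disjoint f & B].
  move=> fX; rewrite subsetI fX andbT => /andP [-> /=]; apply: contra.
  by rewrite -!setI_eq0 => /eqP h; rewrite setIA h set0I.
have [BE0|BE0] := eqVneq (B :&: cover E) set0; last first.
  have [BEE|BEE] := eqVneq (B :&: cover E) (cover E); last first.
    have [f fT fB] := cb _ (subsetIr _ _) BE0 BEE.
    exists f; last by apply: lift fB; apply: subE.
    by rewrite !inE fT orbT andbT; apply: contraNneq tTb => <-.
  have EB : cover E \subset B by rewrite -BEE subsetIl.
  have [||f fT fB] := ca (B :&: cover D) (subsetIr _ _).
  - case/set0Pn: t0 => x xt; apply/set0Pn; exists x.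
    by rewrite inE (subsetP EB) ?(subsetP tE) ?(subsetP tD).
  - apply: contra BnX => /eqP DB; rewrite eqEsubset BX subUset EB andbT.
    by rewrite -DB subsetIl.
  have fB' := lift _ f (subD f fT) fB; exists f => //.
  rewrite !inE fT andbT; apply: contraTneq fB' => ->.
  by rewrite (subset_trans tE EB).
have BD : B \subset cover D.
  apply/subsetP => x xB; have := subsetP BX x xB; rewrite inE => /orP [//|xE].
  by have := in_set0 x; rewrite -BE0 inE xB xE.
have [|f fT fB] := ca B BD B0.
  case/set0Pn: t0 => x xt; apply: contraNneq (negbT (in_set0 x)) => BE.
  by rewrite -BE0 inE BE (subsetP tD) ?(subsetP tE).
exists f => //; rewrite !inE fT andbT; apply: contraTneq fB => ->.
rewrite negb_and negbK; apply/orP; right; rewrite negbK -setI_eq0 -subset0 -BE0.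
by rewrite setIC setIS.
Qed.

Theorem even_sphere_hypertree FF f : even_sphere FF -> f \in FF ->
  exists2 T, hypertree FF T & f \in T.
Proof.
elim: {FF}_.+1 {-2}FF (ltnSn #|FF|) f => // n IH FF; rewrite ltnS => leF f sph fF.
have surf := sphere_surface sph; have tri := surface_tri surf.
have [|nosep] := boolP [exists A : {set {set V}}, exists t : {set V},
    [&& A \subset FF, #|t| == 3, bd A == pairs t & t \notin FF]]; last first.
  apply: base_tree => //; first exact: sphere_euler.
    move=> A t AF t3 bA; apply: contraR nosep => tF.
    by apply/existsP; exists A; apply/existsP; exists t; rewrite AF t3 bA !eqxx.
  (* All faces but [f] form a side of [f], so evenly many vertices lie off [f] and the total number
     is odd. *)
  pose A := FF :\ f; have AF : A \subset FF by exact: subsetDl.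
  have bA : bd A = pairs f.
    have -> : A = symd FF [set f].
      apply/setP => g; rewrite in_symd !inE; have [->|//] := eqVneq g f; first by rewrite fF.
      by rewrite addbF.
    by rewrite bd_symd (bd_surface surf) bd1; apply/setP => e; rewrite in_symd in_set0.
  have fA : f \subset cover A := t_sub_cover (tri f fF) bA.
  have := sphere_even sph AF (tri f fF) bA.
  have -> : cover A = cover FF.
    by rewrite -[in RHS](setD1K fF) /cover bigcup_setU big_set1; apply/esym/setUidPr.
  have fX : f \subset cover FF by apply: bigcup_max (subxx _).
  rewrite -(cardsID f (cover FF)) (setIidPr fX) (tri f fF) oddD.
  by case: (odd _).
case/existsP => A0 /existsP [t /and4P [A0F /eqP t3 /eqP bA0 tF]].
(* Both sides have boundary [t]; the one containing the prescribed face is called [D]. *)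
have [D [DF fD bD]] : exists D, [/\ D \subset FF, f \in D & bd D = pairs t].
  have [fA|fA] := boolP (f \in A0); first by exists A0.
  exists (FF :\: A0); split; [exact: subsetDl|by rewrite inE fA|exact: bd_compl sph A0F bA0].
pose E := FF :\: D; have EF : E \subset FF by exact: subsetDl.
have bE : bd E = pairs t := bd_compl sph DF bD.
have sD := piece_sphere sph DF t3 tF bD; have sE := piece_sphere sph EF t3 tF bE.
have ltD := leq_trans (card_piece_lt sph DF t3 tF bD) leF.
have ltE := leq_trans (card_piece_lt sph EF t3 tF bE) leF.
have cD := cover_piece t3 bD; have cE := cover_piece t3 bE.
have tD := t_notin_D DF tF; have tE := t_notin_D EF tF.
have tcD := t_sub_cover t3 bD; have tcE := t_sub_cover t3 bE.
have t0 : t != set0 by rewrite -cards_eq0 t3.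
have cX := cover_compl DF; rewrite -/E in cX.
have ft : f != t by apply: contraNneq tF => <-.
have [T1 h1 fT1] := IH _ ltD f sD (setU1r _ fD).
have glue (Ta Tb Da Db : {set {set V}}) : Ta \subset t |: Da -> Tb \subset t |: Db -> t \in Ta -> t \notin Tb ->
  [disjoint Da & Db] -> #|(Ta :|: Tb) :\ t|.+1 = #|Ta| + #|Tb|.
  move=> aD bE' ta tb dis; rewrite -(cardsUI Ta Tb) (cardsD1 t (_ :|: _)) inE ta /=.
  suff -> : Ta :&: Tb = set0 by rewrite cards0 addn0.
  apply/setP => x; rewrite in_set0 inE; apply/negbTE/negP => /andP [xa xb].
  have xt : x != t by apply: contraNneq tb => <-.
  have := subsetP aD x xa; have := subsetP bE' x xb; rewrite !inE (negbTE xt) /= => xDb xDa.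
  by rewrite (disjointFr dis xDa) in xDb.
have disDE : [disjoint D & E].
  by rewrite -setI_eq0; apply/eqP/setP => x; rewrite !inE; case: (x \in D).
have subT (T2 : {set {set V}}) : T2 \subset t |: E -> (T1 :|: T2) :\ t \subset FF.
  move=> T2E; apply/subsetP => x; rewrite !inE => /andP [xt /orP [/(subsetP (hypertree_sub h1))|/(subsetP T2E)]].
    by rewrite !inE (negbTE xt) => /(subsetP DF).
  by rewrite !inE (negbTE xt) => /andP [].
have split_card := card_cover_split sph DF t3 bD; rewrite -/E in split_card.
have k1 := hypertree_card h1; have n1 := hypertree_conn h1; rewrite cD in k1 n1.
have finish T2 : hypertree (t |: E) T2 -> (t \in T1) (+) (t \in T2) ->
    hypertree FF ((T1 :|: T2) :\ t).
  move=> [T2E n2 k2] tt; rewrite cE in n2 k2; split; first exact: subT.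
    rewrite -cX; move: tt; case t1: (t \in T1); case t2: (t \in T2) => // _.
      by apply: glue_connects; rewrite ?t1 ?t2 ?(hypertree_sub h1).
    rewrite setUC [cover D :|: _]setUC.
    by apply: glue_connects; rewrite ?t1 ?t2 ?(hypertree_sub h1).
  have cT : #|(T1 :|: T2) :\ t|.+1 = #|T1| + #|T2|.
    move: tt; case t1: (t \in T1); case t2: (t \in T2) => // _.
      by apply: (glue _ _ D E); rewrite ?t1 ?t2 ?(hypertree_sub h1).
    rewrite setUC addnC; apply: (glue _ _ E D); rewrite ?t1 ?t2 ?(hypertree_sub h1) //.
    by rewrite disjoint_sym.
  move: cT k1 k2 split_card.
  lia_card.
have [tT1|tT1] := boolP (t \in T1); last first.
  have [T2 h2 tT2] := IH _ ltE t sE (setU11 _ _).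
  exists ((T1 :|: T2) :\ t); last by rewrite !inE ft fT1.
  by apply: finish => //; rewrite tT2 (negbTE tT1).
have [e et] : exists e, e \in pairs t by apply/set0Pn; rewrite -cards_eq0 card_pairs3.
have [g gE eg] := bd_face_in bE et.
have [T2 h2 gT2] := IH _ ltE g sE (setU1r _ gE).
exists ((T1 :|: T2) :\ t); last by rewrite !inE ft fT1.
apply: finish => //; rewrite tT1 /=; apply/negP => tT2.
have gt : g != t by apply: contraNneq tE => <-.
have := hypertree_share (sphere_surface sE) h2 gT2 tT2 gt.
rewrite leqNgt => /negP; apply.
move: et; rewrite inE => /andP [et /eqP e2]; rewrite -e2.
by apply: subset_leq_card; rewrite subsetI eg et.
Qed.

End TriTree.

(** * Plane maps *)

Section Potential.
Variables (K : realFieldType) (X : finType).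
Local Open Scope ring_scope.
Local Notation vec := 'rV[K]_#|X|.
Implicit Types (s : X -> X) (P : {set {set X}}).

Definition orb s x : {set X} := [set y | fconnect s x y].
Definition orbs s := [set orb s x | x : X].

Definition indic P : 'M[K]_(#|P|, #|X|) := \matrix_(i < #|P|, j < #|X|) ((enum_val j : X) \in (enum_val i : {set X}))%:R.

Lemma indic_row_free P : (forall A, A \in P -> A != set0) ->
  (forall A B x, A \in P -> B \in P -> x \in A -> x \in B -> A = B) -> row_free (indic P).
Proof.
move=> ne dis; rewrite -kermx_eq0; apply/rowV0P => u /sub_kermxP u0.
apply/rowP => i; rewrite [RHS]mxE; have /set0Pn [x xA] := ne _ (enum_valP i).
have := congr1 (fun v : vec => v 0 (enum_rank x)) u0; rewrite !mxE (bigD1 i) //=.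
rewrite mxE enum_rankK xA mulr1 big1 ?addr0 // => k ki; rewrite mxE enum_rankK.
case xk: (x \in enum_val k); last by rewrite mulr0.
by case/eqP: ki; apply: enum_val_inj; apply: (dis _ _ x) => //; apply: enum_valP.
Qed.

Lemma val_indic P (u : 'rV[K]_#|P|) x :
  val_at (u *m indic P) x = \sum_i u 0 i * (x \in enum_val i)%:R.
Proof. by rewrite /val_at mxE; apply: eq_bigr => i _; rewrite mxE enum_rankK. Qed.

Section Orbits.
Variable s : X -> X.
Hypothesis injs : injective s.

Lemma orb_refl x : x \in orb s x. Proof. by rewrite inE connect0. Qed.

Lemma orb_mem_step x y : (s y \in orb s x) = (y \in orb s x).
Proof. by rewrite !inE -(same_fconnect1_r injs). Qed.

Lemma orb_eq x y : y \in orb s x -> orb s y = orb s x.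
Proof. by rewrite inE => xy; apply/setP => z; rewrite !inE (same_connect (fconnect_sym injs) xy). Qed.

Lemma orbs_row_free : row_free (indic (orbs s)).
Proof.
apply: indic_row_free => [A /imsetP [x _ ->]|A B z /imsetP [x _ ->] /imsetP [y _ ->] zx zy].
  by apply/set0Pn; exists x; apply: orb_refl.
by rewrite -(orb_eq zx) -(orb_eq zy).
Qed.

Lemma orbs_invariant (x : vec) : (x <= indic (orbs s))%MS ->
  forall d, val_at x (s d) = val_at x d.
Proof.
case/submxP => u -> d; rewrite !val_indic; apply: eq_bigr => i _.
by have /imsetP [y _ ->] := enum_valP i; rewrite orb_mem_step.
Qed.

End Orbits.

Variables (e n : X -> X).
Hypotheses (eK : involutive e) (e_ne : forall d, e d != d) (injn : injective n).
Hypothesis conn : forall x y, connect (fun a b => (b == e a) || (b == n a)) x y.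
Let f d := n (e d).
Hypothesis euler : (2 * (#|orbs n| + #|orbs f|) = #|X| + 4)%N.

Let inje : injective e. Proof. exact: inv_inj. Qed.
Let injf : injective f. Proof. by move=> x y /injn /inje. Qed.

Lemma map_const (T : eqType) (a : X -> T) : (forall d, a (e d) = a d) ->
  (forall d, a (n d) = a d) -> forall x y, a x = a y.
Proof.
move=> ae an x y; case/connectP: (conn x y) => p + ->.
elim: p x => //= z p IH x /andP [/orP [] /eqP -> /IH <-]; [exact/esym/ae | exact/esym/an].
Qed.

Lemma card_pairs_e : (2 * #|[set [set x; e x] | x : X]| = #|X|)%N.
Proof.
rewrite mulnC -sum_nat_const -[RHS]sum1_card [RHS](partition_big_imset (fun x => [set x; e x])) /=.
apply: eq_bigr => A /imsetP [x _ ->]; apply/esym.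
rewrite sum1dep_card (_ : [set _ | _] = [set x; e x]) ?cards2 1?eq_sym ?e_ne //.
apply/setP => y; rewrite !inE; apply/eqP/orP => [h|[] /eqP ->].
- have hy : y \in [set x; e x] by rewrite -h !inE eqxx.
  by apply/orP; move: hy; rewrite !inE.
- by [].
- by rewrite eK setUC.
Qed.

Definition altern : 'M[K]_#|X| :=
  \matrix_(i, j) ((i == j)%:R - (enum_val i == e (enum_val j))%:R).

Lemma val_altern (x : vec) d : val_at (x *m altern) d = val_at x d - val_at x (e d).
Proof.
rewrite /val_at mxE; under eq_bigr => i _ do rewrite mxE mulrBr.
rewrite sumrB; congr (_ - _).
  by rewrite (bigD1 (enum_rank d)) //= eqxx mulr1 big1 ?addr0 // => i /negbTE ->; rewrite mulr0.
rewrite (bigD1 (enum_rank (e d))) //= !enum_rankK eqxx mulr1 big1 ?addr0 // => i id.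
case: eqP => [h|]; last by rewrite mulr0.
by case/eqP: id; rewrite -h enum_valK.
Qed.

Lemma alternT : altern^T = altern.
Proof.
apply/matrixP => i j; rewrite !mxE eq_sym; congr (_ - _%:R).
by rewrite eq_sym -(inj_eq inje) eK eq_sym.
Qed.

(** The [#|X| / 2] indicators of edges are independent and lie in the kernel. *)
Lemma rank_altern : (2 * \rank altern <= #|X|)%N.
Proof.
pose P := [set [set x; e x] | x : X].
have free : row_free (indic P).
  apply: indic_row_free => [A /imsetP [x _ ->]|A B z /imsetP [x _ ->] /imsetP [y _ ->]].
    by apply/set0Pn; exists x; rewrite !inE eqxx.
  rewrite !inE => /orP [] /eqP -> /orP [] /eqP; [by move=> -> | by move=> -> ; rewrite eK setUC| |].
    by move=> <-; rewrite eK setUC.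
  by move/inje ->.
have ker : indic P *m altern = 0.
  apply/row_matrixP => i; rewrite row_mul row0; apply: val_at_inj => d.
  rewrite val_altern /val_at !mxE !enum_rankK.
  have /imsetP [x _ ->] := enum_valP i; rewrite !inE.
  have -> : (e d == x) = (d == e x) by rewrite -(inj_eq inje) eK.
  by rewrite (inj_eq inje) orbC subrr.
have := mulmx0_rank_max ker; rewrite (eqP free).
have := card_pairs_e; rewrite -/P.
lia_card.
Qed.

(** A function constant on orbits with zero coboundary is constant by connectedness, so only one
    dimension is lost. *)
Lemma rank_coboundary s : injective s ->
  (forall T : eqType, forall a : X -> T, (forall d, a (e d) = a d) ->
     (forall d, a (s d) = a d) -> forall x y, a x = a y) ->
  (#|orbs s| <= (\rank (indic (orbs s) *m altern)).+1)%N.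
Proof.
move=> injs const; have /eqP free := orbs_row_free injs.
rewrite -{1}free -(mxrank_mul_ker _ altern) addnC -add1n leq_add2r.
apply: leq_trans (rank_leq_row (const_mx 1 : 'rV[K]_#|X|)).
apply/mxrankS/rV_subP => x; rewrite sub_capmx => /andP [xs /sub_kermxP xk].
have xe d : val_at x (e d) = val_at x d.
  have := val_altern x d; rewrite xk /val_at !mxE => /eqP.
  by rewrite eq_sym subr_eq0 => /eqP.
have xc := const _ (val_at x) xe (orbs_invariant injs xs).
have [->|/rV0Pn [j _]] := eqVneq x 0; first exact: sub0mx.
suff -> : x = val_at x (enum_val j) *: const_mx 1 by apply: scalemx_sub.
by apply: val_at_inj => d; rewrite val_atZ [X in _ * X]mxE mulr1; apply: xc.
Qed.

(** The face coboundaries are divergence-free: since [e d] and [n d = f (e d)] lie on one face, the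
    sum around a vertex telescopes. *)
Lemma coboundary_orth : indic (orbs f) *m altern *m (indic (orbs n))^T = 0.
Proof.
apply/matrixP => i j; rewrite mxE [RHS]mxE.
have /imsetP [x _ xE] := enum_valP i; have /imsetP [y _ yE] := enum_valP j.
transitivity (\sum_(d : X) ((d \in orb f x)%:R - (e d \in orb f x)%:R) * (d \in orb n y)%:R : K).
  rewrite (reindex_onto (@enum_rank X) (@enum_val X predT)) /=; last by move=> k _; rewrite enum_valK.
  apply: eq_big => [d|d _]; first by rewrite enum_rankK eqxx.
  have := val_altern (row i (indic (orbs f))) d.
  by rewrite /val_at -row_mul !mxE !enum_rankK xE yE => ->.
under eq_bigr => d _ do rewrite mulrBl.
rewrite sumrB (reindex_inj injf) /= [X in _ - X](reindex_inj inje) /= -sumrB big1 // => d _.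
by rewrite (orb_mem_step injf) eK /f (orb_mem_step injn) subrr.
Qed.

(* Vanishing of the first homology: the face coboundaries have the same rank as
   the divergence-free functions, by Euler's formula. *)
Lemma potential (z : X -> K) : (forall d, z (e d) = - z d) ->
  (forall x, \sum_(d in orb n x) z d = 0) ->
  exists a : X -> K, (forall d, a (f d) = a d) /\ forall d, a d - a (e d) = z d.
Proof.
move=> ze zn; pose zv : vec := of_fun z.
pose N := (altern :&: kermx (indic (orbs n))^T)%MS.
have zN : (zv <= N)%MS.
  rewrite sub_capmx; apply/andP; split.
    apply/submxP; exists (2%:R^-1 *: zv); apply: val_at_inj => d.
    by rewrite val_altern !val_atZ !val_of_fun ze; field.
  apply/sub_kermxP/rowP => j; rewrite mxE [RHS]mxE.
  have /imsetP [y _ yE] := enum_valP j.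
  rewrite -[RHS](zn y) [RHS]big_mkcond (reindex_onto (@enum_rank X) (@enum_val X predT)) /=;
    last by move=> k _; rewrite enum_valK.
  apply: eq_big => [d|d _]; first by rewrite enum_rankK eqxx.
  by rewrite !mxE !enum_rankK yE; case: ifP; rewrite ?mulr1 ?mulr0.
have sub : (indic (orbs f) *m altern <= N)%MS.
  by rewrite sub_capmx submxMl; apply/sub_kermxP/coboundary_orth.
have constf (T : eqType) (a : X -> T) : (forall d, a (e d) = a d) ->
     (forall d, a (f d) = a d) -> forall x y, a x = a y.
  by move=> ae af; apply: map_const => // d; have := af (e d); rewrite /f eK ae.
have rf := rank_coboundary injf constf.
have rn := rank_coboundary injn map_const.
(* With [E = #|X| / 2], the rank of [N] is at most [E - (V - 1)], that of the face coboundaries is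
   at least [F - 1], and Euler's formula equates the two bounds. *)
have rN : (\rank N <= \rank (indic (orbs f) *m altern))%N.
  have := mxrank_mul_ker altern (indic (orbs n))^T; rewrite -/N.
  have -> : \rank (altern *m (indic (orbs n))^T) = \rank (indic (orbs n) *m altern).
    by rewrite -mxrank_tr trmx_mul trmxK alternT.
  move: rf rn rank_altern euler.
  lia_card.
have NS : (N <= indic (orbs f) *m altern)%MS.
  by have [_ <-] := mxrank_leqif_sup sub; rewrite eqn_leq rN mxrankS.
have /submxP [u uE] := submx_trans zN NS.
exists (val_at (u *m indic (orbs f))); split.
  by apply: orbs_invariant => //; apply: submxMl.
by move=> d; rewrite -val_altern -mulmxA -uE val_of_fun.
Qed.

End Potential.

Lemma card_fibers (I J : finType) (S : {set I}) (h : I -> J) k :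
  (forall x, x \in S -> #|[set y in S | h y == h x]| = k) -> #|S| = k * #|h @: S|.
Proof.
move=> hk; rewrite -sum1_card (partition_big_imset h) /= mulnC -sum_nat_const.
by apply: eq_bigr => _ /imsetP [x xS ->]; rewrite sum1dep_card hk.
Qed.

Lemma card_imset_ker (I J1 J2 : finType) (S : {set I}) (g : I -> J1) (h : I -> J2) :
  {in S &, forall x y, (g x == g y) = (h x == h y)} -> #|g @: S| = #|h @: S|.
Proof.
move=> gh; have [S0|[x0 x0S]] := set_0Vmem S; first by rewrite S0 !imset0 !cards0.
pose k a := h (odflt x0 [pick x in S | g x == a]).
have kE x : x \in S -> k (g x) = h x.
  move=> xS; rewrite /k; case: pickP => [y /andP [yS yx]|/(_ x)]; last by rewrite xS eqxx.
  by apply/eqP; rewrite /= -gh.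
have <- : k @: (g @: S) = h @: S.
  apply/setP => b; apply/imsetP/imsetP => [[_ /imsetP [x xS ->] ->]|[x xS ->]].
    by exists x; rewrite ?kE.
  by exists (g x); rewrite ?kE //; apply: imset_f.
apply/esym/card_in_imset => _ _ /imsetP [x xS ->] /imsetP [y yS ->].
by rewrite !kE // => /eqP; rewrite -gh // => /eqP.
Qed.

(** * From a plane map with digons and triangles to an even sphere *)

Section PlaneMap.
Variables (X V : finType) (e n : X -> X) (vt : X -> V).
Hypotheses (eK : involutive e) (e_ne : forall d, e d != d) (injn : injective n).
Hypothesis conn : forall x y, connect (fun a b => (b == e a) || (b == n a)) x y.
Hypothesis vtP : forall x y, (vt x == vt y) = fconnect n x y.
Definition face d := n (e d).
Notation f := face.
Hypothesis euler : 2 * (#|orbs n| + #|orbs f|) = #|X| + 4.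
Hypothesis loopless : forall d, vt (e d) != vt d.
Hypothesis face23 : forall d, (f (f d) == d) || (f (f (f d)) == d).
Definition tri d := f (f d) != d.
Definition vf d := [set vt d; vt (f d); vt (f (f d))].
Definition verts : {set V} := [set vt x | x : X].
Definition edge (a d : X) := (d == a) || (d == e a).
Definition on3 (a b c d : X) := [|| edge a d, edge b d | edge c d].
(** A side of a closed curve is a predicate on darts invariant under [f], that is, a set of faces;
    [t] holds the vertices of the curve itself. *)
Definition side (A : pred X) (t : {set V}) := [set v in verts | [exists d, [&& A d, vt d == v & v \notin t]]].
Variable o : X.
Hypothesis tri_o : tri o.
Hypothesis parity : forall a b c (A : pred X),
  vt (e a) = vt b -> vt (e b) = vt c -> vt (e c) = vt a ->
  uniq [:: vt a; vt b; vt c] -> (forall d, A (f d) = A d) ->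
  (forall d, A d (+) A (e d) = on3 a b c d) -> ~~ A o ->
  ~~ odd #|side A [set vt a; vt b; vt c]|.

Lemma inje : injective e. Proof. exact: inv_inj. Qed.
Lemma injf : injective f. Proof. by move=> x y /injn /inje. Qed.

Lemma vt_n d : vt (n d) = vt d.
Proof. by apply/esym/eqP; rewrite vtP fconnect1. Qed.
Lemma vt_f d : vt (f d) = vt (e d). Proof. exact: vt_n. Qed.
Lemma face_tri3 d : tri d -> f (f (f d)) = d.
Proof. by move=> td; apply/eqP; have := face23 d; rewrite (negbTE td). Qed.
Lemma face_digon2 d : ~~ tri d -> f (f d) = d. Proof. by rewrite negbK => /eqP. Qed.
Lemma tri_f d : tri (f d) = tri d. Proof. by rewrite /tri (inj_eq injf). Qed.
Lemma vt_e3 d : tri d -> vt (e (f (f d))) = vt d.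
Proof. by move=> td; rewrite -vt_f face_tri3. Qed.

Lemma tri_uniq d : tri d -> uniq [:: vt d; vt (f d); vt (f (f d))].
Proof.
move=> td; rewrite /= !inE !andbT negb_or -(vt_e3 td) loopless andbT.
by rewrite (vt_e3 td) !vt_f eq_sym loopless -vt_f eq_sym loopless.
Qed.

Lemma map_constf (T : eqType) (a : X -> T) : (forall d, a (e d) = a d) ->
  (forall d, a (f d) = a d) -> forall x y, a x = a y.
Proof.
move=> ae af; apply: (map_const conn) => // d.
by have := af (e d); rewrite /face eK ae.
Qed.

Lemma vf_f d : tri d -> vf (f d) = vf d.
Proof. by move=> td; rewrite /vf face_tri3 // setUC setUA. Qed.

Lemma vf_corner d v : tri d -> v \in vf d -> exists x, [/\ tri x, vf x = vf d, vt x = v & x \in [:: d; f d; f (f d)]].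
Proof.
move=> td; rewrite !inE => /orP [/orP [] |] /eqP ->.
- by exists d; rewrite !inE eqxx.
- by exists (f d); rewrite tri_f vf_f // !inE eqxx orbT.
- by exists (f (f d)); rewrite !tri_f !vf_f ?tri_f // !inE eqxx !orbT.
Qed.

Definition par x y := (vt x == vt y) && (vt (e x) == vt (e y)).

(** Turning once around a vertex, one enters [A] as often as one leaves it. *)
Lemma sum_orbit_telescope (A : pred X) x :
  (\sum_(d in orb n x) ((A d)%:R - (A (n d))%:R) = 0 :> rat)%R.
Proof.
rewrite sumrB [X in (_ - X)%R](_ : _ = \sum_(d in orb n x) (A d)%:R)%R ?subrr //.
rewrite [RHS](reindex_inj injn) /=; apply: eq_bigl => d.
by rewrite (orb_mem_step injn).
Qed.

Lemma invariant_rot (A : pred X) : (forall d, A (f d) = A d) -> forall d, A (n d) = A (e d).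
Proof. by move=> Af d; rewrite -[RHS]Af /face eK. Qed.

Lemma invariant_vertex (A : pred X) v : (forall d, A (f d) = A d) ->
  (forall d, vt d = v -> A (e d) = A d) -> forall x y, vt x = v -> vt y = v -> A x = A y.
Proof.
move=> Af Av x y xv yv; have : fconnect n x y by rewrite -vtP xv yv.
case/connectP => p; elim: p x xv => [|z p IH] x xv /=; first by move=> _ ->.
move=> /andP [/eqP xz pz] yl; subst z.
by rewrite -(Av x xv) -invariant_rot //; apply: IH; rewrite ?vt_n.
Qed.

Lemma side_compl (A : pred X) (t : {set V}) : t \subset verts -> (forall d, A (f d) = A d) ->
  (forall d, vt d \notin t -> A (e d) = A d) ->
  #|side A t| + #|side (predC A) t| + #|t| = #|verts|.
Proof.
move=> tv Af At.
have dis : side A t :&: side (predC A) t = set0.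
  apply/setP => v; rewrite !inE; apply/negbTE/negP => /andP [/andP [_ /existsP [d /and3P [Ad /eqP dv vt_]]]].
  case/andP => _ /existsP [d' /and3P [/= Ad' /eqP d'v _]].
  have : A d = A d' by apply: (invariant_vertex Af _ dv d'v) => k kv; apply: At; rewrite kv.
  by rewrite Ad (negbTE Ad').
have -> : verts = (side A t :|: side (predC A) t) :|: t.
  apply/setP => v; rewrite !inE; case vtt: (v \in t).
    by rewrite orbT (subsetP tv).
  rewrite orbF -andb_orr; case vv: (v \in verts) => //=.
  have /imsetP [d _ dv] := vv.
  case Ad: (A d); apply/esym/orP; [left|right]; apply/existsP; exists d; rewrite /= Ad dv eqxx ?vtt //.
rewrite cardsU (_ : _ :&: t = set0) ?cards0 ?subn0; last first.
  apply/setP => v; rewrite !inE; case vtt: (v \in t); rewrite ?andbF //.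
  by rewrite andbT; apply/negbTE; rewrite negb_or; apply/andP; split; rewrite negb_and;
    apply/orP; right; apply/existsPn => d; rewrite !andbF.
by rewrite cardsU dis cards0 subn0.
Qed.

Lemma face_boundary d : tri d -> forall k,
  (k \in [:: d; f d; f (f d)]) (+) (e k \in [:: d; f d; f (f d)]) = on3 d (f d) (f (f d)) k.
Proof.
move=> td k.
have /= := tri_uniq td; rewrite !inE !andbT => /andP [] /norP [uv uw] vw.
have eE x y : (e x == y) = (x == e y) by rewrite -(inj_eq inje) eK.
have off x y : (vt x != vt y) -> x == y = false by move=> h; apply: contraNF h => /eqP ->.
have h (x y : X) : x \in [:: d; f d; f (f d)] -> y \in [:: d; f d; f (f d)] -> x = e y -> False.
  rewrite !inE => hx hy xey; have : vt x = vt (e y) by rewrite xey.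
  have : vt (e x) = vt y by rewrite xey eK.
  move: hx hy => /or3P [] /eqP -> /or3P [] /eqP ->; rewrite -?vt_f ?face_tri3 // => /eqP h1 /eqP h2;
   move: h1 h2 uv uw vw; do ?[by move=> _ ->] ; do ?[by move=> ->];
   by rewrite ?[vt (f d) == vt d]eq_sym ?[vt (f (f d)) == vt d]eq_sym ?[vt (f (f d)) == vt (f d)]eq_sym => h1 h2; rewrite ?h1 ?h2.
rewrite /on3 /edge !eE.
case h1: [|| k == d, k == f d | k == f (f d)]; case h2: [|| k == e d, k == e (f d) | k == e (f (f d))].
- exfalso; have hk : k \in [:: d; f d; f (f d)] by rewrite !inE.
  by case/or3P: h2 => /eqP; apply: h; rewrite ?inE ?eqxx ?orbT.
- by case/or3P: h1 => ->; rewrite ?orbT.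
- by case/or3P: h2 => ->; rewrite ?orbT.
- by move/negbT: h1; move/negbT: h2; rewrite !negb_or => /and3P [/negbTE -> /negbTE -> /negbTE ->]
    /and3P [/negbTE -> /negbTE -> /negbTE ->].
Qed.

Lemma vf_sub d : vf d \subset verts.
Proof. by rewrite /vf !subUset !sub1set !imset_f. Qed.

(** All faces except the outer triangle form a side of that triangle, so evenly many vertices lie
    off it. *)
Lemma odd_verts : odd #|verts|.
Proof.
pose I := [:: o; f o; f (f o)]; pose A := [pred d | d \notin I].
have If d : (f d \in I) = (d \in I).
  by rewrite !inE -{1}(face_tri3 tri_o) !(inj_eq injf) orbC -orbA.
have Af d : A (f d) = A d by rewrite /= If.
have Ab d : A d (+) A (e d) = on3 o (f o) (f (f o)) d.
  by rewrite -(face_boundary tri_o) /=; case: (d \in I); case: (e d \in I).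
have := parity (esym (vt_f o)) (esym (vt_f _)) (vt_e3 tri_o) (tri_uniq tri_o) Af Ab.
rewrite /= mem_head => /(_ isT) ev.
have tv := vf_sub o; have t3 : #|vf o| = 3.
  have /= := tri_uniq tri_o; rewrite !inE !andbT => /andP [] /norP [uv uw] vw.
  by rewrite /vf -setUA cardsU1 cards2 vw !inE negb_or uv uw.
have At d : vt d \notin vf o -> A (e d) = A d.
  move=> dt; have := Ab d; suff -> : on3 o (f o) (f (f o)) d = false by case: (A d); case: (A (e d)).
  apply: contraNF dt; rewrite /on3 /edge => /or3P [] /orP [] /eqP ->;
    by rewrite ?vt_e3 // -?vt_f ?face_tri3 // !inE ?eqxx ?orbT.
have := side_compl tv Af At; rewrite t3.
have -> : side (predC A) (vf o) = set0.
  apply/setP => v; rewrite !inE; apply/negbTE/negP => /andP [_ /existsP [d /and3P []]].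
  by rewrite /= negbK !inE => /or3P [] /eqP -> /eqP <-; rewrite eqxx ?orbT.
by rewrite cards0 addn0 => <-; rewrite oddD (negbTE ev).
Qed.

(** The two sides and the three corners make up an odd total, so both sides have the same parity. *)
Lemma parity_both a b c (A : pred X) :
  vt (e a) = vt b -> vt (e b) = vt c -> vt (e c) = vt a ->
  uniq [:: vt a; vt b; vt c] -> (forall d, A (f d) = A d) ->
  (forall d, A d (+) A (e d) = on3 a b c d) ->
  ~~ odd #|side A [set vt a; vt b; vt c]|.
Proof.
move=> ab bc ca uq Af Ab; have [Ao|] := boolP (A o); last exact: (parity ab bc ca uq Af Ab).
set t := [set _; _; _].
have tv : t \subset verts by rewrite !subUset !sub1set !imset_f.
have t3 : #|t| = 3.
  have /= := uq; rewrite !inE !andbT => /andP [] /norP [uv uw] vw.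
  by rewrite /t -setUA cardsU1 cards2 vw !inE negb_or uv uw.
have At d : vt d \notin t -> A (e d) = A d.
  move=> dt; have := Ab d; suff -> : on3 a b c d = false by case: (A d); case: (A (e d)).
  apply: contraNF dt; rewrite /on3 /edge => /or3P [] /orP [] /eqP ->;
    by rewrite ?ab ?bc ?ca !inE ?eqxx ?orbT.
have Acb d : predC A d (+) predC A (e d) = on3 a b c d.
  by rewrite -Ab /=; case: (A d); case: (A (e d)).
have Acf d : predC A (f d) = predC A d by rewrite /= Af.
have := parity ab bc ca uq Acf Acb; rewrite /= Ao => /(_ isT).
have := odd_verts; rewrite -(side_compl tv Af At) t3 !oddD /=.
by case: (odd _); case: (odd _).
Qed.

Lemma par_sym x y : par x y = par y x.
Proof. by rewrite /par eq_sym [vt (e x) == _]eq_sym. Qed.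

Lemma par_trans x y z : par x y -> par y z -> par x z.
Proof. by rewrite /par => /andP [/eqP -> /eqP ->]. Qed.

Definition on2 (x y d : X) := edge x d || edge y d.

Lemma side_witness (A : pred X) (t : {set V}) d : A d -> vt d \notin t -> vt d \in side A t.
Proof.
by move=> Ad dt; rewrite inE imset_f //=; apply/existsP; exists d; rewrite Ad eqxx.
Qed.

Lemma sideP (A : pred X) (t : {set V}) v :
  reflect (exists d, [/\ A d, vt d = v & v \notin t]) (v \in side A t).
Proof.
rewrite inE; apply: (iffP andP) => [[_ /existsP [d /and3P [Ad /eqP dv vt_]]]|[d [Ad dv vt_]]].
  by exists d.
by rewrite -dv imset_f //; split=> //; apply/existsP; exists d; rewrite Ad eqxx dv.
Qed.

Lemma on2_vertex x y d : par x y -> on2 x y d -> vt d \in [set vt x; vt (e x)].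
Proof.
case/andP => /eqP xy /eqP exy; rewrite /on2 !inE.
by rewrite /edge => /orP [] /orP [] /eqP ->; rewrite -?xy -?exy eqxx ?orbT.
Qed.

(** Removing the triangle at [x] from [A] replaces the edge [x] of the boundary by the other two
    edges of that triangle. The result is a side of a 3-cycle, hence even, and it lost exactly one
    vertex, the apex of the triangle. *)
Lemma par_side_odd x y (A : pred X) : tri x -> par x y -> x != y ->
  (forall d, A (f d) = A d) -> (forall d, A d (+) A (e d) = on2 x y d) -> A x ->
  odd #|side A [set vt x; vt (e x)]|.
Proof.
move=> tx pxy xy Af Ab Ax; have /andP [/eqP vxy /eqP vexy] := pxy.
pose I := [:: x; f x; f (f x)]; pose A1 := [pred d | A d && (d \notin I)].
have uq := tri_uniq tx.
have If d : (f d \in I) = (d \in I).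
  by rewrite !inE -{1}(face_tri3 tx) !(inj_eq injf) orbC -orbA.
have IA d : d \in I -> A d by rewrite !inE => /or3P [] /eqP ->; rewrite ?Af.
have A1f d : A1 (f d) = A1 d by rewrite /= If Af.
have eE u v : (e u == v) = (u == e v) by rewrite -(inj_eq inje) eK.
have off u v : (vt u != vt v) -> (u == v) = false by move=> h; apply: contraNF h => /eqP ->.
have /= := uq; rewrite !inE !andbT => /andP [] /norP [uv uw] vw.
have vex : vt (e x) = vt (f x) by rewrite vt_f.
have vefx : vt (e (f x)) = vt (f (f x)) by rewrite -vt_f.
have veffx : vt (e (f (f x))) = vt x by exact: vt_e3.
have A1b d : A1 d (+) A1 (e d) = on3 y (f x) (f (f x)) d.
  have E : A1 d (+) A1 (e d) = (A d (+) A (e d)) (+) ((d \in I) (+) (e d \in I)).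
    rewrite /A1 inE inE; move: (IA d) (IA (e d)).
    by case: (d \in I); case: (e d \in I); case: (A d); case: (A (e d)) => //= h1 h2;
      by [have := h1 isT | have := h2 isT].
  rewrite E Ab (face_boundary tx) /on2 /on3.
  have edge_dis a b : edge a d -> edge b d -> (b == a) || (b == e a).
    by rewrite /edge => /orP [] /eqP -> /orP [] /eqP;
      [move=> -> | move=> ->; rewrite eK | move=> <- | move/inje ->]; rewrite ?eqxx ?orbT.
  have n2 : edge x d -> edge y d -> False.
    move=> h1 h2; case/orP: (edge_dis _ _ h1 h2) => /eqP h; first by rewrite h eqxx in xy.
    by move: vxy; rewrite h => /eqP; rewrite eq_sym (negbTE (loopless _)).
  have n3 : edge x d -> edge (f x) d -> False.
    move=> h1 h2; case/orP: (edge_dis _ _ h1 h2) => /eqP h; first by rewrite h eqxx in uv.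
    have : vt (e (f x)) = vt x by rewrite h eK.
    by rewrite vefx => h'; rewrite h' eqxx in uw.
  have n4 : edge x d -> edge (f (f x)) d -> False.
    move=> h1 h2; case/orP: (edge_dis _ _ h1 h2) => /eqP h; first by rewrite h eqxx in uw.
    by move: vw; rewrite h vex eqxx.
  have n5 : edge y d -> edge (f x) d -> False.
    move=> h1 h2; case/orP: (edge_dis _ _ h1 h2) => /eqP h; first by rewrite vxy -h eqxx in uv.
    have : vt (e (f x)) = vt y by rewrite h eK.
    by rewrite vefx -vxy => h'; rewrite h' eqxx in uw.
  have n6 : edge y d -> edge (f (f x)) d -> False.
    move=> h1 h2; case/orP: (edge_dis _ _ h1 h2) => /eqP h; first by rewrite vxy -h eqxx in uw.
    by move: vw; rewrite h -vexy vex eqxx.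
  have n7 : edge (f x) d -> edge (f (f x)) d -> False.
    move=> h1 h2; case/orP: (edge_dis _ _ h1 h2) => /eqP h; first by rewrite h eqxx in vw.
    have : vt (e (f (f x))) = vt (f x) by rewrite h eK.
    by rewrite veffx => h'; rewrite h' eqxx in uv.
  case h1: (edge x d); case h2: (edge y d); case h3: (edge (f x) d); case h4: (edge (f (f x)) d) => //;
    by [have := n2 h1 h2 | have := n3 h1 h3 | have := n4 h1 h4 | have := n5 h2 h3 | have := n6 h2 h4 | have := n7 h3 h4].
have wE : [set vt y; vt (f x); vt (f (f x))] = vt (f (f x)) |: [set vt x; vt (e x)].
  by rewrite -vxy vex setUC.
have uq' : uniq [:: vt y; vt (f x); vt (f (f x))] by rewrite -vxy.
have := parity_both (etrans (esym vexy) vex) vefx (etrans veffx vxy) uq' A1f A1b.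
have ww : vt (f (f x)) \in side A [set vt x; vt (e x)].
  by apply: side_witness; rewrite ?Af // vex !inE negb_or ![vt (f (f x)) == _]eq_sym uw vw.
suff -> : side A1 [set vt y; vt (f x); vt (f (f x))] = side A [set vt x; vt (e x)] :\ vt (f (f x)).
  have := cardsD1 (vt (f (f x))) (side A [set vt x; vt (e x)]).
  by rewrite ww add1n => -> /negbTE h; rewrite oddS h.
apply/setP => v; rewrite wE in_setD1; apply/sideP/andP => [[d [/andP [Ad dI] dv]]|[vw' /sideP [d [Ad dv vxe]]]].
  by rewrite in_setU1 negb_or => /andP [-> vxe]; split=> //; apply/sideP; exists d.
exists d; split=> //; last by rewrite in_setU1 negb_or vw'.
rewrite /A1 inE Ad; apply/negP; rewrite !inE => /or3P [] /eqP dE; move: dv vw' vxe; rewrite dE => <-.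
- by rewrite !inE eqxx.
- by rewrite !inE vex eqxx orbT.
- by rewrite eqxx.
Qed.

(* The potential of the 2-cycle formed by [x] and [e y] separates its two sides,
   and both sides would contain an odd number of vertices, as does [verts]. *)
Lemma par_uniq x y : tri x -> tri y -> par x y -> x = y.
Proof.
move=> tx ty pxy; have /andP [/eqP vxy /eqP vexy] := pxy.
apply/eqP; apply: contraT => xy.
have vne := loopless x; have vne' : vt x != vt (e x) by rewrite eq_sym.
have off u v : (vt u != vt v) -> (u == v) = false by move=> h; apply: contraNF h => /eqP ->.
have xey : (x == e y) = false by apply: off; rewrite -vexy.
have yex : (y == e x) = false by apply: off; rewrite -vxy.
(* The circulation that leaves along [x] and returns along [y]. *)
pose z d : rat := ((d == x)%:R - (d == e x)%:R - (d == y)%:R + (d == e y)%:R)%R.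
have eE u v : (e u == v) = (u == e v) by rewrite -(inj_eq inje) eK.
have ze d : (z (e d) = - z d)%R by rewrite /z !eE !eK; ring.
have zn w : (\sum_(d in orb n w) z d = 0)%R.
  have S c : (\sum_(d in orb n w) (d == c)%:R = (vt w == vt c)%:R :> rat)%R.
    rewrite big_mkcond (bigD1 c) //= eqxx big1 ?addr0; last by move=> d /negbTE ->; case: ifP.
    by rewrite inE -vtP; case: ifP.
  rewrite !(big_split, sumrN) /= !S vxy vexy; set p := (_%:R)%R; set q := (_%:R)%R; by clearbody p q; ring.
have [a [af ad]] := potential eK e_ne injn conn euler ze zn.
pose A := [pred d | a d == a x].
have Af d : A (f d) = A d by rewrite /= af.
have zx : (z x = 1)%R.
  by rewrite /z eqxx [x == e x]eq_sym (negbTE (e_ne x)) (negbTE xy) xey /=; ring.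
have zy : (z y = -1)%R.
  by rewrite /z eqxx yex [y == x]eq_sym (negbTE xy) [y == e y]eq_sym (negbTE (e_ne y)) /=; ring.
have z0 d : ~~ on2 x y d -> z d = 0%R.
  rewrite /on2 /edge !negb_or => /andP [/andP [h1 h2] /andP [h3 h4]].
  by rewrite /z (negbTE h1) (negbTE h2) (negbTE h3) (negbTE h4) /=; ring.
have Ax : A x by rewrite /= eqxx.
have Aex : ~~ A (e x).
  rewrite /=; have := ad x; rewrite zx => h; apply/eqP => h'.
  by move: h; rewrite h' subrr => /eqP; rewrite eq_sym oner_eq0.
(* Around the common tail, [A] changes only at [x] and at [y], so the change at [x] is undone at
   [y]. *)
have [Ay Aey] : ~~ A y /\ A (e y).
  have := sum_orbit_telescope A x.
  rewrite (bigD1 x) ?inE ?connect0 //= (bigD1 y) /=; last by rewrite inE -vtP vxy eqxx eq_sym.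
  rewrite big1 ?addr0; last first.
    move=> d /andP [/andP [dx ndx] ndy]; rewrite -[(a (n d) == _)]/(A (n d)) -[(a d == _)]/(A d) (invariant_rot Af).
    suff -> : A (e d) = A d by rewrite subrr.
    have vdx : vt d = vt x by apply/esym/eqP; rewrite vtP; move: dx; rewrite inE.
    rewrite /=; have -> // : a (e d) = a d.
    apply/esym/eqP; rewrite -subr_eq0 ad z0 //.
    rewrite /on2 /edge (negbTE ndx) (negbTE ndy) /= negb_or; apply/andP; split; apply/negbT/off.
      by rewrite vdx.
    by rewrite vdx -vexy.
  rewrite eqxx -[(a (n x) == _)]/(A (n x)) (invariant_rot Af) (negbTE Aex) -[(a (n y) == _)]/(A (n y)) (invariant_rot Af).
  rewrite -[(a y == _)]/(A y).
  by case Ay: (A y); case Aey: (A (e y)) => /= /eqP h; split.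
have Ab d : A d (+) A (e d) = on2 x y d.
  have [h|h] := boolP (on2 x y d); last first.
    rewrite /=; have -> : a (e d) = a d by apply/esym/eqP; rewrite -subr_eq0 ad z0.
    by rewrite addbb.
  move: h; rewrite /on2 /edge => /orP [] /orP [] /eqP ->; rewrite ?eK.
  - by rewrite Ax (negbTE Aex).
  - by rewrite Ax (negbTE Aex).
  - by rewrite Aey (negbTE Ay).
  - by rewrite Aey (negbTE Ay).
have o1 := par_side_odd tx pxy xy Af Ab Ax.
have pyx : par y x by rewrite par_sym.
have yx : y != x by rewrite eq_sym.
have Acf d : predC A (f d) = predC A d by rewrite /= af.
have Acb d : predC A d (+) predC A (e d) = on2 y x d.
  by rewrite /on2 orbC -/(on2 x y d) -Ab /=; case: (a d == _); case: (a (e d) == _).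
have o2 := par_side_odd ty pyx yx Acf Acb Ay; rewrite -vxy -vexy in o2.
have tv : [set vt x; vt (e x)] \subset verts by rewrite subUset !sub1set !imset_f.
have At d : vt d \notin [set vt x; vt (e x)] -> A (e d) = A d.
  move=> dt; have := Ab d; suff -> : on2 x y d = false by case: (A d); case: (A (e d)).
  by apply: contraNF dt; apply: on2_vertex.
have := odd_verts; rewrite -(side_compl tv Af At) !oddD o1 o2 cards2 vne'.
by [].
Qed.

Lemma par_digon d : ~~ tri d -> par (e d) (f d).
Proof.
move=> td; have ff := face_digon2 td; rewrite /par vt_f eqxx /= eK.
by apply/eqP; rewrite -[RHS]vt_f ff.
Qed.

Lemma par_e x y : par (e x) (e y) = par x y.
Proof. by rewrite /par !eK andbC. Qed.

(** If every face at a dart parallel to [d] were a digon, the darts parallel to [d] or to [e d]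
    would be closed under [e] and [f], hence be all darts, although the face of [o] is a
    triangle. *)
Lemma tri_par_ex d : exists x, tri x && par d x.
Proof.
apply/existsP; apply: contraT => /existsPn h.
have dig b : par d b -> ~~ tri b by move=> db; have := h b; rewrite db andbT.
have turn b : par d b -> par d (e (f b)).
  by move=> db; apply: (par_trans db); rewrite -par_e eK; apply/par_digon/dig.
pose B1 := [set b | par d b].
(* By [turn], [f] maps [B1] into [e @: B1], and equal cardinalities give equality. So the darts
   opposite to [d] are also on digons. *)
have fB1 : f @: B1 = e @: B1.
  apply/eqP; rewrite eqEcard (card_imset _ injf) (card_imset _ inje) leqnn andbT.
  apply/subsetP => _ /imsetP [b bB ->]; rewrite inE in bB.
  apply/imsetP; exists (e (f b)); rewrite ?eK // inE.
  exact: turn.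
have B1f k : par d (e k) -> exists2 b, par d b & k = f b.
  move=> dk; have : k \in f @: B1.
    by rewrite fB1; apply/imsetP; exists (e k); rewrite ?eK // inE.
  by case/imsetP => b; rewrite inE => db ->; exists b.
pose B k := par d k || par d (e k).
have Be k : B (e k) = B k by rewrite /B eK orbC.
have Bf1 k : B k -> B (f k).
  case/orP => [dk|/B1f [b db ->]]; last by rewrite /B face_digon2 ?db // dig.
  by apply/orP; right; apply: turn.
have Bf k : B (f k) = B k.
  apply/idP/idP; last exact: Bf1.
  move=> /Bf1 hk; case/orP: (face23 k) => /eqP E; rewrite -E //.
  exact: Bf1.
have : B o = B d by apply: (map_constf Be Bf).
rewrite {2}/B /par !eqxx /= => /orP [/dig|/B1f [b /dig nb oE]]; first by rewrite tri_o.
by move: nb; rewrite -tri_f -oE tri_o.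
Qed.

(* The triangle dart that represents all darts parallel to [d]. *)
Definition L d := odflt d [pick x | tri x && par d x].

Lemma tri_L d : tri (L d).
Proof. by rewrite /L; case: pickP => [x /andP []//|h]; have [x] := tri_par_ex d; rewrite h. Qed.
Lemma par_L d : par d (L d).
Proof. by rewrite /L; case: pickP => [x /andP []//|h]; have [x] := tri_par_ex d; rewrite h. Qed.
Lemma L_uniq d x : tri x -> par d x -> L d = x.
Proof.
move=> tx dx; apply: par_uniq => //; first exact: tri_L.
by apply: par_trans dx; rewrite par_sym par_L.
Qed.
Lemma L_par d d' : par d d' -> L d = L d'.
Proof. by move=> dd; apply: L_uniq; [apply: tri_L | apply: par_trans dd (par_L d')]. Qed.
Lemma par_refl d : par d d. Proof. by rewrite /par !eqxx. Qed.
Lemma L_tri d : tri d -> L d = d. Proof. by move=> td; apply: L_uniq => //; apply: par_refl. Qed.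
Lemma L_digon d : ~~ tri d -> L (f d) = L (e d).
Proof. by move=> td; apply/esym/L_par/par_digon. Qed.
Lemma vt_L d : vt (L d) = vt d.
Proof. by have /andP [/eqP -> _] := par_L d. Qed.
Lemma vt_eL d : vt (e (L d)) = vt (e d).
Proof. by have /andP [_ /eqP ->] := par_L d. Qed.
Lemma L_eL d : L (e (L d)) = L (e d).
Proof. by apply/esym/L_par; rewrite par_e par_L. Qed.

Definition FF := [set vf x | x in tri].
Definition edg d := [set vt d; vt (e d)].

Lemma in_FF x : tri x -> vf x \in FF.
Proof. by move=> tx; apply: imset_f. Qed.
Lemma FFP g : g \in FF -> exists2 x, tri x & g = vf x.
Proof. by case/imsetP => x tx ->; exists x. Qed.

Lemma vt_ne d : vt d != vt (e d). Proof. by rewrite eq_sym. Qed.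

Lemma card_vf d : tri d -> #|vf d| = 3.
Proof.
move/tri_uniq; rewrite /= !inE !andbT => /andP [] /norP [uv uw] vw.
by rewrite /vf -setUA cardsU1 cards2 vw !inE negb_or uv uw.
Qed.

Lemma edge_in_face d (g : {set V}) : tri d -> g \subset vf d -> #|g| = 2 ->
  exists x, [/\ tri x, vf x = vf d, g = edg x & x \in [:: d; f d; f (f d)]].
Proof.
move=> td gd g2; have : g \in pairs (vf d) by rewrite inE gd g2.
have -> : pairs (vf d) = _ := pairs3 (tri_uniq td).
rewrite !inE => /orP [/orP [] |] /eqP ->.
- by exists d; rewrite /edg -vt_f !inE eqxx.
- by exists (f d); rewrite /edg -(vt_f (f d)) tri_f vf_f // !inE eqxx orbT.
- by exists (f (f d)); rewrite /edg -(vt_f (f (f d))) face_tri3 // !tri_f !vf_f ?tri_f // !inE eqxx !orbT setUC.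
Qed.

Lemma edg_par x d : edg x = edg d -> par x d \/ par x (e d).
Proof.
move=> E; have := vt_ne x; have : vt x \in edg d by rewrite -E !inE eqxx.
have : vt (e x) \in edg d by rewrite -E !inE eqxx orbT.
rewrite !inE /par eK => /orP [] /eqP h1 /orP [] /eqP h2; rewrite h1 h2 ?eqxx //; by [right|left].
Qed.

Lemma star_edg d : star FF (edg d) = [set vf (L d); vf (L (e d))].
Proof.
apply/setP => g; rewrite !inE; apply/andP/orP => [[/FFP [x tx ->] sub]|].
  have c2 : #|edg d| = 2 by rewrite cards2 vt_ne.
  have [y [ty <- yE _]] := edge_in_face tx sub c2.
  case: (edg_par (esym yE)) => h; first by left; rewrite -(L_par h) (L_tri ty).
  right; rewrite -(L_par h) (L_tri ty) //.
have sub k : edg k \subset vf (L k).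
  by rewrite subUset !sub1set -vt_L -vt_eL -vt_f !inE !eqxx orbT.
case=> /eqP ->; split; try (by apply/in_FF/tri_L); first exact: sub.
by have := sub (e d); rewrite /edg eK setUC.
Qed.

Lemma edgesP (g : {set V}) : g \in edges FF -> exists2 d, tri d & g = edg d.
Proof.
rewrite inE => /andP [/eqP g2 /set0Pn [h]]; rewrite inE => /andP [/FFP [x tx ->] sub].
by have [y [ty _ -> _]] := edge_in_face tx sub g2; exists y.
Qed.

Lemma cover_FF : cover FF = verts.
Proof.
apply/setP => v; apply/bigcupP/imsetP => [[g /FFP [x tx ->]]|[d _ ->]].
  by move/(subsetP (vf_sub x))/imsetP.
exists (vf (L d)); first by apply/in_FF/tri_L.
by rewrite -(vt_L d) !inE eqxx.
Qed.

Section Big.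
Hypothesis big : 3 < #|verts|.

(** By [par_uniq], a second face on the same three vertices runs around them in the opposite
    direction and lies across all three edges. Up to digons the two faces are then the whole map,
    which has only three vertices. *)
Lemma vf_inj x y : tri x -> tri y -> vf x = vf y -> y \in [:: x; f x; f (f x)].
Proof.
move=> tx ty vxy.
have : vt x \in vf y by rewrite -vxy !inE eqxx.
case/(vf_corner ty) => z [tz vz vzx zy].
have [zx|zx] := eqVneq z x.
  move: zy; rewrite zx !inE => /or3P [] /eqP ->; rewrite ?face_tri3 // ?eqxx ?orbT //.
have := tri_uniq tx; rewrite /= !inE !andbT => /andP [] /norP [uv uw] vw.
have := tri_uniq tz; rewrite /= !inE !andbT => /andP [] /norP [uv' uw'] vw'.
have vfz : vf z = vf x by rewrite vz vxy.
have fzv : vt (f z) <> vt (f x).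
  move=> h; case/eqP: zx; apply: par_uniq => //.
  by rewrite /par vzx -vt_f h vt_f !eqxx.
have fzw : vt (f z) = vt (f (f x)).
  have : vt (f z) \in vf x by rewrite -vfz !inE eqxx orbT.
  rewrite !inE -vzx eq_sym (negbTE uv') /= => /orP [/eqP //|/eqP //].
have ffzv : vt (f (f z)) = vt (f x).
  have : vt (f (f z)) \in vf x by rewrite -vfz !inE eqxx orbT.
  rewrite !inE -vzx eq_sym (negbTE uw') /= => /orP [/eqP //|].
  by rewrite -fzw eq_sym (negbTE vw').
have e1 : L (e x) = f (f z).
  by apply: L_uniq; rewrite ?tri_f // /par eK -vt_f ffzv eqxx /= vt_e3 // vzx.
have e2 : L (e (f x)) = f z.
  by apply: L_uniq; rewrite ?tri_f // /par eK -vt_f -fzw eqxx /= -vt_f ffzv.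
have e3 : L (e (f (f x))) = z.
  by apply: L_uniq; rewrite ?tri_f // /par eK vt_e3 // vzx eqxx /= -vt_f fzw.
have e1' : L (e z) = f (f x) by rewrite -e3 L_eL eK L_tri // !tri_f.
have e2' : L (e (f z)) = f x by rewrite -e2 L_eL eK L_tri // !tri_f.
have e3' : L (e (f (f z))) = x by rewrite -e1 L_eL eK L_tri.
pose B k := L k \in [:: x; f x; f (f x); z; f z; f (f z)].
have Be1 k : B k -> B (e k).
  rewrite /B -(L_eL k) !inE.
  case/or4P => [/eqP ->|/eqP ->|/eqP ->|/or3P [] /eqP ->];
    by rewrite ?e1 ?e2 ?e3 ?e1' ?e2' ?e3' eqxx ?orbT.
have Be k : B (e k) = B k by apply/idP/idP; [rewrite -{2}(eK k)|]; apply: Be1.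
have Bf1 k : B k -> B (f k).
  have [tk|tk] := boolP (tri k); last by rewrite -Be /B L_digon.
  rewrite /B !L_tri ?tri_f // !inE.
  by case/or4P => [/eqP ->|/eqP ->|/eqP ->|/or3P [] /eqP ->]; rewrite ?face_tri3 // eqxx ?orbT.
have Bf k : B (f k) = B k.
  apply/idP/idP; last exact: Bf1.
  move=> /Bf1 hk; case/orP: (face23 k) => /eqP E; rewrite -E //.
  exact: Bf1.
have sub : verts \subset vf x.
  apply/subsetP => _ /imsetP [k _ ->].
  have : B k = B x by apply: (map_constf Be Bf).
  rewrite {2}/B L_tri // mem_head /B => bk; rewrite -(vt_L k).
  move: bk; rewrite !inE.
  by case/or4P => [/eqP ->|/eqP ->|/eqP ->|/or3P [] /eqP ->];
    rewrite ?vzx ?fzw ?ffzv eqxx ?orbT.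
by have := subset_leq_card sub; rewrite card_vf // leqNgt big.
Qed.

Lemma vf_L_ne d : vf (L d) != vf (L (e d)).
Proof.
apply/eqP => /(vf_inj (tri_L _) (tri_L _)); set x := L d; set y := L (e d).
have tx : tri x := tri_L d; have vy : vt y = vt (e x) by rewrite vt_L vt_eL.
have vey : vt (e y) = vt x by rewrite vt_eL eK vt_L.
have := tri_uniq tx; rewrite /= !inE !andbT => /andP [] /norP [uv uw] vw.
case/or3P => /eqP yE.
- by move: vy; rewrite yE => /eqP; rewrite (negbTE (vt_ne _)).
- by move: vey; rewrite yE -vt_f => h; rewrite h eqxx in uw.
- by move: vy; rewrite yE -vt_f => h; rewrite h eqxx in vw.
Qed.

Lemma vf_adj (A : {set {set V}}) d : edg d \notin bd A -> A \subset FF ->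
  (vf (L d) \in A) = (vf (L (e d)) \in A).
Proof.
move=> nb AF; move: nb; rewrite (in_bd AF (star_edg d) (vf_L_ne d)) ?cards2 ?vt_ne //.
by case: (vf (L d) \in A); case: (vf (L (e d)) \in A).
Qed.

Lemma surface_FF : surface FF.
Proof.
split.
- by move=> _ /FFP [x tx ->]; apply: card_vf.
- by move=> _ /edgesP [d td ->]; rewrite star_edg cards2 vf_L_ne.
- move=> A AF bA; pose B k := vf (L k) \in A.
  have Be k : B (e k) = B k by rewrite /B -(@vf_adj A k) // bA inE.
  have Bf k : B (f k) = B k.
    have [tk|tk] := boolP (tri k); last by rewrite /B L_digon // -/(B (e k)) Be.
    by rewrite /B !L_tri ?tri_f // vf_f.
  have Bc := map_constf Be Bf.
  have [Bo|Bo] := boolP (B o); [right|left].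
    apply/eqP; rewrite eqEsubset AF; apply/subsetP => _ /FFP [x tx ->].
    by have := Bc o x; rewrite Bo /B L_tri.
  apply/setP => g; rewrite inE; apply/negbTE/negP => gA.
  have /FFP [x tx gx] := subsetP AF g gA.
  by have := Bc o x; rewrite (negbTE Bo) /B L_tri // -gx gA.
- by apply/set0Pn; exists (vf o); apply: in_FF.
Qed.

Lemma tri_fconnect x y : fconnect f x y -> tri x = tri y.
Proof.
case/connectP => p; elim: p x => [|z p IH] x /=; first by move=> _ ->.
by case/andP => /eqP <- /IH h /h <-; rewrite tri_f.
Qed.

Lemma fconnect_face x y : fconnect f x y = (y \in [:: x; f x; f (f x)]).
Proof.
apply/idP/idP => [|]; last first.
  rewrite !inE => /or3P [] /eqP ->; rewrite ?connect0 ?fconnect1 //.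
  by apply: (connect_trans (fconnect1 f x)); apply: fconnect1.
case/connectP => p px ->.
have H w q : w \in [:: x; f x; f (f x)] -> path (frel f) w q -> last w q \in [:: x; f x; f (f x)].
  elim: q w => //= z q IH w wx /andP [/eqP <- pw]; apply: IH => //.
  move: wx; rewrite !inE => /or3P [] /eqP ->; rewrite ?eqxx ?orbT //.
  by case/orP: (face23 x) => /eqP E; rewrite ?E ?eqxx ?orbT.
by apply: H px; rewrite mem_head.
Qed.

Lemma orb_f_eq x y : (orb f x == orb f y) = (x \in [:: y; f y; f (f y)]).
Proof.
rewrite -fconnect_face; apply/eqP/idP => [h|h].
  by have := orb_refl f x; rewrite h inE.
by apply: (orb_eq injf); rewrite inE.
Qed.

(** A digon contributes two darts and one face, so the digons cancel in Euler's formula. *)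
Lemma card_FF : #|FF| + 4 = 2 * #|verts|.
Proof.
pose S3 := [set d | tri d]; pose S2 := [set d | ~~ tri d].
have FFE : FF = vf @: S3.
  by apply/setP => g; apply/imsetP/imsetP => -[x tx ->]; exists x; rewrite ?inE //; rewrite inE in tx.
have k3 : #|orb f @: S3| = #|FF|.
  rewrite FFE; apply: card_imset_ker => x y; rewrite !inE => tx ty; rewrite orb_f_eq.
  apply/idP/eqP => [|h]; last by apply: vf_inj => //.
  by rewrite !inE => /or3P [] /eqP ->; rewrite ?vf_f ?tri_f.
have c3 : #|S3| = 3 * #|orb f @: S3|.
  apply: card_fibers => x; rewrite inE => tx.
  have -> : [set y in S3 | orb f y == orb f x] = [set x; f x; f (f x)].
    apply/setP => y; rewrite !inE orb_f_eq !inE -orbA andb_idl //.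
    by case/or3P => /eqP ->; rewrite ?tri_f.
  have := tri_uniq tx; rewrite /= !inE !andbT => /andP [] /norP [uv uw] vw.
  have off u v : (vt u != vt v) -> (u != v) by apply: contra => /eqP ->.
  by rewrite -setUA cardsU1 cards2 !inE negb_or !off.
have c2 : #|S2| = 2 * #|orb f @: S2|.
  apply: card_fibers => x; rewrite inE => tx.
  have -> : [set y in S2 | orb f y == orb f x] = [set x; f x].
    apply/setP => y; rewrite !inE orb_f_eq !inE (face_digon2 tx).
    have -> : [|| y == x, y == f x | y == x] = (y == x) || (y == f x).
      by case: (y == x); case: (y == f x).
    by rewrite andb_idl // => /orP [] /eqP ->; rewrite ?tri_f.
  by rewrite cards2 (contraNneq _ (vt_ne x)) // => xfx; rewrite -vt_f -xfx.
have kO : #|orbs f| = #|orb f @: S3| + #|orb f @: S2|.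
  rewrite -cardsUI (_ : _ :&: _ = set0) ?cards0 ?addn0.
    rewrite -imsetU; congr #|pred_of_set _|; apply/setP => A.
    by apply/imsetP/imsetP => -[x _ ->]; exists x; rewrite ?inE ?orbN.
  apply/setP => A; rewrite !inE; apply/negbTE/negP => /andP [/imsetP [x xS ->] /imsetP [y yS]].
  move/eqP; rewrite orb_f_eq -fconnect_face => /tri_fconnect; move: xS yS; rewrite !inE => -> .
  by move/negbTE ->.
have kN : #|orbs n| = #|verts|.
  have E (J : finType) (g : X -> J) : [set g x | x : X] = g @: [set: X].
    by apply/setP => b; apply/imsetP/imsetP => -[x _ ->]; exists x.
  rewrite /orbs /verts !E; apply: card_imset_ker => x y _ _.
  rewrite vtP; apply/eqP/idP => [h|h]; last by apply/esym/(orb_eq injn); rewrite inE.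
  by have := orb_refl n y; rewrite -h inE.
have cX : #|S3| + #|S2| = #|X|.
  by rewrite -(cardsC S3); congr (_ + #|pred_of_set _|); apply/setP => d; rewrite !inE.
move: euler k3 c3 c2 kO kN cX; rewrite -/f.
lia_card.
Qed.

Lemma edg_vt d : vt d \in edg d. Proof. by rewrite !inE eqxx. Qed.
Lemma edg_card d : #|edg d| = 2. Proof. by rewrite cards2 vt_ne. Qed.
Lemma edg_e d : edg (e d) = edg d. Proof. by rewrite /edg eK setUC. Qed.
Lemma edg_subL d : edg d \subset vf (L d).
Proof. by rewrite subUset !sub1set -vt_L -vt_eL -vt_f !inE !eqxx orbT. Qed.
Lemma edg_subLe d : edg d \subset vf (L (e d)).
Proof. by rewrite -edg_e edg_subL. Qed.

Lemma link_FF v (A : {set {set V}}) : A \subset [set g in FF | v \in g] ->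
    (forall d g h : {set V}, v \in d -> #|d| = 2 -> g \in FF -> h \in FF -> d \subset g -> d \subset h ->
       g \in A -> h \in A) ->
    A = set0 \/ A = [set g in FF | v \in g].
Proof.
move=> AS closed; pose B d := vf (L d) \in A.
have Be d : vt d = v -> (vf (L (e d)) \in A) = B d.
  move=> dv; have ve : v \in edg d by rewrite -dv edg_vt.
  apply/idP/idP; apply: (closed (edg d)); rewrite ?edg_card ?edg_subL ?edg_subLe //;
    exact/in_FF/tri_L.
have Bn d : vt d = v -> B (n d) = B d.
  move=> dv; have nf : n d = f (e d) by rewrite /face eK.
  have [te|te] := boolP (tri (e d)).
    by rewrite -[RHS]Be // nf /B !L_tri ?tri_f // vf_f.
  by rewrite /B nf L_digon // eK.
have Bc x y : vt x = v -> vt y = v -> B x = B y.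
  move=> xv yv; have : fconnect n x y by rewrite -vtP xv yv.
  case/connectP => p; elim: p x xv => [|z p IH] x xv /=; first by move=> _ ->.
  by move=> /andP [/eqP <- pz] yl; rewrite -Bn //; apply: IH; rewrite ?vt_n.
have star_corner g : g \in FF -> v \in g -> exists2 x, vt x = v & g = vf (L x).
  by move=> /FFP [y ty ->] /(vf_corner ty) [x [tx <- xv _]]; exists x; rewrite ?L_tri.
have [A0|[g gA]] := set_0Vmem A; [by left | right].
apply/eqP; rewrite eqEsubset AS; apply/subsetP => h; rewrite inE => /andP [hF vh].
have := subsetP AS g gA; rewrite inE => /andP [gF vg].
have [x xv gx] := star_corner g gF vg; have [y yv ->] := star_corner h hF vh.
by rewrite -/(B y) (Bc y x yv xv) /B -gx.
Qed.

Lemma even_FF (A : {set {set V}}) (t : {set V}) : A \subset FF -> #|t| = 3 -> bd A = pairs t -> ~~ odd #|cover A :\: t|.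
Proof.
move=> AF t3 bA; have [u [v [w [uq tE]]]] := triple t3.
have [uv uw vw] : [/\ u != v, u != w & v != w].
  by move: uq; rewrite /= !inE !andbT => /andP [] /norP [? ?] ?.
pose l d := vf (L d) \in A.
have le d : (l d == l (e d)) = (edg d \notin pairs t).
  by rewrite -bA (in_bd AF (star_edg d) (vf_L_ne d) (edg_card d)) /l; case: (_ \in A); case: (_ \in A).
(* A set of merged faces becomes a set of faces of the map. A digon counts only if both sides of its
   bundle of parallel edges belong to [A], so on a boundary bundle all digons are outside and the
   boundary runs along the triangle in [A]. *)
pose al d := if tri d then vf d \in A else l d && l (e d).
have alf d : al (f d) = al d.
  rewrite /al tri_f; have [td|td] := boolP (tri d); first by rewrite vf_f.
  have E : L (e (f d)) = L d by apply/esym/L_par; rewrite -par_e eK; apply: par_digon.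
  by rewrite /l L_digon // E andbC.
have alb d : al d (+) al (e d) = (edg d \in pairs t) && ((l d && tri d) || (l (e d) && tri (e d))).
  have := le d; rewrite /al eK; have [td|td] := boolP (tri d); have [te|te] := boolP (tri (e d));
    rewrite -?[vf d]/(vf d); rewrite /l ?(L_tri td) ?(L_tri te); 
    case: (edg d \in pairs t); case: (_ \in A); case: (_ \in A) => //.
have dart p q : [set p; q] \in pairs t -> p != q -> exists d, vt d = p /\ vt (e d) = q.
  move=> pq pq'; have : [set p; q] \in edges FF.
    by apply: (subsetP (bd_sub_edges AF)); rewrite bA.
  case/edgesP => d td E; have : p \in edg d by rewrite -E !inE eqxx.
  have : q \in edg d by rewrite -E !inE eqxx orbT.
  rewrite !inE => /orP [] /eqP qd /orP [] /eqP pd; move: pq'; rewrite qd pd ?eqxx // => _.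
    by exists (e d); rewrite eK.
  by exists d.
have edgeP z d : tri z -> l z -> ~~ l (e z) ->
    edge z d = (edg d == edg z) && ((l d && tri d) || (l (e d) && tri (e d))).
  move=> tz lz lez; apply/idP/andP => [|[/eqP/edg_par dz h]].
    by rewrite /edge => /orP [] /eqP ->; rewrite ?edg_e eqxx ?eK lz tz ?orbT.
  have Lz : L z = z := L_tri tz.
  case: dz => dz.
    have L1 := L_par dz; have L2 : L (e d) = L (e z) by apply: L_par; rewrite par_e.
    move: h; rewrite /l L1 L2 -/(l z) -/(l (e z)) lz (negbTE lez) /= orbF => td.
    by rewrite /edge -(L_tri td) L1 Lz eqxx.
  have L1 := L_par dz; have L2 : L (e d) = z by rewrite -Lz; apply: L_par; rewrite -par_e eK.
  move: h; rewrite /l L1 L2 -/(l (e z)) (negbTE lez) /= => /andP [_ te].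
  have edz : e d = z by rewrite -(L_tri te).
  by rewrite /edge -edz eK eqxx orbT.
(* Each boundary pair thus contributes exactly one edge of the map, and the three of them form the
   3-cycle for [parity_both]. *)
have cut p q : [set p; q] \in pairs t -> p != q -> exists a, [/\ vt a = p, vt (e a) = q &
    forall d, edge a d = (edg d == [set p; q]) && ((l d && tri d) || (l (e d) && tri (e d)))].
  move=> pq pq'; have [d0 [d0p d0q]] := dart p q pq pq'.
  have E0 : [set p; q] = edg d0 by rewrite /edg d0p d0q.
  have lne : l d0 != l (e d0) by rewrite le -E0 pq.
  have edgL d : edg (L d) = edg d by rewrite /edg vt_L vt_eL.
  have lL d : l (L d) = l d by rewrite /l (L_tri (tri_L d)).
  have leL d : l (e (L d)) = l (e d) by rewrite /l L_eL.
  have [l0|l0] := boolP (l d0).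
    exists (L d0); rewrite vt_L vt_eL d0p d0q; split=> // d.
    rewrite edgeP ?tri_L ?lL ?leL ?edgL -?E0 //.
    by move: lne; rewrite l0; case: (l (e d0)).
  have l1 : l (e d0) by move: lne; rewrite (negbTE l0); case: (l (e d0)).
  exists (e (L (e d0))); rewrite vt_eL !eK vt_L d0p d0q; split=> // d.
  have -> : edge (e (L (e d0))) d = edge (L (e d0)) d by rewrite /edge eK orbC.
  by rewrite edgeP ?tri_L ?lL ?leL ?edgL ?edg_e ?eK -?E0.
have tp : pairs t = [set [set u; v]; [set v; w]; [set u; w]] by rewrite tE pairs3.
have puv : [set u; v] \in pairs t by rewrite tp !inE eqxx.
have pvw : [set v; w] \in pairs t by rewrite tp !inE eqxx orbT.
have pwu : [set w; u] \in pairs t by rewrite tp !inE [[set w; u]]setUC eqxx !orbT.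
have wu : w != u by rewrite eq_sym.
have [a [au av aE]] := cut u v puv uv.
have [b [bv bw bE]] := cut v w pvw vw.
have [c [cw cu cE]] := cut w u pwu wu.
have alb3 d : al d (+) al (e d) = on3 a b c d.
  rewrite alb /on3 aE bE cE tp !inE -!andb_orl [[set w; u]]setUC orbA //.
have := parity_both (etrans av (esym bv)) (etrans bw (esym cw)) (etrans cu (esym au)) _ alf alb3.
rewrite au bv cw => /(_ uq); rewrite -tE.
suff -> : side al t = cover A :\: t by [].
apply/setP => x; rewrite in_setD; apply/sideP/andP => [[d [ad dx xt]]|[xt /bigcupP [g gA xg]]].
  split=> //; move: ad; rewrite /al; have [td|td] := boolP (tri d).
    by move=> h; apply/bigcupP; exists (vf d) => //; rewrite -dx !inE eqxx.
  by case/andP => h _; apply/bigcupP; exists (vf (L d)) => //; rewrite -dx -vt_L !inE eqxx.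
have /FFP [y ty gy] := subsetP AF g gA; move: xg; rewrite gy => /(vf_corner ty) [z [tz vz zx _]].
by exists z; split=> //; rewrite /al tz vz -gy.
Qed.

Lemma even_sphere_FF : even_sphere FF.
Proof.
split; [exact: surface_FF | by rewrite cover_FF card_FF | exact: link_FF | exact: even_FF].
Qed.

End Big.

(** * Adding the faces of a hypertree one at a time *)

Fixpoint grow (C : {set V}) (s : seq X) : bool :=
  if s is x :: s' then
    [&& tri x, vt x \in C, vt (f x) \notin C, vt (f (f x)) \notin C & grow (vf x :|: C) s']
  else C == verts.

Lemma grow_tri C s x : grow C s -> x \in s -> tri x.
Proof.
elim: s C => //= y s IH C /and5P [ty _ _ _ /IH gs].
by rewrite inE => /orP [/eqP ->|/gs].
Qed.

(** The count is tight: by [grow_bound], a face that met the vertices reached so far in two or more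
    vertices would leave too few faces to reach the rest. *)
Lemma grow_exists (T : {set {set V}}) (C : {set V}) : T \subset FF -> C \subset verts ->
  (forall B : {set V}, C \subset B -> B \subset verts -> B != verts ->
     exists2 g, g \in T & ~~ (g \subset B) && ~~ [disjoint g & B]) ->
  #|verts| = #|C| + 2 * #|T| ->
  exists2 s, grow C s & forall x, x \in s -> vf x \in T.
Proof.
elim: {T}_.+1 {-2}T (ltnSn #|T|) C => // m IH T; rewrite ltnS => leT C TF Cv conT card.
have [CE|CnE] := eqVneq C verts; first by exists [::]; rewrite /= ?CE.
have [g gT /andP [gC gdC]] := conT C (subxx C) Cv CnE.
have cT : #|T| = #|T :\ g|.+1 by rewrite (cardsD1 g) gT.
have /FFP [y ty gy] := subsetP TF g gT.
have T3 h : h \in T -> #|h| = 3 by move=> /(subsetP TF)/FFP [z tz ->]; apply: card_vf.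
have Tv h : h \in T -> h \subset verts by move=> /(subsetP TF)/FFP [z tz ->]; apply: vf_sub.
have gCv : g :|: C \subset verts by rewrite subUset Cv Tv.
have conT' (B : {set V}) : g :|: C \subset B -> B \subset verts -> B != verts ->
     exists2 h, h \in T :\ g & ~~ (h \subset B) && ~~ [disjoint h & B].
  rewrite subUset => /andP [gB CB] Bv Bn; have [h hT hB] := conT B CB Bv Bn.
  exists h => //; rewrite !inE hT andbT; apply: contraTneq hB => ->; by rewrite gB.
have bound : #|verts| <= #|g :|: C| + 2 * #|T :\ g|.
  apply: grow_bound => // [h|h]; rewrite inE => /andP [_]; [exact: T3 | exact: Tv].
have gC1 : #|g :&: C| = 1.
  have : 0 < #|g :&: C| by rewrite card_gt0 setI_eq0.
  have := cardsUI g C; rewrite (T3 g gT); move: bound card cT.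
  lia_card.
have cU : #|g :|: C| = #|C| + 2.
  have := cardsUI g C; rewrite (T3 g gT) gC1.
  lia_card.
have /cards1P [v gCE] : #|g :&: C| == 1 by rewrite gC1.
have : v \in g :&: C by rewrite gCE set11.
rewrite inE => /andP [vg vC]; move: (vg); rewrite gy => /(vf_corner ty) [x [tx vx xv _]].
have uq := tri_uniq tx; move: uq; rewrite /= !inE !andbT => /andP [] /norP [uv uw] vw.
have out z : z \in vf x -> z != vt x -> z \notin C.
  rewrite vx -gy xv => zg; apply: contra => zC.
  have zz : z \in g :&: C by rewrite inE zg.
  by move: zz; rewrite gCE inE.
have TF' : T :\ g \subset FF by apply: subset_trans TF; apply: subsetDl.
have ltT : #|T :\ g| < m by rewrite -cT.
have card' : #|verts| = #|g :|: C| + 2 * #|T :\ g| by rewrite card cU cT mulnS addnA.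
have [s gs sT] := IH _ ltT _ TF' gCv conT' card'.
exists (x :: s).
  rewrite /= tx xv vC /= vx -gy gs andbT.
  by apply/andP; split; apply: out; rewrite ?inE ?eqxx ?orbT // eq_sym.
move=> z; rewrite inE => /orP [/eqP ->|/sT]; first by rewrite vx -gy.
by rewrite inE => /andP [].
Qed.

Lemma tri_edge_avoid d : tri d -> L (e d) \notin [:: d; f d; f (f d)].
Proof.
move=> td; have := tri_uniq td; rewrite /= !inE !andbT => /andP [] /norP [uv uw] vw.
set y := L (e d); have vy : vt y = vt (e d) by rewrite vt_L.
have vey : vt (e y) = vt d by rewrite vt_eL eK.
apply/negP => /or3P [] /eqP yE.
- by move: vy; rewrite yE => /eqP; rewrite (negbTE (vt_ne _)).
- by move: vey; rewrite yE -vt_f => h; rewrite h eqxx in uw.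
- by move: vy; rewrite yE -vt_f => h; rewrite h eqxx in vw.
Qed.

Theorem triangle_growth : exists r s, grow [set vt r] s /\
  forall x, x \in s -> o \notin [:: x; f x; f (f x)].
Proof.
have avoid y : tri y -> vf y != vf o -> o \notin [:: y; f y; f (f y)].
  move=> ty; apply: contraNN; rewrite !inE => /or3P [] /eqP ->; rewrite ?vf_f ?tri_f //.
(* With three vertices the two sides of the outer triangle can merge into one triple, and [FF] need
   not be a surface; the triangle across [o] already reaches every vertex. *)
have [small|big] := leqP #|verts| 3.
  exists (e o), [:: L (e o)]; split.
    have tL := tri_L (e o); have := tri_uniq tL; rewrite /= !inE !andbT => /andP [] /norP [uv uw] vw.
    rewrite tL vt_L eqxx -(vt_L (e o)) ![_ == vt (L (e o))]eq_sym uv uw /=.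
    have -> : vf (L (e o)) :|: [set vt (L (e o))] = vf (L (e o)).
      by apply/setUidPl; rewrite sub1set !inE eqxx.
    by rewrite eqEcard vf_sub card_vf.
  move=> x; rewrite inE => /eqP ->; apply: contra (tri_edge_avoid tri_o).
  rewrite -!fconnect_face fconnect_sym //; exact: injf.
have sph := even_sphere_FF big.
(* The prescribed face shares the edge of [o] with the outer face, so [hypertree_share] keeps the
   outer face out. *)
have [T hT gT] := even_sphere_hypertree sph (in_FF (tri_L (e o))).
have vo : vf o \notin T.
  apply/negP => oT; have ne : vf o != vf (L (e o)) by rewrite -{1}(L_tri tri_o) vf_L_ne.
  have := hypertree_share (sphere_surface sph) hT oT gT ne.
  rewrite leqNgt => /negP; apply; rewrite -(edg_card o); apply: subset_leq_card.
  by rewrite subsetI -{2}(L_tri tri_o) edg_subL edg_subLe.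
have [s gs sT] : exists2 s, grow [set vt o] s & forall x, x \in s -> vf x \in T.
  apply: grow_exists; first exact: hypertree_sub hT.
  - by rewrite sub1set imset_f.
  - move=> B oB Bv Bn; have := hypertree_conn hT; rewrite cover_FF; apply=> //.
    by apply/set0Pn; exists (vt o); rewrite -sub1set.
  - by rewrite -cover_FF -(hypertree_card hT) cards1 mul2n.
exists o, s; split=> // x xs; have := sT x xs => xT.
by apply: avoid; [apply: grow_tri gs xs | apply: contraNneq vo => <-].
Qed.

End PlaneMap.

(** * The walk around a union of faces *)

Section Boundary.
Variables (X V : finType) (e n : X -> X) (vt : X -> V).
Hypotheses (eK : involutive e) (injn : injective n).
Hypothesis vtP : forall x y, (vt x == vt y) = fconnect n x y.
Notation f := (face e n).
Hypothesis face23 : forall d, (f (f d) == d) || (f (f (f d)) == d).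

(* The successor of a dart on the walk around the union of the faces in [S]. *)
Definition turn (S : {set X}) d := if d \in S then e d else finv n d.
Definition face_union (s : seq X) := [set d | has (fun x => d \in [:: x; f x; f (f x)]) s].

Let vtn d : vt (n d) = vt d.
Proof. by apply/esym/eqP; rewrite vtP fconnect1. Qed.
Let vt_finv d : vt (finv n d) = vt d.
Proof. by rewrite -[in RHS](f_finv injn d) vtn. Qed.

Lemma turn_inj (S : {set X}) : (forall d, d \in S -> f d \in S) -> injective (turn S).
Proof.
move=> Sf x y; rewrite /turn; case xS: (x \in S); case yS: (y \in S).
- exact: (inv_inj eK).
- by move/(congr1 n); rewrite (f_finv injn) => h; have := Sf x xS; rewrite /face h yS.
- by move/(congr1 n); rewrite (f_finv injn) => h; have := Sf y yS; rewrite /face -h xS.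
- exact: (finv_inj injn).
Qed.

Lemma turn_outside (S : {set X}) (C : {set V}) a b : (forall d, d \in S -> vt d \in C) ->
  vt a \notin C -> fconnect (turn S) a b -> vt b = vt a.
Proof.
move=> SC aC /connectP [p]; elim: p a aC => [|z p IH] a aC /=; first by move=> _ ->.
case/andP => /eqP <- pz bl.
have E : vt (turn S a) = vt a.
  by rewrite /turn; case: ifP => [/SC|_]; rewrite ?(negbTE aC) ?vt_finv.
by rewrite -E; apply: (IH _ _ pz bl); rewrite E.
Qed.

Lemma turn_vertex (S : {set X}) (C : {set V}) a b : (forall d, d \in S -> f d \in S) ->
  (forall d, d \in S -> vt d \in C) -> vt a \notin C -> vt b = vt a -> fconnect (turn S) a b.
Proof.
move=> Sf SC aC ba; have : fconnect n a b by rewrite -vtP ba.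
have sym := fconnect_sym (turn_inj Sf).
case/connectP => p; elim: p a aC {ba} => [|z p IH] a aC /=; first by move=> _ ->.
case/andP => /eqP <- pz bl.
have naC : vt (n a) \notin C by rewrite vtn.
apply: connect_trans (IH _ naC pz bl); rewrite sym; apply: connect1 => /=.
rewrite /turn; case: ifP => [/SC|_]; first by rewrite (negbTE naC).
by rewrite (finv_f injn).
Qed.

(** Off [C] the walk just rotates around each vertex. The new triangle touches the single orbit on
    [C] and two such rotations in one dart each, and it joins the three orbits into one. *)
Lemma turn_merge (S : {set X}) (C : {set V}) x : (forall d, d \in S -> f d \in S) ->
  (forall d, d \in S -> vt d \in C) -> tri e n x ->
  vt x \in C -> vt (f x) \notin C -> vt (f (f x)) \notin C -> vt (f x) != vt (f (f x)) ->
  (forall a b, vt a \in C -> vt b \in C -> fconnect (turn S) a b) ->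
  forall a b, vt a \in vf e n vt x :|: C -> vt b \in vf e n vt x :|: C ->
  fconnect (turn (S :|: [set x; f x; f (f x)])) a b.
Proof.
move=> Sf SC tx xC fxC ffxC ne conC.
have fffx : f (f (f x)) = x by apply/eqP; have := face23 x; rewrite (negbTE tx).
set S2 := S :|: _.
have S2f d : d \in S2 -> f d \in S2.
  rewrite !inE => /orP [/Sf -> //|/orP [/orP [] |] /eqP ->]; by rewrite ?fffx eqxx ?orbT.
have nS y : vt y \notin C -> y \notin S by apply: contra => /SC.
have fxS := nS _ fxC; have ffxS := nS _ ffxC.
have xS : x \notin S by apply: contra fxS => /Sf.
have sym := fconnect_sym (turn_inj Sf); have sym2 := fconnect_sym (turn_inj S2f).
have ef y : e y = finv n (f y) by rewrite /face (finv_f injn).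
(* From a dart [y] of the new triangle the new walk goes to [e y], where the old walk goes from
   [f y]. It then follows the old orbit of [f y], which meets the triangle nowhere else, all the way
   back to [f y]. *)
have orb_step y z : y \in [:: x; f x; f (f x)] -> f y \notin S -> 
   (forall w, fconnect (turn S) (f y) w -> w != f y -> w \notin [:: x; f x; f (f x)]) ->
   fconnect (turn S) (f y) z -> fconnect (turn S2) y z.
  move=> yI fyS alone.
  have start : fconnect (turn S2) y (turn S (f y)).
    apply: connect1 => /=; rewrite /turn (negbTE fyS) -ef.
    have -> // : y \in S2 by rewrite !inE -orbA; move: yI; rewrite !inE => ->; rewrite orbT.
  have walk p w : fconnect (turn S) (f y) w -> fconnect (turn S2) y w ->
      path (frel (turn S)) w p -> fconnect (turn S2) y (last w p).
    elim: p w => //= w' p IH w cw rw /andP [/eqP <- pw]; apply: IH pw.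
      by apply: connect_trans cw (fconnect1 _ _).
    have [->|wn] := eqVneq w (f y); first exact: start.
    apply: connect_trans rw _; apply: connect1 => /=.
    have := alone w cw wn; rewrite /turn !inE -!orbA => /negbTE ->; by rewrite orbF.
  move=> fyz; have : fconnect (turn S) (turn S (f y)) z.
    by apply: connect_trans fyz; rewrite sym; apply: fconnect1.
  by case/connectP => p pw ->; apply: walk pw => //; apply: fconnect1.
have apart y w : vt y \notin C -> fconnect (turn S) x w -> vt w != vt y.
  move=> yC xw; apply/eqP => wy; have wC : vt w \notin C by rewrite wy.
  by rewrite sym in xw; have := wC; rewrite -(turn_outside SC wC xw) xC.
have s1 a : vt a = vt (f x) -> fconnect (turn S2) x a.
  move=> av; apply: orb_step => //; first by rewrite mem_head.
    move=> w cw wn; have wv := turn_outside SC fxC cw; rewrite !inE (negbTE wn) /=.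
    by apply/norP; split; apply: contraTneq fxC => wE; [rewrite -wv wE xC | move: ne; rewrite -wv wE eqxx].
  exact: turn_vertex Sf SC fxC av.
have s2 a : vt a = vt (f (f x)) -> fconnect (turn S2) (f x) a.
  move=> av; apply: orb_step => //; first by rewrite !inE eqxx orbT.
    move=> w cw wn; have wv := turn_outside SC ffxC cw; rewrite !inE (negbTE wn) orbF.
    by apply/norP; split; apply: contraTneq ffxC => wE; [rewrite -wv wE xC | move: ne; rewrite -wv wE eqxx].
  exact: turn_vertex Sf SC ffxC av.
have s3 a : vt a \in C -> fconnect (turn S2) (f (f x)) a.
  move=> aC; apply: orb_step; rewrite ?fffx //; first by rewrite !inE eqxx !orbT.
    move=> w cw wn; rewrite !inE (negbTE wn) /=.
    by apply/norP; split; apply/eqP => wE;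
      [have := apart _ _ fxC cw | have := apart _ _ ffxC cw]; rewrite wE eqxx.
  exact: conC.
have key a : vt a \in vf e n vt x :|: C -> fconnect (turn S2) x a.
  have x1 := s1 _ erefl; have x2 := connect_trans x1 (s2 _ erefl).
  rewrite !inE -!orbA => /or4P [/eqP av|/eqP av|/eqP av|aC].
  - have aC : vt a \in C by rewrite av.
    exact: connect_trans x2 (s3 _ aC).
  - exact: s1.
  - exact: connect_trans x1 (s2 _ av).
  - exact: connect_trans x2 (s3 _ aC).
by move=> a b aC bC; apply: connect_trans (key b bC); rewrite sym2; apply: key.
Qed.

Lemma turn_grow s (S : {set X}) (C : {set V}) : (forall d, d \in S -> f d \in S) ->
  (forall d, d \in S -> vt d \in C) ->
  (forall a b, vt a \in C -> vt b \in C -> fconnect (turn S) a b) ->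
  (forall d, tri e n d -> uniq [:: vt d; vt (f d); vt (f (f d))]) ->
  grow e n vt C s -> forall a b, fconnect (turn (S :|: face_union s)) a b.
Proof.
move=> + + + uq; elim: s S C => [|x s IH] S C Sf SC conC /=.
  move=> /eqP CE a b; rewrite (_ : face_union [::] = set0) ?setU0; last by apply/setP => d; rewrite !inE.
  by apply: conC; rewrite CE imset_f.
case/and5P => tx xC fxC ffxC gs.
have fffx : f (f (f x)) = x by apply/eqP; have := face23 x; rewrite (negbTE tx).
have -> : S :|: face_union (x :: s) = (S :|: [set x; f x; f (f x)]) :|: face_union s.
  by apply/setP => d; rewrite !inE /= !inE -!orbA.
apply: IH gs => [d|d|].
- rewrite !inE => /orP [/Sf -> //|/orP [/orP [] |] /eqP ->]; by rewrite ?fffx eqxx ?orbT.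
- rewrite !inE => /orP [/SC -> |/orP [/orP [] |] /eqP ->]; by rewrite ?eqxx ?orbT.
- apply: turn_merge => //; have := uq x tx.
  by rewrite /= !inE !andbT => /andP [].
Qed.

Lemma turn_single r s : (forall d, tri e n d -> uniq [:: vt d; vt (f d); vt (f (f d))]) ->
  grow e n vt [set vt r] s -> forall a b, fconnect (turn (face_union s)) a b.
Proof.
move=> uq gs; rewrite -[face_union s]set0U.
apply: (turn_grow _ _ _ uq gs) => [d|d|]; rewrite ?inE // => a b; rewrite !inE => /eqP ar /eqP br.
have t0 : turn set0 =1 finv n by move=> d; rewrite /turn inE.
rewrite (eq_fconnect t0) (same_fconnect_finv injn) -vtP ar br eqxx //.
Qed.

End Boundary.

(** * Trees of faces *)

Section TreeSeq.
Variables (N : finType) (adj : rel N).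
Hypothesis adjC : symmetric adj.

(** Read from the back, every node after the first is attached by exactly one edge to those already
    present. *)
Fixpoint tree_seq (zs : seq N) : bool :=
  if zs is z :: zs' then
    [&& z \notin zs', (zs' == [::]) || (count (adj z) zs' == 1) & tree_seq zs']
  else true.

(** The node of the cycle that stands first in the list has two different neighbours on the cycle,
    both further down. *)
Lemma tree_seq_acyclic zs (c : seq N) : tree_seq zs -> {subset c <= zs} -> uniq c -> 2 < size c ->
  ~~ cycle adj c.
Proof.
elim: zs => [|z zs IH] /=; first by case: c => // a c _ /(_ a); rewrite mem_head => /(_ isT).
case/and3P => zzs cnt ts sub uc c2; have [zc|zc] := boolP (z \in c); last first.
  apply: IH => // x xc; have := sub x xc; rewrite inE => /orP [/eqP xz|//].
  by rewrite -xz xc in zc.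
have [i c' ci] := rot_to zc; rewrite -(rot_cycle i) ci.
have uc' : uniq (z :: c') by rewrite -ci rot_uniq.
have c'2 : 2 < size (z :: c') by rewrite -ci size_rot.
have sub' : {subset c' <= zs}.
  move=> x xc'; have : x \in z :: zs by apply: sub; rewrite -(mem_rot i) ci inE xc' orbT.
  rewrite inE => /orP [/eqP xz|//]; by move: uc'; rewrite /= -xz xc'.
case: c' ci uc' c'2 sub' => [|a [|b c'']] // ci uc' _ sub'.
apply/negP => /=; rewrite rcons_path => /and4P [za _ _ lz].
set l := last b c'' in lz; have lin : l \in b :: c'' by exact: mem_last.
have : uniq [:: a; l].
  rewrite /= inE andbT; apply/eqP => al; move: uc'; rewrite /= => /and3P [_ + _].
  by rewrite al lin.
have al : {subset [:: a; l] <= filter (adj z) zs}.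
  move=> x; rewrite !inE => /orP [] /eqP ->; rewrite mem_filter.
    by rewrite za sub' // mem_head.
  by rewrite adjC lz sub' // inE lin orbT.
move/uniq_leq_size/(_ al); rewrite size_filter /=.
case/orP: cnt => [/eqP z0|/eqP -> //].
by have := sub' a (mem_head _ _); rewrite z0.
Qed.

Lemma tree_seq_connected zs a b : tree_seq zs -> a \in zs -> b \in zs ->
  connect (fun u w => [&& u \in zs, w \in zs & adj u w]) a b.
Proof.
elim: zs a b => //= z zs IH a b /and3P [zzs cnt ts].
have mono u v : u \in zs -> v \in zs ->
    connect (fun u w => [&& u \in z :: zs, w \in z :: zs & adj u w]) u v.
  move=> uz vz; apply: connect_sub (IH u v ts uz vz) => p q /and3P [pz qz pq].
  by apply: connect1; rewrite !inE pz qz pq !orbT.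
have nb x : x \in zs -> exists2 y, y \in zs & adj z y.
  move=> xz; case/orP: cnt => [/eqP z0|/eqP c1]; first by rewrite z0 in xz.
  by apply/hasP; rewrite has_count c1.
rewrite !inE => /orP [/eqP ->|az] /orP [/eqP ->|bz]; rewrite ?connect0 //; last exact: mono.
- have [y yz zy] := nb b bz; apply: connect_trans (mono y b yz bz).
  by apply: connect1; rewrite mem_head inE yz orbT.
- have [y yz zy] := nb a az; apply: connect_trans (mono a y az yz) _.
  by apply: connect1; rewrite mem_head inE yz orbT adjC.
Qed.

Lemma tree_seq_is_tree (P : pred N) zs : tree_seq zs -> P =i zs -> is_tree P adj.
Proof.
move=> ts PE; split.
  move=> a b Pa Pb; have /= := @tree_seq_connected zs a b ts.
  rewrite -!PE => /(_ Pa Pb); rewrite (@eq_connect _ _ (fun u w => [&& P u, P w & adj u w])) //.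
  by move=> u w /=; rewrite -!PE.
move=> c /allP cP uc c2; apply: (tree_seq_acyclic ts) => // x /cP.
by rewrite -PE.
Qed.

End TreeSeq.

Section GrowTree.
Variables (X V : finType) (e n : X -> X) (vt : X -> V) (N : finType) (adj : rel N).
Variables (nv : V -> N) (nf : X -> N).
Notation f := (face e n).
Notation tri := (tri e n).
Notation vf := (vf e n vt).
Notation verts := (verts vt).
Hypothesis adjC : symmetric adj.
Hypothesis adj_vv : forall u v, adj (nv u) (nv v) = false.
Hypothesis adj_ff : forall x y, adj (nf x) (nf y) = false.
Hypothesis adj_vf : forall u y, tri y -> u \in verts -> adj (nv u) (nf y) = (u \in vf y).
Hypothesis nv_inj : {in verts &, injective nv}.
Hypothesis nv_nf : forall u y, nv u != nf y.
Hypothesis nf_vf : forall x y, tri x -> tri y -> nf x = nf y -> vf x = vf y.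
Hypothesis vuniq : forall d, tri d -> uniq [:: vt d; vt (f d); vt (f (f d))].

Definition nodes (C : {set V}) (F : seq X) (zs : seq N) :=
  forall z, z \in zs <-> (exists2 u, u \in C & z = nv u) \/ (exists2 x, x \in F & z = nf x).

Lemma tree_seq_uniq zs : tree_seq adj zs -> uniq zs.
Proof. by elim: zs => //= z zs IH /and3P [-> _ /IH]. Qed.

(** A new face hangs on the node of its only old vertex, and its two new vertices hang on the
    face. *)
Lemma grow_tree_seq s (C : {set V}) F zs : C \subset verts -> (forall y, y \in F -> tri y /\ vf y \subset C) ->
  tree_seq adj zs -> nodes C F zs -> grow e n vt C s ->
  exists zs', tree_seq adj zs' /\ nodes verts (rev s ++ F) zs'.
Proof.
elim: s C F zs => [|x s IH] C F zs Cv Ft ts nd /=; first by move=> /eqP <-; exists zs.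
case/and5P => tx xC fxC ffxC gs.
have := vuniq tx; rewrite /= !inE !andbT => /andP [] /norP [uv uw] vw.
have vv y : vt y \in verts by exact: imset_f.
have nfz : nf x \notin zs.
  apply/negP => /nd [[u _ h]|[y yF h]]; first by have := nv_nf u x; rewrite h eqxx.
  have [ty yC] := Ft y yF; case/negP: fxC; apply: (subsetP yC).
  by rewrite -(nf_vf tx ty h) !inE eqxx orbT.
have nvz y : vt y \notin C -> nv (vt y) \notin zs.
  move=> yC; apply/negP => /nd [[u uC h]|[z _ h]]; last by have := nv_nf (vt y) z; rewrite h eqxx.
  by case/negP: yC; rewrite (nv_inj (vv y) _ h) ?(subsetP Cv).
have zs0 : nv (vt x) \in zs by apply/nd; left; exists (vt x).
have c1 : count (adj (nf x)) zs = 1.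
  rewrite -[RHS](_ : count (pred1 (nv (vt x))) zs = 1); last first.
    by rewrite count_uniq_mem ?zs0 // tree_seq_uniq.
  apply: eq_in_count => z /(iffLR (nd z)) [[u uC ->]|[y yF ->]] /=; last first.
    by rewrite adj_ff eq_sym (negbTE (nv_nf _ _)).
  have uv' : u \in verts by rewrite (subsetP Cv).
  rewrite adjC adj_vf //; apply/idP/eqP => [|h]; last by rewrite (nv_inj uv' (vv x) h) !inE eqxx.
  rewrite !inE => /orP [/orP [] |] /eqP uE; [by rewrite uE | by rewrite -uE uC in fxC | by rewrite -uE uC in ffxC].
have c0 y : vt y \notin C -> count (adj (nv (vt y))) zs = 0.
  move=> yC; apply/eqP; rewrite -leqn0 leqNgt -has_count; apply/hasPn => z /nd [[u _ ->]|[w wF ->]].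
    by rewrite adj_vv.
  by have [tw wC] := Ft w wF; rewrite adj_vf //; apply: contra yC => /(subsetP wC).
have zsn : zs != [::] by apply: contraTneq zs0 => ->.
have ffne : nv (vt (f (f x))) \notin [:: nv (vt (f x)), nf x & zs].
  rewrite !inE !negb_or nv_nf nvz // !andbT; apply: contra vw => /eqP h.
  by rewrite (nv_inj (vv _) (vv _) h).
rewrite rev_cons cat_rcons.
apply: (IH (vf x :|: C) (x :: F) [:: nv (vt (f (f x))), nv (vt (f x)), nf x & zs]) => //.
- by rewrite subUset Cv vf_sub.
- move=> y; rewrite inE => /orP [/eqP ->|/Ft [ty yC]]; first by rewrite tx subsetUl.
  by split=> //; apply: subset_trans yC (subsetUr _ _).
- rewrite /= -/(tree_seq adj zs) ts nfz ffne (negbTE zsn) c1 !c0 // !adj_vv !adj_vf // !inE !eqxx ?orbT /=.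
  by rewrite negb_or nv_nf nvz.
- move=> z; rewrite !in_cons; split.
    case/or4P => [/eqP ->|/eqP ->|/eqP ->|/nd [[u uC ->]|[y yF ->]]].
    + by left; exists (vt (f (f x))); rewrite // !inE eqxx ?orbT.
    + by left; exists (vt (f x)); rewrite // !inE eqxx ?orbT.
    + by right; exists x; rewrite ?mem_head.
    + by left; exists u; rewrite // !inE uC orbT.
    + by right; exists y; rewrite // inE yF orbT.
  case=> [[u + ->]|[y + ->]].
    rewrite !inE -!orbA => /or4P [/eqP ->|/eqP ->|/eqP ->|uC]; rewrite ?eqxx ?zs0 ?orbT //.
    by rewrite (iffRL (nd _)) ?orbT //; left; exists u.
  rewrite inE => /orP [/eqP ->|yF]; first by rewrite eqxx ?orbT.
  by rewrite (iffRL (nd _)) ?orbT //; right; exists y.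
Qed.

End GrowTree.

Lemma fconnect_conj (S T : finType) (P : pred S) (s : S -> S) (t : T -> T) (h : S -> T) x y :
  (forall z, P z -> P (s z)) -> (forall z, P z -> h (s z) = t (h z)) ->
  {in P &, injective h} -> P x -> P y -> fconnect s x y = fconnect t (h x) (h y).
Proof.
move=> Ps hst hi Px Py.
have it i : P (iter i s x) /\ h (iter i s x) = iter i t (h x).
  by elim: i => //= i [Pi <-]; split; [apply: Ps | apply: hst].
apply/idP/idP => [/iter_findex <-|/iter_findex].
  by rewrite (it _).2 fconnect_iter.
by rewrite -(it _).2 => /(hi _ _ (it _).1 Py) <-; apply: fconnect_iter.
Qed.

Lemma orb_eqE (S : finType) (s : S -> S) x y : injective s -> (orb s x == orb s y) = fconnect s x y.
Proof.
move=> injs; apply/eqP/idP => [h|c]; first by have := orb_refl s y; rewrite -h inE.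
by apply/esym/orb_eq; rewrite // inE.
Qed.

Lemma imset_T (S T : finType) (h : S -> T) : h @: setT = [set h x | x : S].
Proof. by apply/setP => y; apply/imsetP/imsetP => -[x _ ->]; exists x. Qed.

(** * The exterior of a 3-cycle *)

Section Side.
Variables (X V : finType) (e n : X -> X) (vt : X -> V).
Hypotheses (eK : involutive e) (injn : injective n).
Hypothesis conn : forall x y, connect (fun a b => (b == e a) || (b == n a)) x y.
Hypothesis vtP : forall x y, (vt x == vt y) = fconnect n x y.
Notation f := (face e n).

Lemma conn_sym (s : X -> X) x y : injective s ->
  connect (fun a b => (b == e a) || (b == s a)) x y -> connect (fun a b => (b == e a) || (b == s a)) y x.
Proof.
move=> injs; case/connectP => p + ->; elim: p x => //= z p IH x /andP [xz pz].
apply: connect_trans (IH z pz) _; case/orP: xz => /eqP ->.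
  by apply: connect1; rewrite eK eqxx.
have : fconnect s (s x) x by rewrite fconnect_sym // fconnect1.
by apply: connect_sub => u w /= /eqP <-; apply: connect1; rewrite eqxx orbT.
Qed.

(** Only two edges of the 3-cycle meet at a corner, and the changes of [B] around the corner cancel,
    so the boundary of [B] contains both or neither. *)
Lemma boundary_vertex (B : pred X) a b c :
  vt (e a) = vt b -> vt (e b) = vt c -> vt (e c) = vt a -> uniq [:: vt a; vt b; vt c] ->
  (forall d, B (f d) = B d) -> (forall d, B d (+) B (e d) -> on3 e a b c d) ->
  B a (+) B (e a) = B b (+) B (e b).
Proof.
move=> ab bc ca; rewrite /= !inE !andbT => /andP [] /norP [nab nac] nbc Bf B3.
have := sum_orbit_telescope injn B b.
have bo : b \in orb n b by apply: orb_refl.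
have eao : e a \in orb n b by rewrite inE -vtP ab.
have eab : e a != b.
  by apply: contraNneq nac => h; rewrite -[a]eK h bc.
rewrite (bigD1 b) //= (bigD1 (e a)) ?eao //= !(invariant_rot eK Bf) eK big1 => [|d].
  by rewrite addr0; case: (B a); case: (B (e a)); case: (B b); case: (B (e b)) => //= /eqP.
rewrite (invariant_rot eK Bf) inE -vtP => /andP [/andP [/eqP db dnb] dnea].
have : ~~ (B d (+) B (e d)); last by case: (B d); case: (B (e d)); rewrite ?subrr.
apply/negP => /B3; rewrite /on3 /edge (negbTE dnb) (negbTE dnea) !orbF => /or3P [/eqP dE|/eqP dE|/orP [] /eqP dE].
- by rewrite db dE eqxx in nab.
- by rewrite db dE bc eqxx in nbc.
- by rewrite db dE eqxx in nbc.
- by rewrite db dE ca eqxx in nab.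
Qed.

(** The boundary of [B] is the whole 3-cycle or empty. In the first case [A] and [B] differ by a
    constant. In the second [B] is everything, which contradicts that it is disjoint from [A]. *)
Lemma exterior_compl (A B : pred X) a b c o :
  vt (e a) = vt b -> vt (e b) = vt c -> vt (e c) = vt a -> uniq [:: vt a; vt b; vt c] ->
  (forall d, A (f d) = A d) -> (forall d, A d (+) A (e d) = on3 e a b c d) -> 
  (forall d, B (f d) = B d) -> (forall d, B d (+) B (e d) -> on3 e a b c d) ->
  B o -> (forall d, B d -> ~~ A d) -> forall d, B d = ~~ A d.
Proof.
move=> ab bc ca uq Af A3 Bf B3 Bo BA.
have uq' : uniq [:: vt b; vt c; vt a].
  by move: uq; rewrite -(rot_uniq 1).
have E1 := boundary_vertex ab bc ca uq Bf B3.
have rot d : on3 e b c a d = on3 e a b c d by rewrite /on3 orbA orbC.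
have E2 : B b (+) B (e b) = B c (+) B (e c).
  by apply: (boundary_vertex bc ca ab uq' Bf) => d; rewrite rot; apply: B3.
have B3E d : on3 e a b c d -> B d (+) B (e d) = B a (+) B (e a).
  by case/or3P => /orP [] /eqP ->; rewrite ?eK -?E2 -?E1 // addbC -?E2 -?E1.
have a3 : on3 e a b c a by rewrite /on3 /edge eqxx.
case Ba: (B a (+) B (e a)).
  have ABe d : A (e d) (+) B (e d) = A d (+) B d.
    have := A3 d; case d3: (on3 e a b c d).
      by have := B3E d d3; rewrite Ba; case: (A d); case: (A (e d)); case: (B d); case: (B (e d)).
    have : ~~ (B d (+) B (e d)) by apply: contraFN d3; apply: B3.
    by case: (A d); case: (A (e d)); case: (B d); case: (B (e d)).
  have ABf d : A (f d) (+) B (f d) = A d (+) B d by rewrite Af Bf.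
  move=> d; have := map_constf eK conn ABe ABf d o; rewrite Bo.
  have := BA o Bo; case: (A o) => // _; by case: (A d); case: (B d).
have Be d : B (e d) = B d.
  have : ~~ (B d (+) B (e d)).
    by apply/negP => h; have := B3E d (B3 d h); rewrite Ba h.
  by case: (B d); case: (B (e d)).
have Ball d : B d by rewrite (map_constf eK conn Be Bf d o).
by have := A3 a; rewrite a3 (negbTE (BA _ (Ball a))) (negbTE (BA _ (Ball (e a)))).
Qed.

End Side.

(** * The contraction of a facial 2-factor *)

Section Contraction.
Variables (D : finType) (e n : D -> D) (Q : {set D}).
Hypotheses (mapP : is_map e n) (connD : map_connected e n) (planar : planar_map e n).
Hypotheses (cub : cubic n) (simple : simple_map e n) (c3 : three_connected e n).
Hypothesis two : facial_2factor e n Q.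
Hypothesis face46 : forall d, d \notin Q -> order (gface e n) d \in [:: 4; 6].
Notation g := (gface e n).
Notation Hd := (Hdart e Q).

Lemma injn : injective n. Proof. by case: mapP. Qed.
Lemma eK : involutive e. Proof. by case: mapP. Qed.
Lemma e_ne d : e d != d. Proof. by case: mapP. Qed.
Lemma inj_e : injective e. Proof. exact: inv_inj eK. Qed.
Lemma injg : injective g. Proof. by move=> x y /injn /inj_e. Qed.

Lemma n3 x : n (n (n x)) = x.
Proof. by have := iter_order injn x; rewrite cub. Qed.

Lemma orbit_n x : orbit n x = [:: x; n x; n (n x)].
Proof. by rewrite /orbit cub. Qed.

Lemma fconnect_n x y : fconnect n x y = (y \in [:: x; n x; n (n x)]).
Proof. by rewrite fconnect_orbit orbit_n. Qed.

Lemma gQ d : (g d \in Q) = (d \in Q). Proof. by case: two. Qed.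
Lemma nQ d : (n d \in Q) = (e d \in Q). Proof. by rewrite -[RHS]gQ /gface eK. Qed.

Lemma Q_one x : (x \in Q) + (n x \in Q) + (n (n x) \in Q) = 1.
Proof.
have [_ /(_ x) <-] := two; have uo := orbit_uniq n x.
have -> : [set y in gvert n x | y \in Q] = [set y in filter (mem Q) (orbit n x)].
  by apply/setP => y; rewrite !inE mem_filter andbC -fconnect_orbit.
rewrite cardsE (card_uniqP _) ?filter_uniq // size_filter orbit_n /=.
by rewrite addn0 addnA.
Qed.

Lemma HdE d : Hd d = (n (n d) \in Q).
Proof. by have := Q_one d; rewrite /Hdart -nQ; case: (_ \in Q); case: (_ \in Q); case: (_ \in Q). Qed.

Lemma Hd_e d : Hd (e d) = Hd d. Proof. by rewrite /Hdart eK andbC. Qed.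

Lemma nHE d : Hd d -> nH e n Q d = n (e (n d)). Proof. by rewrite /nH => ->. Qed.

Lemma Hd_nH d : Hd (nH e n Q d) = Hd d.
Proof. by rewrite /nH; case: ifP => // h; rewrite HdE n3 -nQ -HdE h. Qed.

Lemma injnH : injective (nH e n Q).
Proof.
move=> x y h; have := congr1 Hd h; rewrite !Hd_nH; move: h; rewrite /nH => + xy.
by rewrite xy; case: ifP => // _ /injn /inj_e /injn.
Qed.

Lemma fHE d : Hd d -> fH e n Q d = g (g d).
Proof. by move=> h; rewrite /fH h nHE ?Hd_e. Qed.

Notation Hsub := {d : D | Hd d}.
Definition toH d (h : Hd d) : Hsub := exist _ d h.
Definition eH (x : Hsub) : Hsub := exist _ (e (val x)) (etrans (Hd_e _) (valP x)).
Definition rH (x : Hsub) : Hsub := exist _ (nH e n Q (val x)) (etrans (Hd_nH _) (valP x)).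
Definition hv (x : Hsub) := hvert e n Q (val x).
Notation f := (face eH rH).

Lemma val_f x : val (f x) = fH e n Q (val x).
Proof. by rewrite /= /fH (valP x). Qed.

Lemma eHK : involutive eH.
Proof. by move=> x; apply: val_inj; rewrite /= eK. Qed.
Lemma eH_ne x : eH x != x. Proof. by rewrite -val_eqE e_ne. Qed.
Lemma injrH : injective rH.
Proof. by move=> x y /(congr1 val) /= /injnH /val_inj. Qed.

Lemma hvP x y : (hv x == hv y) = fconnect rH x y.
Proof.
rewrite (@fconnect_conj _ _ predT rH (nH e n Q) val) //; last exact: in2W val_inj.
have sym := fconnect_sym injnH.
have hE z w : (z \in hv w) = fconnect (nH e n Q) (val w) z by rewrite inE.
apply/eqP/idP => [h|c]; first by rewrite -hE h hE connect0.
by apply/setP => z; rewrite !inE (same_connect sym c).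
Qed.

(** Every vertex of [G] carries exactly one dart of [H]; [rep] identifies the vertices of [G] with
    the darts of [H]. *)
Definition rep d := if Hd d then d else if Hd (n d) then n d else n (n d).

Lemma HdP d : Hd d \/ (Hd (n d) \/ Hd (n (n d))).
Proof.
rewrite !HdE !n3; have := Q_one d; case: (d \in Q); first by right; left.
by case: (n d \in Q); [right; right | case: (_ \in Q) => //; left].
Qed.

Lemma Hd_rep d : Hd (rep d).
Proof.
rewrite /rep; case: ifP => // h; case: ifP => // h'.
by case: (HdP d) => [|[]]; rewrite ?h ?h'.
Qed.

Lemma rep_in d : rep d \in [:: d; n d; n (n d)].
Proof. by rewrite /rep !inE; case: ifP => _; rewrite ?eqxx //; case: ifP => _; rewrite !eqxx ?orbT. Qed.

Lemma rep_n d : rep (n d) = rep d.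
Proof.
rewrite /rep !n3 !HdE !n3; have := Q_one d.
by case: (d \in Q); case: (n d \in Q); case: (n (n d) \in Q).
Qed.

Lemma rep_Hd d : Hd d -> rep d = d. Proof. by rewrite /rep => ->. Qed.
Lemma rep_Q d : d \in Q -> rep d = n d.
Proof. by move=> dQ; rewrite -rep_n rep_Hd // HdE n3. Qed.
Lemma rep_eQ d : d \in Q -> nH e n Q (rep (e d)) = rep d.
Proof.
move=> dQ; have h : Hd (n (n (e d))) by rewrite HdE n3 nQ eK.
by rewrite -rep_n -rep_n rep_Hd // nHE // n3 eK -rep_Q // rep_Q.
Qed.

Definition repH d : Hsub := exist _ (rep d) (Hd_rep d).

Lemma repH_val x : repH (val x) = x.
Proof. by apply: val_inj; rewrite /= rep_Hd // (valP x). Qed.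

Lemma repH_n d : repH (n d) = repH d. Proof. by apply: val_inj; rewrite /= rep_n. Qed.

(** An edge of [G] either is an edge of [H] or joins consecutive darts in a rotation of [H], so
    walks of [G] project to [H]. *)
Lemma repH_e d : [\/ [/\ Hd d & repH (e d) = eH (repH d)], rH (repH (e d)) = repH d |
  rH (repH d) = repH (e d)].
Proof.
have [h|] := boolP (Hd d).
  by constructor 1; split=> //; apply: val_inj; rewrite /= !rep_Hd ?Hd_e.
rewrite negb_and !negbK => /orP [h|h]; [constructor 2|constructor 3]; apply: val_inj; rewrite /=.
  exact: rep_eQ.
by rewrite -[in rep d](eK d) rep_eQ.
Qed.

Lemma connH x y : connect (fun a b => (b == eH a) || (b == rH a)) x y.
Proof.
rewrite -(repH_val x) -(repH_val y); case/connectP: (connD (val x) (val y)) => p + ->.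
elim: p (val x) => //= z p IH d /andP [dz pz].
apply: connect_trans (IH z pz); case/orP: dz => /eqP ->; last by rewrite repH_n.
have [[_ ->]|h|<-] := repH_e d.
- by apply: connect1; rewrite eqxx.
- by apply: (conn_sym eHK injrH); apply: connect1; rewrite h eqxx orbT.
- by apply: connect1; rewrite eqxx orbT.
Qed.

Lemma card_darts : #|D| = 3 * #|orbs n|.
Proof.
rewrite -cardsT /orbs -imset_T; apply: card_fibers => x _.
rewrite -(cub x) /order -cardsE; apply: eq_card => y.
by rewrite !inE orb_eqE 1?(fconnect_sym injn) //; exact: injn.
Qed.

Lemma card_gverts : #|orbs n| = #|{: Hsub}|.
Proof.
have -> : orbs n = [set orb n (val x) | x : Hsub].
  apply/setP => A; apply/imsetP/imsetP => [[d _ ->]|[x _ ->]]; last by exists (val x).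
  exists (repH d) => //; apply/eqP; rewrite orb_eqE //=; last exact: injn.
  by rewrite fconnect_n rep_in.
apply: card_imset => x y /eqP; rewrite orb_eqE; last exact: injn.
rewrite fconnect_n => xy; rewrite -[x]repH_val -[y]repH_val.
by move: xy; rewrite !inE => /or3P [] /eqP ->; rewrite ?repH_n.
Qed.

Lemma fconnect_g : fconnect g =2 fconnect (fun d => e (n (n d))).
Proof.
move=> x y; rewrite -(same_fconnect_finv injg); apply: eq_fconnect.
by apply: (finv_eq_can (f := g)) => d; rewrite /gface n3 eK.
Qed.

(** On [Q], [rep] conjugates the inverse of the face permutation to the rotation of [H]: going
    backwards around a contracted face is turning around its vertex. *)
Lemma card_Qfaces : #|orb g @: Q| = #|orbs rH|.
Proof.
have -> : orbs rH = (fun d => orb rH (repH d)) @: Q.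
  apply/setP => A; apply/imsetP/imsetP => [[x _ ->]|[d _ ->]]; last by exists (repH d).
  by exists (n (n (val x))); rewrite -?HdE ?(valP x) // !repH_n repH_val.
apply: card_imset_ker => d d' dQ dQ'; rewrite !orb_eqE; [|exact: injrH|exact: injg].
have sQ z : z \in Q -> e (n (n z)) \in Q by rewrite -nQ n3.
rewrite fconnect_g; apply: (fconnect_conj (P := mem Q)) => // [z zQ|x y xQ yQ].
  by apply: val_inj => /=; rewrite -(rep_eQ (sQ z zQ)) eK !rep_n.
by move/(congr1 val) => /=; rewrite !rep_Q // => /injn.
Qed.

Lemma Hd_g d : d \notin Q -> Hd (g d) = ~~ Hd d.
Proof. by rewrite HdE /gface n3 /Hdart => ->; rewrite negbK. Qed.

(** Along a face outside [Q] the darts of [H] are every second one, so a face of [H] is half as long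
    as the face of [G] it comes from. *)
Lemma fconnect_f x y : fconnect f x y = fconnect g (val x) (val y).
Proof.
have it i : val (iter i f x) = iter i.*2 g (val x).
  by elim: i => // i IH; rewrite doubleS !iterS val_f IH fHE // -IH (valP (iter i f x)).
have xQ : val x \notin Q by case/andP: (valP x).
have itQ i : iter i g (val x) \notin Q by elim: i => // i; rewrite iterS gQ.
have itH i : Hd (iter i g (val x)) = ~~ odd i.
  by elim: i => [|i IH]; rewrite ?(valP x) // iterS Hd_g // IH.
apply/idP/idP => /iter_findex yE; first by rewrite -yE it fconnect_iter.
set i := findex _ _ _ in yE; have := itH i; rewrite yE (valP y) => /esym oi.
have : val y = val (iter i./2 f x) by rewrite it even_halfK // yE.
by move/val_inj ->; apply: fconnect_iter.
Qed.

Lemma injfH : injective f. Proof. exact: injf eHK injrH. Qed.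

Lemma card_Hfaces : #|orb g @: (~: Q)| = #|orbs f|.
Proof.
have -> : orb g @: (~: Q) = (fun x : Hsub => orb g (val x)) @: setT.
  apply/setP => A; apply/imsetP/imsetP => [[d + ->]|[x _ ->]]; last first.
    by exists (val x); rewrite // inE; case/andP: (valP x).
  rewrite inE => dQ.
  have [hd|hd] := boolP (Hd d); first by exists (toH hd).
  have hg : Hd (g d) by rewrite Hd_g.
  by exists (toH hg) => //; apply/eqP; rewrite orb_eqE ?fconnect1 //; exact: injg.
rewrite /orbs -imset_T; apply: card_imset_ker => x y _ _.
by rewrite !orb_eqE ?fconnect_f //; [exact: injfH | exact: injg].
Qed.

Lemma eulerH : 2 * (#|orbs rH| + #|orbs f|) = #|{: Hsub}| + 4.
Proof.
have pl : 2 * (#|orbs n| + #|orbs g|) = #|D| + 4 by exact: planar.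
have gU : orbs g = orb g @: Q :|: orb g @: (~: Q) by rewrite -imsetU setUCr imset_T.
have dis : orb g @: Q :&: orb g @: (~: Q) = set0.
  apply/setP => A; rewrite !inE; apply/negbTE/negP => /andP [/imsetP [x xQ ->] /imsetP [y]].
  rewrite inE => yQ /eqP; rewrite orb_eqE => [/iter_findex|]; last exact: injg.
  have itQ i : iter i g x \in Q by elim: i => // i; rewrite iterS gQ.
  by move=> yE; move: yQ; rewrite -yE itQ.
have := cardsUI (orb g @: Q) (orb g @: (~: Q)); rewrite -gU dis cards0 addn0 card_Qfaces card_Hfaces.
move: pl; rewrite card_darts card_gverts.
lia_card.
Qed.

Lemma face23H x : (f (f x) == x) || (f (f (f x)) == x).
Proof.
have val_fg y : val (f y) = g (g (val y)) by rewrite val_f fHE // (valP y).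
have xQ : val x \notin Q by case/andP: (valP x).
have := iter_order injg (val x); have := face46 xQ; rewrite !inE => /orP [] /eqP -> /= h.
  by apply/orP; left; rewrite -val_eqE !val_fg h.
by apply/orP; right; rewrite -val_eqE !val_fg h.
Qed.

Lemma face_ne x : f x != x.
Proof.
apply/eqP => fx; have := orbit_uniq g (val x); have := face46 (proj1 (andP (valP x))).
have gg : g (g (val x)) = val x by have := congr1 val fx; rewrite val_f fHE // (valP x).
by rewrite /orbit => /predU1P [->|/predU1P [->|//]] /=; rewrite gg !inE eqxx ?orbT ?andbF.
Qed.

Lemma rH_ne x : rH x != x.
Proof.
apply/eqP => /(congr1 val) /=; rewrite nHE; last exact: valP.
rewrite -{2}(n3 (val x)) => /injn h.
by have [/(_ (n (val x)))] := simple; rewrite h fconnect_n !inE eqxx orbT.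
Qed.

(* A loop gives a potential that distinguishes its two sides, so that the ends
   of the loop would form a 2-vertex cut of [G]. *)
Lemma looplessH x : hv (eH x) != hv x.
Proof.
rewrite hvP (fconnect_sym injrH); apply/negP => xe.
pose z (y : Hsub) : rat := ((y == x)%:R - (y == eH x)%:R)%R.
have xne : x == eH x = false by apply/negbTE; rewrite eq_sym eH_ne.
have zE y : z (eH y) = (- z y)%R.
  by rewrite /z opprB -{1}[x]eHK !(inj_eq (inv_inj eHK)).
have zS y : (\sum_(d in orb rH y) z d = 0)%R.
  have E w : (\sum_(d in orb rH y) (d == w)%:R = (w \in orb rH y)%:R :> rat)%R.
    rewrite big_mkcond (bigD1 w) //= eqxx big1 ?addr0; first by case: ifP.
    by move=> d /negbTE ->; case: ifP.
  rewrite sumrB !E !inE (same_connect_r (fconnect_sym injrH) xe) subrr //.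
have [a [af az]] := potential eHK eH_ne injrH connH eulerH zE zS.
have an y : a (rH y) = a (eH y) by rewrite -[RHS]af /= eHK.
have ae y : y != x -> y != eH x -> a (eH y) = a y.
  move=> yx yex; have := az y; rewrite /z (negbTE yx) (negbTE yex) subrr => /eqP.
  by rewrite subr_eq0 => /eqP.
have rc d d' : fconnect n d d' -> repH d' = repH d.
  by rewrite fconnect_n !inE => /or3P [] /eqP ->; rewrite ?repH_n.
have step u w : ~~ fconnect n (val x) u -> ~~ fconnect n (val (eH x)) u ->
    ~~ fconnect n (val x) w -> ~~ fconnect n (val (eH x)) w ->
    (w == e u) || (w == n u) -> a (repH w) = a (repH u).
  have rn d (y : Hsub) : ~~ fconnect n (val y) d -> repH d != y.
    by apply: contraNneq => <-; rewrite (fconnect_sym injn) fconnect_n rep_in.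
  move=> /rn ux /rn uex /rn wx /rn wex /orP [] /eqP wE; last by rewrite wE repH_n.
  move: wx wex; rewrite wE => wx wex; have [[_ ->]|<-|<-] := repH_e u; first exact: ae.
    by rewrite an ae.
  by rewrite an ae.
have avoid (y y' : Hsub) : y != x -> y != eH x -> y' != x -> y' != eH x -> a y = a y'.
  have nf (u w : Hsub) : u != w -> ~~ fconnect n (val w) (val u).
    by apply: contra => /rc; rewrite !repH_val => ->.
  move=> /nf yx /nf yex /nf y'x /nf y'ex; have [_ /(_ _ _ _ _ yx yex y'x y'ex)] := c3.
  rewrite -{2}[y]repH_val -{2}[y']repH_val.
  case/connectP => p; elim: p (val y) yx yex => [|w p IH] u ux uex /=; first by move=> _ ->.
  case/andP => /and3P [wx wex uw] pw lw; rewrite -(step u w) //.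
  exact: IH pw lw.
(* As vertices of [G], [rH x] and [rH (eH x)] avoid both ends of the loop. Their values are
   [a (eH x)] and [a x], which differ by [z x = 1]. *)
have n1 : rH x != eH x by have := face_ne (eH x); rewrite /face eHK.
have n2 : rH (eH x) != x by have := face_ne x.
have := avoid _ _ (rH_ne x) n1 n2 (rH_ne (eH x)); rewrite !an eHK => h.
by have := az x; rewrite -h subrr /z eqxx xne subr0 => /eqP; rewrite eq_sym oner_eq0.
Qed.

Variable o : D.
Hypotheses (HdO : Hd o) (triO : tri_face e n Q o).
Hypothesis even : forall t, htriangle e n Q t -> ~~ odd (n_inside e n Q o t).
Definition oH : Hsub := toH HdO.

Lemma triH (x : Hsub) : tri_face e n Q (val x) -> tri eH rH x.
Proof.
case/andP => _ /=; rewrite !inE !negb_or => /andP [/andP [_ h] _]; apply: contra h.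
by move/eqP/(congr1 val); rewrite !val_f => ->.
Qed.

Lemma parityH (a b c : Hsub) (A : pred Hsub) :
  hv (eH a) = hv b -> hv (eH b) = hv c -> hv (eH c) = hv a ->
  uniq [:: hv a; hv b; hv c] -> (forall d, A (f d) = A d) ->
  (forall d, A d (+) A (eH d) = on3 eH a b c d) -> ~~ A oH ->
  ~~ odd #|side hv A [set hv a; hv b; hv c]|.
Proof.
move=> ab bc ca uq Af A3 Ao; pose t := [:: val a; val b; val c].
have fH_c x y : fconnect rH x y = fconnect (nH e n Q) (val x) (val y).
  by apply: (@fconnect_conj _ _ predT) => //; apply: in2W val_inj.
have ht : htriangle e n Q t.
  rewrite /htriangle andbT; apply/and3P; split; first by rewrite /= !valP.
    exact: uq.
  by rewrite /= -![e (val _)]/(val (eH _)) -!fH_c -!hvP ab bc ca !eqxx.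
have on3E (x : Hsub) : on_cycle_edge e t (val x) = on3 eH a b c x.
  rewrite /on_cycle_edge /on3 /edge !inE -!val_eqE /=.
  rewrite -(inj_eq inj_e (e _)) eK -(inj_eq inj_e (e (val x))) eK -(inj_eq inj_e (e (val x))) eK.
  by do 6!case: eqP.
(* Reachability from [o] defines the exterior. By [exterior_compl] it is the whole complement of
   [A], so the vertices on the side [A] are the interior ones. *)
pose B (x : Hsub) := exterior e n Q o t (val x).
have BA x : B x -> ~~ A x.
  case/connectP => p; rewrite -[o]/(val oH); elim: p oH Ao => [|w p IH] y Ay /=.
    by move=> _ /val_inj ->.
  case/andP => /and3P [hy hw yw] pw lw; apply: (IH (toH hw)) pw lw.
  case/orP: yw => [/eqP wE|/andP [/eqP wE]].
    have -> : toH hw = f y by apply: val_inj; rewrite val_f.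
    by rewrite Af.
  have -> : toH hw = eH y by apply: val_inj.
  by rewrite on3E -A3; case: (A y) Ay; case: (A (eH y)).
have stepf x : B x -> B (f x).
  move=> Bx; apply: connect_trans Bx (connect1 _); rewrite /dual_step -val_f.
  by rewrite !(valP x) (valP (f x)) eqxx.
have Bf x : B (f x) = B x.
  apply/idP/idP => [h|/stepf //].
  have Bi i : B (iter i f (f x)) by elim: i => // i; rewrite iterS => /stepf.
  have := Bi (findex f (f x) x); rewrite iter_findex // fconnect_sym ?fconnect1 //.
  exact: injfH.
have B3 x : B x (+) B (eH x) -> on3 eH a b c x.
  apply: contraTT; rewrite -on3E => nx.
  have s y z : eH y = z -> ~~ on_cycle_edge e t (val y) -> B y -> B z.
    move=> <- ny By; apply: connect_trans By (connect1 _).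
    by rewrite /dual_step (valP y) (valP (eH y)) /= eqxx ny orbT.
  have nex : ~~ on_cycle_edge e t (val (eH x)).
    by move: nx; rewrite /on_cycle_edge /= eK orbC.
  have := s x _ erefl nx; have := s (eH x) x (eHK x) nex.
  by case: (B x); case: (B (eH x)) => // h1 h2; [apply: h2 | apply: h1].
have Bo : B oH by apply: connect0.
have BE := exterior_compl eHK injrH connH hvP ab bc ca uq Af A3 Bf B3 Bo BA.
rewrite -[side _ _ _](_ : [set hvert e n Q x | x : D & interior_vertex e n Q o t x] = _); first exact: even.
have onv (x : Hsub) : on_cycle_vertex e n Q t (val x) = (hv x \in [set hv a; hv b; hv c]).
  by rewrite /on_cycle_vertex /= !inE ![hv x == _]eq_sym !hvP !fH_c orbF orbA.
apply/setP => v; apply/imsetP/idP => [[d + ->]|].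
  rewrite inE => /and3P [hd vd ed]; pose x : Hsub := toH hd.
  rewrite inE -[hvert e n Q d]/(hv x) imset_f //; apply/existsP; exists x.
  by rewrite -[A x]negbK -BE -onv eqxx; apply/and3P.
rewrite inE => /andP [_ /existsP [x /and3P [Ax /eqP <- xv]]].
by exists (val x) => //; rewrite inE /interior_vertex (valP x) onv xv -/(B x) BE Ax.
Qed.

Lemma conj_orb (S T : finType) (s : S -> S) (t : T -> T) (h : S -> T) x :
  (forall z, h (s z) = t (h z)) -> [set y | fconnect t (h x) y] = h @: orb s x.
Proof.
move=> hst; have it i : h (iter i s x) = iter i t (h x) by elim: i => //= i <-.
apply/setP => y; rewrite inE; apply/idP/imsetP => [/iter_findex <-|[z + ->]].
  by rewrite -it; exists (iter (findex t (h x) y) s x) => //; rewrite inE fconnect_iter.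
by rewrite inE => /iter_findex <-; rewrite it fconnect_iter.
Qed.

Lemma hfaceE (x : Hsub) : hface e n Q (val x) = val @: orb f x.
Proof. exact: (@conj_orb _ _ f (fH e n Q) val x val_f). Qed.

Lemma hvE (x : Hsub) : hv x = val @: orb rH x.
Proof. by apply: (@conj_orb _ _ rH (nH e n Q) val x). Qed.

Let vuniq := tri_uniq hvP looplessH face23H.

Lemma tri_faceH (x : Hsub) : tri eH rH x -> tri_face e n Q (val x).
Proof.
move=> tx; have uq := vuniq tx; rewrite /tri_face -!val_f uq andbT.
set v := val x; have f3v : fH e n Q (fH e n Q (fH e n Q v)) = v by rewrite -!val_f (face_tri3 face23H tx).
have fv : fcycle (fH e n Q) [:: v; fH e n Q v; fH e n Q (fH e n Q v)] by rewrite /= f3v !eqxx.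
have uv : uniq [:: v; fH e n Q v; fH e n Q (fH e n Q v)].
  by apply: (@map_uniq _ _ (hvert e n Q)); rewrite /v -!val_f; exact: uq.
by rewrite (order_cycle fv uv) ?mem_head.
Qed.

Lemma vt_fH (x : Hsub) : hv (f x) = hv (eH x).
Proof. exact: (vt_n hvP). Qed.

(** * Spanning tree and Hamiltonian cycle from the grown faces *)

Section Grown.
Variables (r : Hsub) (s : seq Hsub).
Hypotheses (gs : grow eH rH hv [set hv r] s).
Hypothesis os : forall x, x \in s -> oH \notin [:: x; f x; f (f x)].
Let U := face_union eH rH s.
Let S : {set D} := val @: U.

Lemma UP (x : Hsub) : reflect (exists2 z, z \in s & fconnect f z x) (x \in U).
Proof.
rewrite inE; apply: (iffP hasP) => -[z zs h]; exists z => //; move: h; by rewrite (fconnect_face face23H).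
Qed.

Lemma U_f (x y : Hsub) : x \in U -> fconnect f x y -> y \in U.
Proof. by case/UP => z zs zx xy; apply/UP; exists z => //; apply: connect_trans xy. Qed.

Lemma U_tri (x : Hsub) : x \in U -> tri eH rH x.
Proof. by case/UP => z zs zx; rewrite -(tri_fconnect eHK injrH zx) (grow_tri gs zs). Qed.

Lemma grow_cover t (C : {set {set D}}) v : grow eH rH hv C t -> v \in verts hv ->
  v \in C \/ exists2 x, x \in face_union eH rH t & hv x = v.
Proof.
elim: t C => [|z t IH] C /=; first by move=> /eqP -> ; left.
case/and5P => tz zC _ _ gt vv; have [|[x xt xv]] := IH _ gt vv; last first.
  by right; exists x => //; move: xt; rewrite !inE /= => ->; rewrite orbT.
rewrite inE => /orP [/(vf_corner eHK injrH face23H tz) [x [_ _ xv xz]]|]; last by left.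
by right; exists x => //; rewrite inE /= xz.
Qed.

Lemma U_cover (x : Hsub) : exists2 y, y \in U & hv y = hv x.
Proof.
have sn : s != [::].
  apply: contraTneq gs => ->; apply/negP => /= /eqP rv.
  have vv y : hv y = hv r by apply/eqP; rewrite -in_set1 rv imset_f.
  by have := looplessH r; rewrite !vv eqxx.
have xv : hv x \in verts hv by exact: imset_f.
have [|[y yU yx]] := grow_cover gs xv; last by exists y.
rewrite inE => /eqP ->; case: s gs sn (UP) => //= z t /and5P [_ + _ _ _] _ zU.
by rewrite inE => /eqP zr; exists z => //; apply/zU; exists z; rewrite ?mem_head.
Qed.

Lemma inc_adjC : symmetric (@inc_adj D).
Proof. by move=> p q; rewrite /inc_adj eq_sym setIC. Qed.

Lemma inc_adj_vf (x y : Hsub) : tri eH rH y ->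
  inc_adj (hv x, false) (hface e n Q (val y), true) = (hv x \in vf eH rH hv y).
Proof.
move=> ty; rewrite /inc_adj /= hfaceE hvE; apply/set0Pn/idP => [[z]|].
  rewrite inE => /andP [/imsetP [w + ->] /imsetP [w' + /val_inj ww']].
  rewrite -{}ww' !inE => xw; rewrite (fconnect_face face23H) -hvE.
  rewrite -hvP in xw; rewrite (eqP xw) !inE.
  by case/or3P => /eqP ->; rewrite eqxx ?orbT.
rewrite -hvE => /(vf_corner eHK injrH face23H ty) [z [_ _ zx zy]]; exists (val z).
have zr : z \in orb rH x by rewrite inE -hvP zx.
have zf : z \in orb f y by rewrite inE (fconnect_face face23H).
by rewrite hvE inE !imset_f.
Qed.

Lemma hface_eq (x y : Hsub) : (hface e n Q (val x) == hface e n Q (val y)) = fconnect f x y.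
Proof. by rewrite !hfaceE (inj_eq (imset_inj val_inj)) orb_eqE //; exact: injfH. Qed.

Lemma vf_fconnect (x y : Hsub) : tri eH rH x -> fconnect f x y -> vf eH rH hv x = vf eH rH hv y.
Proof.
move=> tx; rewrite (fconnect_face face23H) !inE => /or3P [] /eqP -> //; first by rewrite (vf_f hv face23H).
by rewrite (vf_f hv face23H) ?(vf_f hv face23H) ?(tri_f eHK injrH).
Qed.

Lemma grown_tree : is_tree (inc_node e n Q S) (@inc_adj D).
Proof.
pose nv (v : {set D}) := (v, false); pose nf (x : Hsub) := (hface e n Q (val x), true).
have [||||||||||zs [ts nd]] :=
  @grow_tree_seq _ _ eH rH hv _ _ nv nf inc_adjC _ _ _ _ _ _ vuniq s [set hv r] [::] [:: nv (hv r)] _ _ _ _ gs.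
- by [].
- by [].
- by move=> u y ty /imsetP [x _ ->]; apply: inc_adj_vf.
- by move=> u v _ _ [].
- by move=> u y; rewrite xpair_eqE andbF.
- by move=> x y tx _ [/eqP]; rewrite hface_eq; apply: vf_fconnect.
- by rewrite sub1set imset_f.
- by [].
- by [].
- move=> z; rewrite inE; split => [/eqP ->|]; first by left; exists (hv r); rewrite ?set11.
  by case=> [[u /set1P -> ->]|[]].
apply: (tree_seq_is_tree inc_adjC ts) => -[A b].
rewrite -[_ \in inc_node _ _ _ _]/(inc_node e n Q S (A, b)); apply/idP/idP => [|/nd].
  case: b => /existsP [d /andP [dS /eqP /= ->]]; apply/nd.
    right; case/imsetP: dS => x /UP [z zs' zx] ->; exists z; first by rewrite cats0 mem_rev.
    by congr (_, _); apply/esym/eqP; rewrite hface_eq.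
  by left; exists (hv (toH dS)); rewrite ?imset_f.
case=> [[u /imsetP [x _ ->] [-> ->]]|[x xs [-> ->]]]; apply/existsP.
  by exists (val x); rewrite (valP x) /=.
rewrite cats0 mem_rev in xs; exists (val x); rewrite eqxx andbT imset_f //.
by apply/UP; exists x.
Qed.

(** Two faces that share the ends of an edge would form a 4-cycle with them in the incidence
    graph. *)
Lemma grown_disjoint (x y : Hsub) : x \in U -> y \in U -> hv x \in vf eH rH hv y ->
  hv (f x) \in vf eH rH hv y -> fconnect f x y.
Proof.
move=> xU yU xy fxy; have [_ ac] := grown_tree; apply/negPn/negP => nxy.
pose nv (v : {set D}) := (v, false); pose nf (x : Hsub) := (hface e n Q (val x), true).
have tx := U_tri xU; have ty := U_tri yU.
have Pv w : inc_node e n Q S (nv (hv w)) by apply/existsP; exists (val w); rewrite (valP w) /=.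
have Pf w : w \in U -> inc_node e n Q S (nf w).
  by move=> wU; apply/existsP; exists (val w); rewrite imset_f /=.
have := ac [:: nv (hv x); nf x; nv (hv (f x)); nf y].
have a1 := inc_adj_vf x tx; have a2 := inc_adj_vf (f x) tx; have a3 := inc_adj_vf (f x) ty.
have a4 := inc_adj_vf x ty.
have x1 : hv x \in vf eH rH hv x by rewrite !inE eqxx.
have x2 : hv (f x) \in vf eH rH hv x by rewrite !inE eqxx orbT.
rewrite x1 in a1; rewrite x2 in a2; rewrite fxy in a3; rewrite xy in a4.
rewrite /= a1 a3 (inc_adjC (nf x)) a2 (inc_adjC (nf y)) a4 !Pv !Pf //= => /(_ isT) h.
have /h : uniq [:: nv (hv x); nf x; nv (hv (f x)); nf y]; last by move/(_ isT).
rewrite /= !inE !xpair_eqE !andbF !orbF !andbT hface_eq nxy.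
by have := vuniq tx; rewrite /= !inE negb_or -!andbA => /and4P [-> _ _ _].
Qed.

Lemma grown_edges (x y : Hsub) : x \in U -> y \in U -> ~~ fconnect f x y ->
  ~ same_edge e n Q o (val x) (val y).
Proof.
move=> xU yU nxy se.
have fH_c u w : fconnect rH u w = fconnect (nH e n Q) (val u) (val w).
  by apply: (@fconnect_conj _ _ predT) => //; apply: in2W val_inj.
suff [h1 h2] : hv x \in [set hv y; hv (eH y)] /\ hv (eH x) \in [set hv y; hv (eH y)].
  have sub : [set hv y; hv (eH y)] \subset vf eH rH hv y.
    by rewrite subUset !sub1set -vt_fH !inE !eqxx orbT.
  by case/negP: nxy; apply: grown_disjoint; rewrite // ?vt_fH; apply: (subsetP sub).
case: se => [[|] yx|[a [b [hd ax bx _]]]].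
- by have -> : y = x by [apply: val_inj]; rewrite !inE !eqxx orbT.
- have -> : y = eH x by apply: val_inj.
  by rewrite eHK !inE !eqxx orbT.
have ex (d : D) (z : Hsub) : d = val z \/ d = e (val z) -> exists2 w, d = val w & w = z \/ w = eH z.
  by case=> ->; [exists z | exists (eH z)] => //; [left | right].
have [a' aE ax'] := ex _ _ ax; have [b' bE bx'] := ex _ _ bx.
move: hd; rewrite aE bE => /and3P [/and3P [_ _]]; rewrite /= andbT => /andP [].
rewrite -![e (val _)]/(val (eH _)) -!fH_c -!hvP => /eqP h1 /eqP h2 _ _.
by case: ax' h1 h2 => ->; case: bx' => -> h1 h2; rewrite ?eHK in h1 h2; rewrite !inE ?h1 ?h2 ?eqxx ?orbT.
Qed.

Lemma grown_spanning : spanning_tree_of_triangles e n Q o S.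
Proof.
have fH_c u w : fconnect f u w = fconnect (fH e n Q) (val u) (val w).
  by apply: (@fconnect_conj _ _ predT) => //; [move=> z _; exact: val_f | apply: in2W val_inj].
split; [| | | |split].
- by move=> _ /imsetP [x _ ->]; apply: valP.
- move=> _ /imsetP [x xU ->]; rewrite hfaceE imsetS //; apply/subsetP => y.
  by rewrite inE; apply: U_f.
- move=> _ /imsetP [x /UP [z zs zx] ->]; apply/negP; rewrite -[o]/(val oH) -fH_c => ox.
  have := os zs; rewrite -(fconnect_face face23H) (fconnect_sym injfH) => /negP; apply.
  by apply: connect_trans ox _; rewrite (fconnect_sym injfH).
- by move=> _ /imsetP [x /U_tri tx ->]; apply: tri_faceH.
- move=> _ _ /imsetP [x xU ->] /imsetP [y yU ->]; rewrite -fH_c; exact: grown_edges.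
- move=> d hd; have [y yU yd] := U_cover (toH hd).
  by exists (val y); [apply: imset_f | exact: yd].
- exact: grown_tree.
Qed.

(** The darts of [H] are the vertices of [G], and the single orbit of [turn] visits each of them
    once; each turn is a step along an edge of [G]. *)
Lemma grown_hamiltonian : hamiltonian e n.
Proof.
have one := turn_single eHK injrH hvP face23H vuniq gs.
have injt : injective (turn eH rH U).
  apply: (turn_inj eHK injrH) => x xU; apply: U_f xU _; exact: fconnect1.
(* The dart by which the cycle leaves a vertex of [G]: the edge of [H] if the walk crosses to the
   other end, otherwise the dart in [Q], which leads back to the previous dart of the rotation. *)
pose out (x : Hsub) := if x \in U then val x else n (n (val x)).
have out_n x : gvert n (out x) = gvert n (val x).
  apply/eqP; rewrite (orb_eqE _ _ injn) (fconnect_sym injn) fconnect_n /out.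
  by case: ifP => _; rewrite !inE eqxx ?orbT.
have gv_inj : injective (fun x : Hsub => gvert n (val x)).
  move=> x y /eqP; rewrite (orb_eqE _ _ injn) fconnect_n => xy.
  by rewrite -[x]repH_val -[y]repH_val; move: xy; rewrite !inE => /or3P [] /eqP ->; rewrite ?repH_n.
have all_orb x : x \in orbit (turn eH rH U) oH by rewrite -fconnect_orbit.
have gvE : map (gvert n) (map out (orbit (turn eH rH U) oH)) = map (fun x => gvert n (val x)) (orbit (turn eH rH U) oH).
  by rewrite -map_comp; apply: eq_map => x /=; apply: out_n.
exists (map out (orbit (turn eH rH U) oH)); split.
- rewrite size_map size_orbit /order; have [c4 _] := c3.
  apply: leq_trans (ltnW c4) _; rewrite -[X in X <= _]/#|orbs n| card_gverts.
  by apply: subset_leq_card; apply/subsetP => x _; apply: one.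
- by rewrite gvE map_inj_uniq ?orbit_uniq.
- move=> d; have -> : gvert n d = gvert n (val (repH d)).
    by apply/eqP; rewrite (orb_eqE _ _ injn) fconnect_n rep_in.
  by rewrite -out_n !map_f.
rewrite cycle_map; apply: sub_cycle (cycle_orbit injt oH) => x _ /= /eqP <-.
have out_v y : fconnect n (val y) (out y) by rewrite -(orb_eqE _ _ injn) -![orb _ _]/(gvert _ _) out_n.
rewrite {1}/out /turn; case: ifP => xU; first exact: out_v (eH x).
set y := finv rH x; have /(congr1 val) /= : rH y = x by rewrite f_finv //; exact: injrH.
rewrite nHE; last exact: valP.
move=> <-; rewrite n3 eK; apply: connect_trans (out_v y).
by rewrite (fconnect_sym injn) fconnect1.
Qed.

End Grown.
Lemma spanning_and_hamiltonian :
  (exists S, spanning_tree_of_triangles e n Q o S) /\ hamiltonian e n.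
Proof.
have [r [s [gs os]]] := triangle_growth eHK eH_ne injrH connH hvP eulerH looplessH face23H
  (@triH oH triO) parityH.
split; last exact: grown_hamiltonian gs.
by eexists; apply: grown_spanning gs os.
Qed.

End Contraction.

Theorem theorem3 (D : finType) (e n : D -> D) (Q : {set D}) (o : D) :
  is_map e n -> map_connected e n -> planar_map e n ->
  cubic n -> simple_map e n -> three_connected e n ->
  facial_2factor e n Q ->
  (forall d, d \notin Q -> order (gface e n) d \in [:: 4; 6]) ->
  Hdart e Q o -> tri_face e n Q o ->
  (forall t, htriangle e n Q t -> ~~ odd (n_inside e n Q o t)) ->
  (forall t1 t2 dg, direct_successor e n Q o t1 t2 ->
     hdigon e n Q dg -> separating e n Q o dg ->
     region e n Q o dg \subset region e n Q o t2 -> False) ->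
  (exists S, spanning_tree_of_triangles e n Q o S) /\ hamiltonian e n.
Proof.
move=> mapP connD planar cub simple c3 two face46 HdO triO even _.
exact: spanning_and_hamiltonian HdO triO even.
Qed.
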